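(* Let $A\in\mathbb{C}^{m\times n}$ have singular values $\sigma_1\ge\sigma_2\ge\cdots$, let $k\ge 1$ be an integer (the target truncation term), let $p\ge 2$ be an integer (the oversampling parameter), and let $q\ge 0$ be an integer (the number of iterations). Assume $\sigma_k>0$ and that the singular value gap $\tau_k:=\sigma_{k+1}/\sigma_k$ satisfies $\tau_k<1$. Let $W\in\mathbb{R}^{n\times(k+p)}$ be a Gaussian random matrix, and let $Q$ be the matrix with orthonormal columns obtained from the randomized subspace iteration with $q$ iterations applied to $A$ with starting matrix $W$. Then $$\mathbb{E}\,\|A-QQ^{\rm H}A\|_{\rm F}^2\;\le\;\left(1+\frac{k}{p-1}\,\tau_k^{4q}\right)\left(\sum_{j=k+1}^{\min\{m,n\}}\sigma_j^2\right).$$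
   Context: A Gaussian random matrix has independent standard normal entries. The superscript ${\rm H}$ denotes conjugate transpose and $\|\cdot\|_{\rm F}$ the Frobenius norm. By convention $\sigma_j=0$ for $j>\min\{m,n\}$. Randomized subspace iteration with $q$ iterations: form $Y_0=AW$ and compute a thin QR factorization $Y_0=Q_0R_0$. For $i=1,\dots,q$: form $\tilde Y_i=A^{\rm H}Q_{i-1}$ and compute a thin QR factorization $\tilde Y_i=\tilde Q_i\tilde R_i$; then form $Y_i=A\tilde Q_i$ and compute a thin QR factorization $Y_i=Q_iR_i$. Output $Q=Q_q$. In each QR factorization the first factor has orthonormal columns spanning the range of the matrix being factored; thus $\operatorname{range}(Q)=\operatorname{range}\big((AA^{\rm H})^qAW\big)$. *)

(* Defs.v *)
From HB Require Import structures.
From mathcomp Require Import all_boot all_order all_algebra.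
From mathcomp Require Import complex.
From mathcomp Require Import all_classical all_reals all_analysis.

Set Implicit Arguments.
Unset Strict Implicit.
Unset Printing Implicit Defensive.

Import Order.TTheory GRing.Theory Num.Theory.

Local Open Scope ring_scope.
Local Open Scope complex_scope.
Local Open Scope sesquilinear_scope.
Local Open Scope classical_set_scope.

Section LinearAlgebra.
Context {R : realType}.

Definition cmatrix m n (M : 'M[R]_(m, n)) : 'M[R[i]]_(m, n) :=
  map_mx (real_complex R) M.

Definition frobenius_norm m n (M : 'M[R[i]]_(m, n)) : R :=
  Num.sqrt (\sum_i \sum_j Normc.normc (M i j) ^+ 2).

(* Square roots of the eigenvalues of A^H A, counted with multiplicity.  These
   eigenvalues are real and nonnegative, so Re only changes the type; when
   m < n, the entries dropped by take are zero. *)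
Definition singular_values m n (A : 'M[R[i]]_(m, n)) : seq R :=
  take (minn m n)
    (sort >=%R [seq Num.sqrt (complex.Re (spectral_diag (A ^t* *m A) 0 j))
               | j <- enum 'I_n]).

(* The index j starts at 1, and sigma A j = 0 for j > minn m n. The value at
   j = 0 is irrelevant. *)
Definition sigma m n (A : 'M[R[i]]_(m, n)) (j : nat) : R :=
  nth 0 (singular_values A) j.-1.

Definition gap m n (A : 'M[R[i]]_(m, n)) (k : nat) : R :=
  sigma A k.+1 / sigma A k.

(* A rank-deficient Y is allowed: Q has exactly rank Y columns, since they are
   orthonormal and span the column space of Y.  Column spaces are compared as
   row spaces of transposes; is_trig_mx means lower triangular. *)
Definition thin_qr m l r (Y : 'M[R[i]]_(m, l)) (Q : 'M[R[i]]_(m, r))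
    (T : 'M[R[i]]_(r, l)) : Prop :=
  [/\ Y = Q *m T, Q ^t* *m Q = 1%:M, (Q^T == Y^T)%MS & is_trig_mx T^T].

(* Q is a possible output after q iterations started from W; the predicate is
   a relation because QR factors are not unique, and the widths of the
   intermediate factors are existentially quantified. *)
Fixpoint subspace_iteration m n l (A : 'M[R[i]]_(m, n)) (W : 'M[R[i]]_(n, l))
    (q r : nat) (Q : 'M[R[i]]_(m, r)) : Prop :=
  match q with
  | 0 => exists T0, thin_qr (A *m W) Q T0
  | q'.+1 =>
      exists (r0 : nat) (Q0 : 'M[R[i]]_(m, r0))
             (r1 : nat) (Q1 : 'M[R[i]]_(n, r1)) T1 T,
        [/\ subspace_iteration A W q' Q0,
            thin_qr (A ^t* *m Q0) Q1 T1 &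
            thin_qr (A *m Q1) Q T]
  end.

End LinearAlgebra.

Section GaussianMatrix.
Context {d : measure_display} {T : measurableType d} {R : realType}.
Variable P : probability T R.

Definition mutually_independent (I : finType) (X : I -> {RV P >-> R}) : Prop :=
  forall (J : {set I}) (B : I -> set R),
    (forall i, i \in J -> measurable (B i)) ->
    P (\bigcap_(i in [set` J]) (X i @^-1` B i))
    = (\prod_(i in J) P (X i @^-1` B i))%E.

Definition standard_normal (X : {RV P >-> R}) : Prop :=
  forall B : set R, measurable B -> distribution P X B = normal_prob 0 1 B.

Definition gaussian_matrix n l (W : 'I_n -> 'I_l -> {RV P >-> R}) : Prop :=
  (forall i j, standard_normal (W i j)) /\
  mutually_independent (fun ij : 'I_n * 'I_l => W ij.1 ij.2).

Definition sample n l (W : 'I_n -> 'I_l -> {RV P >-> R}) (w : T) : 'M[R]_(n, l) :=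
  \matrix_(i, j) W i j w.

End GaussianMatrix.

(* Main.v *)
(** The singular directions of the complex matrix A are not real, so the blocks
    V1^H W and V2^H W of the real Gaussian W are not independent and the usual
    computation with a pseudo-inverse does not apply.  The proof goes instead
    through the ridge residual
      resid B W = min over Z of (1 - W Z)^H B (1 - W Z) + Z^H Z.

    Since 1 - Q Q^H annihilates (A A^H)^q A W, the error, weighted on the j-th
    right singular vector by sigma_j^(4q), is at most tr (H D D^H) with
    H = (A^H A)^(2q+1), for every D = 1 - W Z.  Taking Z optimal for a matrix B
    with H <= t B bounds this by t tr (resid B W), so a bound on
    E tr (resid B W) is needed.

    (1) If B = b + (t - 1) b P with b real and positive and P a projector
    commuting with b, the resolvent structure of resid and Gaussian integration
    by parts give the sharp bound.

    (2) The function B |-> E tr (resid B W) is midpoint concave, being a minimum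
    of functions affine in B, and is invariant under conjugation by real
    orthogonal matrices.  Invariance under coordinate reflections comes from
    sign flips of the entries of W; integration by parts shows that rotating B
    by a small angle changes the expectation only to second order, hence it is
    the same for all reflections.  Consequently pinching B by real projectors
    can only increase the expectation.

    (3) For a Hermitian projector P, the identity is a sum of orthogonal real
    projectors of rank at most 2 commuting with P, on each of which 1 - P has
    rank at most 1 (diagonalize the real part of P).  Pinching
    Lam b P + X + eta (1 - P), with X the tail of H, by these blocks gives a
    matrix as in (1); then t and eta tend to 0. *)

Require Import Defs.
From HB Require Import structures.
From mathcomp Require Import all_boot all_order all_algebra.
From mathcomp Require Import complex.
From mathcomp Require Import all_classical all_reals all_analysis.
From mathcomp Require Import ring lra measurable_realfun.

Set Implicit Arguments.
Unset Strict Implicit.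
Unset Printing Implicit Defensive.

Import Order.TTheory GRing.Theory Num.Theory numFieldNormedType.Exports.

Local Open Scope classical_set_scope.
Local Open Scope ring_scope.

(** * Gaussian integration by parts *)

(** The constant comes from Stein's identity for the field F P V, where V is the sample, F =
    [resid B V] and P is the projector of rank k. With D the defect of [B], the identity contains tr
    (P D) and tr (P conj(D) F); the conjugate appears because V is real while F is only Hermitian.
    For l = k + p the quotient of the two factors is (k + p - 1) / (p - 1) = 1 + k / (p - 1). The
    additive k does not scale with b: it is made negligible by applying the bound to a matrix
    divided by eta and multiplying the result by eta.

    The obstacle is the reality of b, since the tail X is complex. Pinching has to turn X into b (1
    - P) with b real without changing its trace. Where 1 - P has rank at most one, the compression
    of X is a multiple of 1 - P, so b can be taken scalar on each block, hence real. *)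

Section StandardNormal.
Context {R : realType}.
Local Notation mu := (@lebesgue_measure R).
Local Notation N01 := (normal_prob (0 : R) 1).
Local Notation pdf := (normal_pdf (0 : R) 1).

Lemma normal_pdf01E (x : R) :
  pdf x = normal_peak (1 : R) * expR (- (x ^+ 2 / 2)).
Proof.
by rewrite normal_pdfE ?oner_neq0//= /normal_fun subr0 expr1n mulNr.
Qed.

(** The change of variables uses the abstract Radon-Nikodym derivative. It agrees almost everywhere
    with [pdf] because both have the same integral over every measurable set. *)
Lemma ge0_integral_normal (f : R -> R) : measurable_fun setT f ->
  (forall x, 0 <= f x) ->
  (\int[N01]_x (f x)%:E = \int[mu]_x (f x * pdf x)%:E)%E.
Proof.
move=> mf f0.
have dom : N01 `<< mu by exact: normal_prob_dominates.
rewrite -(@Radon_Nikodym_SigmaFinite.change_of_variables _ _ _ N01 mu dom)//; last first.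
- exact/measurable_EFinP.
under [in RHS]eq_integral do rewrite EFinM.
apply: ae_eq_integral => //.
- apply: emeasurable_funM; first exact/measurable_EFinP.
  apply: (measurable_int mu).
  exact: Radon_Nikodym_SigmaFinite.f_integrable.
- apply: emeasurable_funM; apply/measurable_EFinP => //.
  exact: measurable_normal_pdf.
apply: ae_eqe_mul2l.
apply: integral_ae_eq => //.
- exact: Radon_Nikodym_SigmaFinite.f_integrable.
- by apply/measurable_EFinP; exact: measurable_normal_pdf.
- by move=> E _ mE; rewrite -Radon_Nikodym_SigmaFinite.f_integral.
Qed.

Lemma integrable_normalP (f : R -> R) : measurable_fun setT f ->
  (N01.-integrable setT (EFin \o f) <->
   mu.-integrable setT (fun x => (f x * pdf x)%:E)).
Proof.
move=> mf.
have mfp : measurable_fun setT (fun x => f x * pdf x).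
  by apply: measurable_funM => //; exact: measurable_normal_pdf.
have E : (\int[N01]_x `|(f x)%:E| = \int[mu]_x `|(f x * pdf x)%:E|)%E.
  under eq_integral do rewrite abse_EFin.
  rewrite (ge0_integral_normal (f := fun x => `|f x|))//; last first.
    exact: measurableT_comp.
  apply: eq_integral => x _.
  by rewrite abse_EFin normrM [`|pdf _|]ger0_norm// normal_pdf_ge0.
split=> /integrableP[_ h]; apply/integrableP; split.
- exact/measurable_EFinP.
- by rewrite -E.
- exact/measurable_EFinP.
- by rewrite E.
Qed.

Lemma integral_normal (f : R -> R) : measurable_fun setT f ->
  N01.-integrable setT (EFin \o f) ->
  (\int[N01]_x (f x)%:E = \int[mu]_x (f x * pdf x)%:E)%E.
Proof.
move=> mf intf.
have mfp : measurable_fun setT (fun x => Num.max (f x) 0).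
  by apply: measurable_maxr.
have mfn : measurable_fun setT (fun x => Num.max (- f x) 0).
  by apply: measurable_maxr => //; exact: measurable_funN.
rewrite [LHS]integralE [RHS]integralE; congr (_ - _)%E.
- rewrite (_ : _^\+%E = fun x => (Num.max (f x) 0)%:E)%E; last first.
    by apply/funext => x; rewrite funeposE EFin_max.
  rewrite ge0_integral_normal//; last by move=> x; rewrite le_max lexx orbT.
  apply: eq_integral => x _; rewrite funeposE -EFin_max; congr _%:E.
  by rewrite maxr_pMl ?normal_pdf_ge0// mul0r.
- rewrite (_ : _^\-%E = fun x => (Num.max (- f x) 0)%:E)%E; last first.
    by apply/funext => x; rewrite funenegE -EFinN EFin_max.
  rewrite ge0_integral_normal//; last by move=> x; rewrite le_max lexx orbT.
  apply: eq_integral => x _; rewrite funenegE -EFinN -EFin_max; congr _%:E.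
  by rewrite maxr_pMl ?normal_pdf_ge0// mul0r mulNr.
Qed.

Lemma pdfN (x : R) : pdf (- x) = pdf x.
Proof. by rewrite !normal_pdf01E sqrrN. Qed.

Lemma lebesgue_measureN (A : set R) : measurable A ->
  mu (-%R @^-1` A) = mu A.
Proof.
move=> mA.
have mN : measurable_fun setT (-%R : measurableTypeR R -> measurableTypeR R).
  exact: measurable_funN.
pose nu' : {measure set (measurableTypeR R) -> \bar R} :=
  pushforward mu (-%R : measurableTypeR R -> measurableTypeR R).
rewrite -[LHS]/(nu' mN A); apply/esym.
apply: lebesgue_measure_unique => // _ [[x y] _ <-].
rewrite /= /pushforward.
have -> : -%R @^-1` `]x, y]%classic = `[- y, - x[%classic.
  by apply/seteqP; split=> z /=; rewrite !in_itv/= lerNl ltrNr andbC.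
by rewrite !lebesgue_measure_itv/= !lte_fin ltrN2 opprK addeC.
Qed.

Lemma ge0_integral_normalN (f : R -> R) : measurable_fun setT f ->
  (forall x, 0 <= f x) ->
  (\int[N01]_x (f (- x))%:E = \int[N01]_x (f x)%:E)%E.
Proof.
move=> mf f0.
have mN : measurable_fun setT (-%R : measurableTypeR R -> measurableTypeR R).
  exact: measurable_funN.
rewrite !ge0_integral_normal//; last exact: measurableT_comp.
under eq_integral do rewrite -pdfN.
rewrite -(@ge0_integral_pushforward _ _ _ _ _ _ mN mu setT
  (fun x => (f x * pdf x)%:E))//.
- apply: eq_measure_integral => A mA _; exact: lebesgue_measureN.
- apply/measurable_EFinP; apply: measurable_funM => //.
  exact: measurable_normal_pdf.
- by move=> x _; rewrite lee_fin mulr_ge0// normal_pdf_ge0.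
Qed.

(** Half of the exponent absorbs the quadratic factor, since (1 + x^2) exp (- x^2 / 4) <= 5. The
    other half is a multiple of the normal density of variance 2, which is integrable. *)
Lemma integrable_normal_sqr_bound (f : R -> R) (K : R) :
  measurable_fun setT f -> (forall x, `|f x| <= K * (1 + x ^+ 2)) ->
  N01.-integrable setT (EFin \o f).
Proof.
move=> mf fK; apply/integrable_normalP => //.
have s2 : Num.sqrt 2 != 0 :> R by rewrite sqrtr_eq0 -ltNge.
have K0 : 0 <= K.
  by have := fK 0; rewrite expr0n addr0 mulr1; apply: le_trans.
apply: (@le_integrable _ _ _ mu _ measurableT _
  (fun x => (K * 5 * normal_peak 1 / normal_peak (Num.sqrt 2))%:E
     * (normal_pdf 0 (Num.sqrt 2) x)%:E)%E).
- apply/measurable_EFinP; apply: measurable_funM => //.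
  exact: measurable_normal_pdf.
- move=> x _; rewrite /= lee_fin.
  set p1 := normal_peak (1 : R); set p2 := normal_peak (Num.sqrt (2 : R)).
  have p1_ge0 : 0 <= p1 by exact: normal_peak_ge0.
  have p2_gt0 : 0 < p2 by exact: normal_peak_gt0.
  pose a := x ^+ 2 / 4; pose e := expR (- a).
  have e0 : 0 <= e by exact: expR_ge0.
  have ea : (1 + x ^+ 2) * e <= 5.
    rewrite /e expRN ler_pdivrMr ?expR_gt0//.
    have := expR_ge1Dx a; have := sqr_ge0 x; rewrite /a; lra.
  have -> : pdf x = p1 * (e * e).
    by rewrite normal_pdf01E -expRD; congr (_ * expR _); rewrite /a; field.
  have -> : normal_pdf 0 (Num.sqrt 2) x = p2 * e.
    rewrite (normal_pdfE _ s2) /normal_fun subr0 sqr_sqrtr//.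
    by congr (_ * expR _); rewrite /a -[2 *+ 2]mulr_natr; field.
  rewrite normrM [`|p1 * _|]ger0_norm ?mulr_ge0//.
  have -> : K * 5 * p1 / p2 * (p2 * e) = K * 5 * p1 * e.
    by field; rewrite gt_eqF.
  rewrite [leRHS]ger0_norm ?mulr_ge0//.
  have -> : K * 5 * p1 * e = K * p1 * e * 5 by ring.
  apply: (@le_trans _ _ (K * p1 * e * ((1 + x ^+ 2) * e))); last first.
    by rewrite ler_wpM2l// !mulr_ge0.
  have -> : K * p1 * e * ((1 + x ^+ 2) * e) = K * (1 + x ^+ 2) * (p1 * (e * e)).
    by ring.
  by rewrite ler_wpM2r// !mulr_ge0.
- apply: integrableZl => //; exact: integrable_normal_pdf.
Qed.

End StandardNormal.

Section NormalIntegrationByParts.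
Context {R : realType}.
Local Notation mu := (@lebesgue_measure R).
Local Notation N01 := (normal_prob (0 : R) 1).
Local Notation pdf := (normal_pdf (0 : R) 1).

Lemma is_derive_normal_pdf (x : R) : is_derive x 1 pdf (- x * pdf x).
Proof.
rewrite (_ : pdf = fun x => normal_peak 1 * expR (- (x ^+ 2 / 2))); last first.
  by apply/funext => y; rewrite normal_pdf01E.
have h : is_derive x 1 (fun x : R => - (x ^+ 2 / 2)) (- x).
  by apply: is_derive_eq; rewrite /GRing.scale /=; field.
have h2 : is_derive x 1 (expR \o (fun x : R => - (x ^+ 2 / 2)))
    (expR (- (x ^+ 2 / 2)) * (- x)).
  exact: is_derive1_comp.
rewrite (_ : - x * _ = normal_peak 1 *: (expR (- (x ^+ 2 / 2)) * (- x))).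
  exact: is_deriveZ.
by rewrite /GRing.scale /=; ring.
Qed.

(** The function [F] = u pdf has derivative [h] = (u' - x u) pdf. The integral of [h] over growing
    symmetric intervals is a difference of boundary values of [F], and these tend to 0. *)
Lemma stein1D (u u' : R -> R) (K : R) :
  (forall x : R, is_derive x 1 u (u' x)) -> continuous u' ->
  (forall x, `|u x| <= K * (1 + `|x|)) ->
  (forall x, `|u' x| <= K * (1 + x ^+ 2)) ->
  (\int[N01]_x (u' x)%:E = \int[N01]_x (x * u x)%:E)%E.
Proof.
move=> du cu' uK u'K.
have K0 : 0 <= K.
  by have := uK 0; rewrite normr0 addr0 mulr1; apply: le_trans.
have cu : continuous u.
  by move=> x; apply/differentiable_continuous/derivable1_diffP; case: (du x).
have mu_ : measurable_fun setT u by exact: continuous_measurable_fun.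
have mu'_ : measurable_fun setT u' by exact: continuous_measurable_fun.
have mxu : measurable_fun setT (fun x : R => x * u x) by exact: measurable_funM.
have ixu : N01.-integrable setT (EFin \o (fun x => x * u x)).
  apply: (@integrable_normal_sqr_bound _ _ (2 * K)) => // x.
  rewrite normrM.
  apply: (@le_trans _ _ (`|x| * (K * (1 + `|x|)))); first by rewrite ler_wpM2l.
  rewrite -(real_normK (num_real x)).
  have -> : `|x| * (K * (1 + `|x|)) = K * (`|x| + `|x| ^+ 2) by ring.
  have -> : 2 * K * (1 + `|x| ^+ 2) = K * (2 + 2 * `|x| ^+ 2) by ring.
  rewrite ler_wpM2l//; have := sqr_ge0 (`|x| - 1); nra.
have iu' : N01.-integrable setT (EFin \o u').
  exact: (@integrable_normal_sqr_bound _ _ K).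
pose F x := u x * pdf x.
pose h x := u' x * pdf x - x * u x * pdf x.
have dF (x : R) : is_derive x 1 F (h x).
  rewrite (_ : h x = u x *: (- x * pdf x) + pdf x *: u' x).
    by have hp := is_derive_normal_pdf x; exact: is_deriveM.
  by rewrite /h /GRing.scale /=; ring.
have cpdf : continuous pdf by apply: continuous_normal_pdf; exact: oner_neq0.
have ch : continuous h.
  move=> x; apply: cvgB; first by apply: cvgM; [exact: cu'|exact: cpdf].
  by apply: cvgM; [apply: cvgM; [exact: cvg_id|exact: cu]|exact: cpdf].
have mh : measurable_fun setT h by exact: continuous_measurable_fun.
have ih : mu.-integrable setT (EFin \o h).
  rewrite (_ : _ \o _ = (fun x => (u' x * pdf x)%:E) \- (fun x => (x * u x * pdf x)%:E))%E//.
  by apply: integrableB => //; apply/integrable_normalP.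
suff h0 : (\int[mu]_x (h x)%:E = 0)%E.
  rewrite (integral_normal mu'_ iu') (integral_normal mxu ixu).
  have iA : mu.-integrable setT (fun x => (u' x * pdf x)%:E).
    exact/integrable_normalP.
  have iB : mu.-integrable setT (fun x => (x * u x * pdf x)%:E).
    exact/(integrable_normalP mxu).
  have : ((\int[mu]_x (u' x * pdf x)%:E - \int[mu]_x (x * u x * pdf x)%:E) = 0)%E.
    by rewrite -h0 -integralB_EFin.
  by move/eqP; rewrite sube_eq ?integrable_fin_num// ?add0e => /eqP.
(* The bound is [n.+1] and not [n] because the fundamental theorem of calculus is applied on an
   interval with distinct endpoints. *)
pose hn n : R -> \bar R := (EFin \o h) \_ `[- n.+1%:R, n.+1%:R].
have hn_h : (\int[mu]_x hn n x @[n --> \oo] --> \int[mu]_x (h x)%:E)%E.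
  have [] := @dominated_convergence _ _ _ mu setT measurableT hn (EFin \o h)
    (fun x => `|(h x)%:E|)%E.
  - move=> n; apply/(measurable_restrict _ _ _).1 => //.
    by rewrite setTI; apply: measurable_funTS; apply/measurable_EFinP.
  - exact/measurable_EFinP.
  - apply/aeW => x _; apply: cvg_near_cst.
    exists (Num.truncn `|x|) => // n /= ltxn.
    rewrite /hn patchE mem_set//= in_itv/= -ler_norml.
    apply: ltW; apply: (lt_le_trans (truncnS_gt _)).
    by rewrite ler_nat.
  - exact: integrable_abse.
  - apply/aeW => x n _; rewrite /hn patchE; case: ifP => // _.
    by rewrite abse0.
  - by [].
have hnE n : (\int[mu]_x hn n x = (F n.+1%:R)%:E - (F (- n.+1%:R))%:E)%E.
  rewrite /hn -integral_mkcond.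
  apply: continuous_FTC2.
  - by rewrite gtrN.
  - exact: continuous_subspaceT.
  - have cF : continuous F.
      move=> x; apply/differentiable_continuous/derivable1_diffP.
      by case: (dF x).
    split.
    + by move=> x _; case: (dF x).
    + exact/cvg_at_right_filter/cF.
    + exact/cvg_at_left_filter/cF.
  - by move=> x _; rewrite derive1E; case: (dF x).
have {}hnE : (fun n => \int[mu]_x hn n x)%E = (EFin \o (fun n => F n.+1%:R - F (- n.+1%:R))).
  by apply/funext => n; rewrite hnE.
rewrite hnE in hn_h.
have F0 : (F n.+1%:R - F (- n.+1%:R)) @[n --> \oo] --> (0 : R).
  set p1 := normal_peak (1 : R).
  have p1_ge0 : 0 <= p1 by exact: normal_peak_ge0.
  (* A decay rate for the squeeze below: (1 + |x|)^2 <= 2 (1 + x^2) <= 4 (1 + x^2 / 2) <= 4 exp (x^2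
     / 2). *)
  have FK x : `|F x| * (1 + `|x|) <= 4 * (K * p1).
    rewrite /F normrM [`|pdf x|]ger0_norm ?normal_pdf_ge0//.
    have h1 : (1 + `|x|) ^+ 2 * expR (- (x ^+ 2 / 2)) <= 4.
      rewrite expRN ler_pdivrMr ?expR_gt0//.
      have := expR_ge1Dx (x ^+ 2 / 2); have := real_normK (num_real x).
      have := sqr_ge0 (`|x| - 1); nra.
    apply: (@le_trans _ _ (K * (1 + `|x|) * pdf x * (1 + `|x|))).
      by rewrite !ler_wpM2r ?addr_ge0 ?normal_pdf_ge0.
    rewrite normal_pdf01E -/p1.
    have -> : K * (1 + `|x|) * (p1 * expR (- (x ^+ 2 / 2))) * (1 + `|x|) =
      (K * p1) * ((1 + `|x|) ^+ 2 * expR (- (x ^+ 2 / 2))) by ring.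
    by rewrite [leRHS]mulrC ler_wpM2l// mulr_ge0.
  apply: norm_cvg0.
  apply: (@squeeze_cvgr _ _ _ _ (cst 0) (fun n => (8 * (K * p1)) * n.+1%:R^-1)).
  - apply: nearW => n; rewrite normr_ge0/= ler_pdivlMr ?ltr0n//.
    set N := n.+1%:R; have N0 : 0 <= N by exact: ler0n.
    have e1 := FK N; have e2 := FK (- N).
    rewrite normrN in e2; rewrite (ger0_norm N0) in e1 e2.
    apply: (le_trans (ler_wpM2r N0 (ler_normB _ _))).
    have := normr_ge0 (F N); have := normr_ge0 (F (- N)); lra.
  - exact: cvg_cst.
  - rewrite -[X in _ --> X](mulr0 (8 * (K * p1))).
    by apply: cvgMr; exact: cvg_harmonic.
have F0' : ((F n.+1%:R - F (- n.+1%:R))%:E @[n --> \oo] --> (0 : \bar R))%E.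
  by apply: cvg_EFin => //; exact: nearW.
exact: cvg_unique hn_h F0'.
Qed.
End NormalIntegrationByParts.

(** * Gaussian matrices: measurability, resampling of one entry, expectations *)

Section MatrixSigmaAlgebra.
Context {R : realType} (n l : nat).

(* Matrices carry no measurable structure in the library; this is the product
   sigma-algebra, generated by the rectangles. *)
Definition mx_rect : set (set 'M[R]_(n, l)) :=
  [set A | exists2 B : 'I_n -> 'I_l -> set R, (forall i j, measurable (B i j)) &
     A = [set V : 'M[R]_(n, l) | forall i j, B i j (V i j)]].

Definition mx_space := g_sigma_algebraType mx_rect.

Lemma measurable_mx_coord i j :
  measurable_fun setT (fun V : mx_space => (V : 'M[R]_(n, l)) i j).
Proof.
move=> _ A mA; rewrite setTI; apply: sub_sigma_algebra.
exists (fun a b => if (a == i) && (b == j) then A else setT) => [a b|].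
  by case: ifP.
apply/seteqP; split=> V /=; last by move=> /(_ i j); rewrite !eqxx.
by move=> AV a b; case: ifP => // /andP[/eqP-> /eqP->].
Qed.

Lemma measurable_mxP d (X : measurableType d) (F : X -> mx_space) :
  (forall i j, measurable_fun setT (fun x => (F x : 'M[R]_(n, l)) i j)) ->
  measurable_fun setT F.
Proof.
move=> mF; apply: (@measurability _ _ X mx_space setT F mx_rect) => //.
move=> _ [_ [B mB ->] <-]; rewrite setTI.
rewrite (_ : _ @^-1` _ = \bigcap_(i in [set: 'I_n]) \bigcap_(j in [set: 'I_l])
    ((fun x => (F x : 'M[R]_(n, l)) i j) @^-1` B i j)); last first.
  apply/seteqP; split => x /=; first by move=> h i _ j _; exact: h.
  by move=> h i j; exact: (h i I j I).
apply: fin_bigcap_measurable => // i _; apply: fin_bigcap_measurable => // j _.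
by rewrite -[X in measurable X]setTI; exact: mF.
Qed.

Definition set_entry (i : 'I_n) (j : 'I_l) (x : R) (V : 'M[R]_(n, l)) : 'M[R]_(n, l) :=
  \matrix_(a, b) if (a == i) && (b == j) then x else V a b.

End MatrixSigmaAlgebra.

Section GaussianLaw.
Context {d : measure_display} {T : measurableType d} {R : realType}.
Variables (P : probability T R) (n l : nat) (W : 'I_n -> 'I_l -> {RV P >-> R}).
Hypothesis hW : gaussian_matrix W.
Local Notation N01 := (normal_prob (0 : R) 1).
Local Notation MT := (@mx_space R n l).

Lemma measurable_sample : measurable_fun setT (sample W : T -> MT).
Proof.
apply: measurable_mxP => i j.
rewrite (_ : (fun _ => _) = W i j); first exact: measurable_funP.
by apply/funext => w; rewrite /sample mxE.
Qed.

Lemma measurable_set_entry_sample i j : measurable_fun setT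
  (fun z : R * T => set_entry i j z.1 (sample W z.2) : MT).
Proof.
apply: measurable_mxP => a b.
have [/= ab|/= ab] := boolP ((a == i) && (b == j)).
  rewrite (_ : (fun _ => _) = fst); first exact: measurable_fst.
  by apply/funext => z; rewrite mxE ab.
rewrite (_ : (fun _ => _) = W a b \o snd).
  by apply: measurableT_comp => //; exact: measurable_snd.
by apply/funext => z; rewrite !mxE (negbTE ab).
Qed.

Lemma prob_rect (B : 'I_n -> 'I_l -> set R) :
  (forall i j, measurable (B i j)) ->
  P [set w | forall i j, B i j (W i j w)] = (\prod_i \prod_j N01 (B i j))%E.
Proof.
move=> mB; have [hN hI] := hW.
have := hI [set: 'I_n * 'I_l]%SET (fun ij => B ij.1 ij.2) (fun ij _ => mB ij.1 ij.2).
rewrite (_ : \bigcap_(_ in _) _ = [set w | forall i j, B i j (W i j w)]); last first.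
  apply/seteqP; split => w /=; first by move=> h i j; exact: (h (i, j) (finset.in_setT _)).
  by move=> h [i j] _; exact: h.
move=> ->; rewrite pair_bigA /=; apply: eq_big => [ij|ij _]; first by rewrite finset.inE.
by rewrite -(hN ij.1 ij.2 (B ij.1 ij.2)).

Qed.

(** Replacing one entry by a fresh independent normal variable does not change the law, so
    one-dimensional results can be applied entry by entry without building the joint law as an
    iterated product. Rectangles form a generating pi-system, so agreement on them suffices. *)
Lemma resample_rect i j (A : set MT) : measurable A ->
  P (sample W @^-1` A) =
  (N01 \x P)%E ((fun z : R * T => set_entry i j z.1 (sample W z.2) : MT) @^-1` A).
Proof.
move=> mA.
pose m1 : {measure set MT -> \bar R} := pushforward P (sample W : T -> MT).
pose m2 : {measure set MT -> \bar R} := pushforward (N01 \x P)%E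
  (fun z : R * T => set_entry i j z.1 (sample W z.2) : MT).
pose m1' := m1 measurable_sample; pose m2' := m2 (measurable_set_entry_sample i j).
rewrite -[LHS]/(m1' A) -[RHS]/(m2' A).
apply: (@measure_unique _ R MT (@mx_rect R n l) (fun=> setT) erefl _ _ _ m1' m2' _ _ A mA).
- move=> _ _ [B mB ->] [C mC ->]; exists (fun i j => B i j `&` C i j).
    by move=> a b; exact: measurableI.
  apply/seteqP; split => V /=; first by move=> [h1 h2] a b; split; [exact: h1|exact: h2].
  by move=> h; split=> a b; case: (h a b).
- by move=> _; exists (fun _ _ => setT) => //; apply/seteqP; split.
- by apply/seteqP; split => // V _; exists 0%N.
- move=> _ [B mB ->].
  rewrite /m1' /m2' /m1 /m2 /= /pushforward.
  rewrite (_ : _ @^-1` _ = [set w | forall i j, B i j (W i j w)]); last first.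
    by apply/seteqP; split => w /= h a b; have := h a b; rewrite mxE.
  rewrite prob_rect//.
  (* The overwritten entry of the sample is unconstrained; its condition [B i j] moves to the fresh
     variable. *)
  pose B' a b := if (a == i) && (b == j) then setT else B a b.
  rewrite (_ : _ @^-1` _ = B i j `*` [set w | forall a b, B' a b (W a b w)]); last first.
    apply/seteqP; split => -[x w] /=.
      move=> h; split; first by have := h i j; rewrite mxE !eqxx.
      move=> a b; have := h a b; rewrite /B' !mxE; case: ifP => //.
    move=> [h1 h2] a b; have := h2 a b; rewrite /B' !mxE; case: ifP => //.
    by move=> /andP[/eqP-> /eqP->].
  have mB' a b : measurable (B' a b) by rewrite /B'; case: ifP.
  have mBW : measurable [set w | forall a b, B' a b (W a b w)].
    rewrite (_ : mkset _ = \bigcap_(i in [set: 'I_n]) \bigcap_(j in [set: 'I_l])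
      (W i j @^-1` B' i j)); last first.
      apply/seteqP; split => x /=; first by move=> h a _ b _; exact: h.
      by move=> h a b; exact: (h a I b I).
    apply: fin_bigcap_measurable => // a _; apply: fin_bigcap_measurable => // b _.
    by rewrite -[X in measurable X]setTI; exact: measurable_funP.
  transitivity (N01 (B i j) * P [set w | forall a b, B' a b (W a b w)])%E; last first.
    by apply/esym; apply: product_measure1E => //; exact: mB.
  rewrite [X in (_ * X)%E](prob_rect mB').
  rewrite !pair_bigA/= (bigD1 (i, j))//= [in RHS](bigD1 (i, j))//=.
  have -> : B' i j = setT by rewrite /B' !eqxx.
  rewrite probability_setT mul1e; congr (_ * _)%E.
  apply: eq_bigr => -[a b]; rewrite xpair_eqE /B' => /negbTE -> //.
- by move=> _; apply: (le_lt_trans (probability_le1 P measurableT)); exact: ltry.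
Qed.

End GaussianLaw.

Section GaussianExpectation.
Context {d : measure_display} {T : measurableType d} {R : realType}.
Variables (P : probability T R) (n l : nat) (W : 'I_n -> 'I_l -> {RV P >-> R}).
Hypothesis hW : gaussian_matrix W.
Local Notation N01 := (normal_prob (0 : R) 1).
Local Notation MT := (@mx_space R n l).
Implicit Types (f g : 'M[R]_(n, l) -> R) (V : 'M[R]_(n, l)).

Let NP : {measure set (measurableTypeR R * T) -> \bar R} := (N01 \x P)%E.

Let phi i j := fun z : measurableTypeR R * T => set_entry i j z.1 (sample W z.2) : MT.

Lemma ge0_resample i j f : measurable_fun setT (f : MT -> R) -> (forall V, 0 <= f V) ->
  (\int[P]_w (f (sample W w))%:E =
   \int[P]_w \int[N01]_x (f (set_entry i j x (sample W w)))%:E)%E.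
Proof.
move=> mf f0.
transitivity (\int[(N01 \x P)%E]_z (f (phi i j z))%:E)%E.
  rewrite -[LHS](@ge0_integral_pushforward _ _ _ _ _ _ (measurable_sample W) P setT
    (EFin \o f))//; first last.
  - by move=> V _; rewrite lee_fin.
  - exact/measurable_EFinP.
  rewrite -[RHS](@ge0_integral_pushforward _ _ (measurableTypeR R * T)%type _ _ _
    (measurable_set_entry_sample W i j)
    NP setT (EFin \o f))//; first last.
  - by move=> V _; rewrite lee_fin.
  - exact/measurable_EFinP.
  pose m1 : {measure set MT -> \bar R} := pushforward P (sample W : T -> MT).
  pose m2 : {measure set MT -> \bar R} := pushforward NP (phi i j).
  apply: (@eq_measure_integral _ MT R setT (m2 (measurable_set_entry_sample W i j))
    (m1 (measurable_sample W))) => A mA _.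
  exact: (resample_rect hW).
rewrite -[LHS]/(\int[(N01 \x P)%E]_z (EFin \o f \o phi i j) z)%E.
rewrite [LHS]fubini_tonelli2//.
- apply/measurable_EFinP; apply: (measurableT_comp mf).
  exact: measurable_set_entry_sample.
- by move=> z; rewrite lee_fin.
Qed.

(** The signed counterpart of [ge0_resample]. Integrability over the product, needed for Fubini,
    comes from Tonelli for the absolute value, whose double integral is again an expectation by
    resampling. *)
Lemma resample0 i j f : measurable_fun setT (f : MT -> R) ->
  P.-integrable setT (fun w => (f (sample W w))%:E) ->
  (forall V, \int[N01]_x (f (set_entry i j x V))%:E = 0)%E ->
  (\int[P]_w (f (sample W w))%:E = 0)%E.
Proof.
move=> mf intf f0.
have mphi := measurable_set_entry_sample W i j.
have mfp : measurable_fun setT (fun z => f (phi i j z)) by exact: measurableT_comp.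
have iphi : (N01 \x P)%E.-integrable setT (fun z => (f (phi i j z))%:E).
  apply/integrableP; split; first exact/measurable_EFinP.
  rewrite (@fubini_tonelli2 _ _ _ _ _ N01 P (fun z => `|(f (phi i j z))%:E|)%E)//; last first.
    by apply: measurableT_comp => //; exact/measurable_EFinP.
  rewrite /fubini_G.
  under eq_integral do under eq_integral do rewrite abse_EFin.
  rewrite -(@ge0_resample i j (fun V => `|f V|))//; last exact: measurableT_comp.
  have /integrableP[_] := intf.
  by under eq_integral do rewrite abse_EFin.
transitivity (\int[(N01 \x P)%E]_z (f (phi i j z))%:E)%E; last first.
  rewrite -integral21_prod_meas1// /fubini_G.
  transitivity (\int[P]_x (cst 0 x))%E; last by rewrite integral0.
  by apply: eq_integral => w _; rewrite /= -[RHS](f0 (sample W w)).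
rewrite -[LHS](@integral_pushforward _ _ _ _ _ _ (measurable_sample W) P setT
    (EFin \o f))//; last exact/measurable_EFinP.
rewrite -[RHS](@integral_pushforward _ _ (measurableTypeR R * T)%type _ _ _
    (measurable_set_entry_sample W i j)
    NP setT (EFin \o f))//; last exact/measurable_EFinP.
pose m1 : {measure set MT -> \bar R} := pushforward P (sample W : T -> MT).
pose m2 : {measure set MT -> \bar R} := pushforward NP (phi i j).
apply: (@eq_measure_integral _ MT R setT (m2 (measurable_set_entry_sample W i j))
  (m1 (measurable_sample W))) => A mA _.
exact: (resample_rect hW).
Qed.

(** A single integrable weight, 1 plus the squared Frobenius norm, that dominates every integrand
    below. *)
Definition wt (V : 'M[R]_(n, l)) : R := 1 + \sum_i \sum_j V i j ^+ 2.

Definition tame f := measurable_fun setT (f : MT -> R) /\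
  exists K, forall V, `|f V| <= K * wt V.

Definition Ex f : R := \int[P]_w f (sample W w).

Lemma wt_ge1 V : 1 <= wt V.
Proof. by rewrite lerDl sumr_ge0// => i _; rewrite sumr_ge0// => j _; rewrite sqr_ge0. Qed.

Lemma wt_ge V i j : 1 + V i j ^+ 2 <= wt V.
Proof.
rewrite lerD2l (bigD1 i)//= (bigD1 j)//= -addrA lerDl addr_ge0//.
  by rewrite sumr_ge0// => b _; rewrite sqr_ge0.
by rewrite sumr_ge0// => a _; rewrite sumr_ge0// => b _; rewrite sqr_ge0.
Qed.

Lemma measurable_entry_sqr i j :
  measurable_fun setT (fun V : MT => (V : 'M[R]_(n, l)) i j ^+ 2).
Proof. by apply: measurable_funX; exact: measurable_mx_coord. Qed.

Lemma measurable_wt : measurable_fun setT (wt : MT -> R).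
Proof.
apply: measurable_funD => //.
apply: measurable_sum => i; apply: measurable_sum => j.
exact: measurable_entry_sqr.
Qed.

Lemma integrable_entry_sqr i j :
  P.-integrable setT (fun w => (sample W w i j ^+ 2)%:E).
Proof.
apply/integrableP; split.
  apply/measurable_EFinP.
  apply: (measurableT_comp (measurable_entry_sqr i j)); exact: measurable_sample.
under eq_integral do rewrite abse_EFin.
rewrite (@ge0_resample i j (fun V => `|V i j ^+ 2|))//; last first.
  by apply: measurableT_comp => //; exact: measurable_entry_sqr.
have : N01.-integrable setT (EFin \o (fun x : R => x ^+ 2)).
  apply: (@integrable_normal_sqr_bound _ _ 1) => // x.
  by rewrite mul1r ger0_norm ?sqr_ge0// lerDr.
move/integrableP => [_ h].
set c := (X in (X < _)%E) in h.
rewrite (_ : (\int[P]_w _)%E = (\int[P]_w c)%E); last first.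
  by apply: eq_integral => w _; apply: eq_integral => x _; rewrite mxE !eqxx abse_EFin.
by rewrite integral_cst//= probability_setT mule1.
Qed.

Lemma integrable_wt : P.-integrable setT (fun w => (wt (sample W w))%:E).
Proof.
rewrite /wt.
rewrite (_ : (fun _ => _) = (cst 1 \+ fun w => \sum_i \sum_j (sample W w i j ^+ 2)%:E)%E); last first.
  apply/funext => w /=; rewrite EFinD -sumEFin; congr (_ + _)%E.
  by apply: eq_bigr => i _; rewrite -sumEFin.
apply: integrableD => //.
  by apply: finite_measure_integrable_cst.
apply: integrable_sum => // i _; apply: integrable_sum => // j _.
exact: integrable_entry_sqr.
Qed.

Lemma tame_integrable f : tame f -> P.-integrable setT (fun w => (f (sample W w))%:E).
Proof.
move=> [mf [K fK]].
apply: (@le_integrable _ _ _ P _ measurableT _ (fun w => K%:E * (wt (sample W w))%:E)%E).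
- apply/measurable_EFinP; apply: (measurableT_comp mf); exact: measurable_sample.
- move=> w _; rewrite /= lee_fin; apply: (le_trans (fK _)); exact: ler_norm.
- by apply: integrableZl => //; exact: integrable_wt.
Qed.

Lemma tame_cst c : tame (cst c).
Proof.
split=> //; exists `|c| => V /=; rewrite ler_peMr//; exact: wt_ge1.
Qed.

Lemma tameD f g : tame f -> tame g -> tame (fun V => f V + g V).
Proof.
move=> [mf [K fK]] [mg [L gL]]; split; first exact: measurable_funD.
exists (K + L) => V; rewrite mulrDl; apply: (le_trans (ler_normD _ _)).
exact: lerD.
Qed.

Lemma tameZ c f : tame f -> tame (fun V => c * f V).
Proof.
move=> [mf [K fK]]; split; first by apply: measurable_funM => //.
by exists (`|c| * K) => V; rewrite normrM -mulrA ler_wpM2l.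
Qed.

Lemma ExD f g : tame f -> tame g -> Ex (fun V => f V + g V) = Ex f + Ex g.
Proof.
by move=> /tame_integrable tf /tame_integrable tg; rewrite /Ex RintegralD.
Qed.

Lemma ExZ c f : tame f -> Ex (fun V => c * f V) = c * Ex f.
Proof. by move=> /tame_integrable tf; rewrite /Ex RintegralZl. Qed.

Lemma Ex_cst c : Ex (cst c) = c.
Proof.
by rewrite /Ex /Rintegral /= integral_cst//= probability_setT mule1.
Qed.

Lemma le_Ex f g : tame f -> tame g -> (forall V, f V <= g V) -> Ex f <= Ex g.
Proof.
by move=> /tame_integrable tf /tame_integrable tg fg; apply: le_Rintegral.
Qed.

Lemma tame_sum (I : Type) (s : seq I) (F : I -> 'M[R]_(n, l) -> R) :
  (forall i, tame (F i)) -> tame (fun V => \sum_(i <- s) F i V).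
Proof.
move=> tF; elim: s => [|i s IH].
  rewrite (_ : (fun _ => _) = cst 0); first exact: tame_cst.
  by apply/funext => V; rewrite big_nil.
rewrite (_ : (fun _ => _) = (fun V => F i V + \sum_(j <- s) F j V)); first exact: tameD.
by apply/funext => V; rewrite big_cons.
Qed.

Lemma Ex_sum (I : Type) (s : seq I) (F : I -> 'M[R]_(n, l) -> R) :
  (forall i, tame (F i)) -> Ex (fun V => \sum_(i <- s) F i V) = \sum_(i <- s) Ex (F i).
Proof.
move=> tF; elim: s => [|i s IH].
  rewrite big_nil -[RHS](Ex_cst 0); congr Ex.
  by apply/funext => V; rewrite big_nil.
rewrite big_cons -IH -ExD//; last exact: tame_sum.
by congr Ex; apply/funext => V; rewrite big_cons.
Qed.

Lemma wt_set_entry i j x V : wt (set_entry i j x V) <= wt V + x ^+ 2.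
Proof.
rewrite /wt -addrA lerD2l.
have -> : x ^+ 2 = \sum_a \sum_b (if (a == i) && (b == j) then x ^+ 2 else 0).
  rewrite (bigD1 i)//= [X in _ + X]big1 ?addr0; last first.
    by move=> a /negbTE ai; rewrite big1// => b _; rewrite ai.
  rewrite (bigD1 j)//= !eqxx [X in _ + X]big1 ?addr0// => b /negbTE bj.
  by rewrite bj andbF.
rewrite -big_split/=; apply: ler_sum => a _; rewrite -big_split/=; apply: ler_sum => b _.
rewrite mxE; case: ifP => _; first by rewrite lerDr sqr_ge0.
by rewrite addr0.
Qed.

Lemma tame_sqr_bound f K : measurable_fun setT (f : MT -> R) ->
  (forall V, f V ^+ 2 <= K * wt V) -> tame f.
Proof.
move=> mf fK; split=> //; exists (1 + K) => V.
have h1 := fK V; have h2 := wt_ge1 V; rewrite mulrDl mul1r.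
rewrite -[_ ^+ 2]real_normK ?num_real// in h1.
have := sqr_ge0 (`|f V| - 1); nra.
Qed.

Lemma tame_entryM i j f K : measurable_fun setT (f : MT -> R) ->
  (forall V, f V ^+ 2 <= K * wt V) -> tame (fun V => V i j * f V).
Proof.
move=> mf fK; split.
  by apply: measurable_funM => //; exact: measurable_mx_coord.
exists (1 + K) => V.
have h1 := fK V; have h2 := wt_ge V i j; rewrite mulrDl mul1r normrM.
rewrite -[_ ^+ 2]real_normK ?num_real// in h1.
rewrite -[_ ^+ 2]real_normK ?num_real// in h2.
have := sqr_ge0 (`|V i j| - `|f V|); nra.
Qed.

(** With all other entries frozen this is [stein1D], and resampling entry i j integrates the
    vanishing sections. *)
Lemma stein i j f g K :
  measurable_fun setT (f : MT -> R) -> measurable_fun setT (g : MT -> R) ->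
  (forall V, f V ^+ 2 <= K * wt V) -> (forall V, g V ^+ 2 <= K * wt V) ->
  (forall V (x : R), is_derive x 1 (fun x => f (set_entry i j x V)) (g (set_entry i j x V))) ->
  (forall V, continuous (fun x => g (set_entry i j x V))) ->
  Ex (fun V => V i j * f V) = Ex g.
Proof.
move=> mf mg fK gK df cg.
have K0 : 0 <= K.
  have := fK 0; rewrite /wt big1 => [|a _]; last by rewrite big1// => b _; rewrite mxE expr0n.
  by rewrite addr0 mulr1; apply: le_trans; exact: sqr_ge0.
have tVf : tame (fun V => V i j * f V) by exact: tame_entryM fK.
have tg : tame g by exact: tame_sqr_bound gK.
have tD : tame (fun V => V i j * f V + -1 * g V) by apply: tameD => //; exact: tameZ.
have : Ex (fun V => V i j * f V + -1 * g V) = 0.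
  suff r0 V : (\int[N01]_x (set_entry i j x V i j * f (set_entry i j x V) +
      -1 * g (set_entry i j x V))%:E = 0)%E.
    rewrite /Ex /Rintegral (@resample0 i j (fun V => V i j * f V + -1 * g V))//.
      by case: tD.
    exact: (tame_integrable tD).
  have [c c0 cK] : exists2 c, 1 <= c & K * (wt V + 1) + 1 <= c.
    exists (K * (wt V + 1) + 1) => //.
    by rewrite lerDr mulr_ge0// addr_ge0// (le_trans _ (wt_ge1 V)).
  have c0' : 0 <= c by exact: le_trans c0.
  have bnd (h : 'M[R]_(n, l) -> R) : (forall V, h V ^+ 2 <= K * wt V) ->
      forall x, `|h (set_entry i j x V)| <= c * (1 + `|x|).
    move=> hK x; rewrite -(@ler_pXn2r _ 2) ?nnegrE ?mulr_ge0 ?addr_ge0//.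
    rewrite real_normK ?num_real//; apply: (le_trans (hK _)).
    apply: (@le_trans _ _ (K * (wt V + x ^+ 2))); first by rewrite ler_wpM2l// wt_set_entry.
    apply: (@le_trans _ _ (c * (1 + x ^+ 2))).
      have x2 := sqr_ge0 x; have w0 : 0 <= wt V by exact: le_trans (wt_ge1 V).
      apply: le_trans (ler_wpM2r (addr_ge0 ler01 x2) cK).
      have := mulr_ge0 (mulr_ge0 K0 w0) x2; have := mulr_ge0 K0 x2; nra.
    rewrite exprMn; apply: (@le_trans _ _ (c ^+ 2 * (1 + x ^+ 2))).
      by rewrite ler_wpM2r ?addr_ge0 ?sqr_ge0// expr2 ler_peMr// (le_trans _ c0).
    rewrite ler_wpM2l ?sqr_ge0// -(real_normK (num_real x)).
    by have := normr_ge0 x; nra.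
  have bf := bnd f fK; have bg := bnd g gK.
  have eqs : (\int[N01]_x (g (set_entry i j x V))%:E =
      \int[N01]_x (x * f (set_entry i j x V))%:E)%E.
    apply: (@stein1D _ _ _ (2 * c)) => //.
    - move=> x; apply: (le_trans (bf x)); rewrite ler_wpM2r ?addr_ge0//.
      lra.
    - move=> x; apply: (le_trans (bg x)); rewrite -(real_normK (num_real x)).
      by have := sqr_ge0 (`|x| - 1); nra.
  have mF (h : 'M[R]_(n, l) -> R) : measurable_fun setT (h : MT -> R) ->
      measurable_fun setT (fun x => h (set_entry i j x V)).
    move=> mh; apply: (measurableT_comp mh); apply: measurable_mxP => a b.
    have [ab|ab] := boolP ((a == i) && (b == j)).
      rewrite (_ : (fun _ => _) = id); first exact: measurable_id.
      by apply/funext => x; rewrite mxE ab.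
    rewrite (_ : (fun _ => _) = cst (V a b)); first exact: measurable_cst.
    by apply/funext => x; rewrite mxE (negbTE ab).
  have bx (x : R) : `|x| * (c * (1 + `|x|)) <= 2 * c * (1 + x ^+ 2).
    rewrite -(real_normK (num_real x)) mulrCA -mulrA [leRHS]mulrCA ler_wpM2l//.
    by have := sqr_ge0 (`|x| - 1); nra.
  have i1 : N01.-integrable setT (EFin \o (fun x => x * f (set_entry i j x V))).
    apply: (@integrable_normal_sqr_bound _ _ (2 * c)).
      by apply: measurable_funM => //; exact: mF.
    move=> x; rewrite normrM; apply: le_trans (bx x).
    by rewrite ler_wpM2l.
  have i2 : N01.-integrable setT (EFin \o (fun x => g (set_entry i j x V))).
    apply: (@integrable_normal_sqr_bound _ _ (2 * c)); first exact: mF.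
    move=> x; apply: (le_trans (bg x)); rewrite -(real_normK (num_real x)).
    by have := sqr_ge0 (`|x| - 1); nra.
  rewrite (_ : (fun _ => _) = (fun x => (x * f (set_entry i j x V))%:E -
      (g (set_entry i j x V))%:E)%E); last first.
    by apply/funext => x; rewrite mxE !eqxx/= -EFinB mulN1r.
  rewrite integralB_EFin// -eqs subee// eqs.
  exact: integrable_fin_num.
rewrite ExD//; last exact: tameZ.
by rewrite ExZ// mulN1r => /eqP; rewrite subr_eq0 => /eqP.
Qed.

Lemma ge0_ExN_entry i j f : measurable_fun setT (f : MT -> R) -> (forall V, 0 <= f V) ->
  Ex (fun V => f (set_entry i j (- V i j) V)) = Ex f.
Proof.
move=> mf f0; congr fine.
have mN : measurable_fun setT (fun V : MT => set_entry i j (- (V : 'M[R]_(n, l)) i j) V : MT).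
  apply: measurable_mxP => a b.
  have [ab|ab] := boolP ((a == i) && (b == j)).
    rewrite (_ : (fun _ => _) = fun V : MT => - (V : 'M[R]_(n, l)) i j).
      by apply: measurableT_comp => //; exact: measurable_mx_coord.
    by apply/funext => V; rewrite mxE ab.
  rewrite (_ : (fun _ => _) = fun V : MT => (V : 'M[R]_(n, l)) a b).
    exact: measurable_mx_coord.
  by apply/funext => V; rewrite mxE (negbTE ab).
rewrite (@ge0_resample i j (fun V => f (set_entry i j (- V i j) V)))//; last first.
  exact: (measurableT_comp mf mN).
rewrite (ge0_resample i j mf f0); apply: eq_integral => w _.
rewrite -[RHS]ge0_integral_normalN//.
- apply: eq_integral => x _; congr (f _)%:E.
  apply/matrixP => a b; rewrite !mxE !eqxx/=.
  by case: ((a == i) && (b == j)).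
- suff mE : measurable_fun setT (fun x : measurableTypeR R => set_entry i j x (sample W w) : MT).
    exact: (measurableT_comp mf mE).
  apply: measurable_mxP => a b.
  have [ab|ab] := boolP ((a == i) && (b == j)).
    rewrite (_ : (fun _ => _) = id); first exact: measurable_id.
    by apply/funext => x; rewrite mxE ab.
  rewrite (_ : (fun _ => _) = cst (sample W w a b)); first exact: measurable_cst.
  by apply/funext => x; rewrite mxE (negbTE ab).
Qed.

End GaussianExpectation.

Local Open Scope sesquilinear_scope.

(** * Ridge residuals *)

Ltac mxexpand :=
  rewrite ?(mulmxDl, mulmxDr, mulNmx, mulmxN, mul1mx, mulmx1, mul0mx, mulmx0, opprK, mulmxA).

Ltac mxabel := repeat (match goal with |- context [mulmx ?A ?B] =>
   let x := fresh "x" in set x := mulmx A B; clearbody x end);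
  let i := fresh "i" in let j := fresh "j" in
  apply/matrixP => i j; rewrite !mxE; ring.

Local Notation mxconj := (map_mx Num.conj).

Section ConjugateTranspose.
Context {C : numClosedFieldType}.

Lemma adjM m n p (A : 'M[C]_(m, n)) (B : 'M[C]_(n, p)) :
  (A *m B) ^t* = B ^t* *m A ^t*.
Proof. by rewrite trmx_mul map_mxM. Qed.

Lemma adjD m n (A B : 'M[C]_(m, n)) : (A + B) ^t* = A ^t* + B ^t*.
Proof. by rewrite linearD map_mxD. Qed.

Lemma adjN m n (A : 'M[C]_(m, n)) : (- A) ^t* = - A ^t*.
Proof. by rewrite linearN map_mxN. Qed.

Lemma adjB m n (A B : 'M[C]_(m, n)) : (A - B) ^t* = A ^t* - B ^t*.
Proof. by rewrite adjD adjN. Qed.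

Lemma adjZ m n c (A : 'M[C]_(m, n)) : (c *: A) ^t* = c^* *: A ^t*.
Proof. by rewrite linearZ map_mxZ. Qed.

Lemma adj1 n : (1%:M : 'M[C]_n) ^t* = 1%:M.
Proof. by rewrite trmx1 map_mx1. Qed.

Lemma adjE m n (A : 'M[C]_(m, n)) i j : A ^t* i j = (A j i)^*.
Proof. by rewrite !mxE. Qed.

Definition mxreal m n (A : 'M[C]_(m, n)) := mxconj A = A.

Lemma mxreal_adj m n (A : 'M[C]_(m, n)) : mxreal A -> A ^t* = A^T.
Proof. by move=> rA; rewrite -map_trmx rA. Qed.

Lemma mxtrace_adj n (A : 'M[C]_n) : \tr (A ^t*) = (\tr A)^*.
Proof. by rewrite rmorph_sum; apply: eq_bigr => i _; rewrite adjE. Qed.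

Lemma mxtrace_conj n (A : 'M[C]_n) : \tr (mxconj A) = (\tr A)^*.
Proof. by rewrite rmorph_sum; apply: eq_bigr => i _; rewrite mxE. Qed.

Lemma mxtrace_mul_adj m n (A : 'M[C]_(m, n)) :
  \tr (A *m A ^t*) = \sum_i \sum_j `|A i j| ^+ 2.
Proof.
apply: eq_bigr => i _; rewrite mxE; apply: eq_bigr => j _.
by rewrite adjE normCK.
Qed.

Lemma mxtrace_mul_adj_ge0 m n (A : 'M[C]_(m, n)) : 0 <= \tr (A *m A ^t*).
Proof.
rewrite mxtrace_mul_adj; apply: sumr_ge0 => i _; apply: sumr_ge0 => j _.
exact: exprn_ge0.
Qed.

Lemma mxtrace_mul_adj_eq0 m n (A : 'M[C]_(m, n)) : \tr (A *m A ^t*) = 0 -> A = 0.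
Proof.
rewrite mxtrace_mul_adj => /eqP; rewrite psumr_eq0; last first.
  by move=> i _; apply: sumr_ge0 => j _; exact: exprn_ge0.
move=> /allP h; apply/matrixP => i j; rewrite mxE.
have := h i (mem_index_enum _); rewrite psumr_eq0 => [/allP /(_ j (mem_index_enum _))|].
  by rewrite sqrf_eq0 normr_eq0 => /eqP.
by move=> k _; exact: exprn_ge0.
Qed.

(** Positivity is encoded by a factorization, of any inner width, so that closure under sums,
    congruences and conjugation is immediate and traces become sums of squares. *)
Definition psd n (A : 'M[C]_n) := exists p (X : 'M[C]_(n, p)), A = X *m X ^t*.

Lemma psd_adj n (A : 'M[C]_n) : psd A -> A ^t* = A.
Proof. by move=> [p [X ->]]; rewrite adjM trmxCK. Qed.

Lemma psdD n (A B : 'M[C]_n) : psd A -> psd B -> psd (A + B).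
Proof.
move=> [p [X ->]] [q [Y ->]]; exists (p + q)%N, (row_mx X Y).
by rewrite tr_row_mx map_col_mx mul_row_col.
Qed.

Lemma psd0 n : psd (0 : 'M[C]_n).
Proof. by exists 0%N, 0; rewrite mul0mx. Qed.

Lemma psd1 n : psd (1%:M : 'M[C]_n).
Proof. by exists n, 1%:M; rewrite adj1 mul1mx. Qed.

Lemma psdZ n c (A : 'M[C]_n) : 0 <= c -> psd A -> psd (c *: A).
Proof.
move=> c0 [p [X ->]]; exists p, (sqrtC c *: X).
rewrite adjZ -scalemxAl -scalemxAr scalerA -normCK ger0_norm ?sqrtC_ge0//.
by rewrite sqrtCK.
Qed.

Lemma psd_congr m n (Y : 'M[C]_(m, n)) (A : 'M[C]_n) : psd A -> psd (Y *m A *m Y ^t*).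
Proof. by move=> [p [X ->]]; exists p, (Y *m X); rewrite adjM !mulmxA. Qed.

Lemma psd_mul_adj m n (Y : 'M[C]_(m, n)) : psd (Y *m Y ^t*).
Proof. by exists n, Y. Qed.

Lemma psd_tr_ge0 n (A : 'M[C]_n) : psd A -> 0 <= \tr A.
Proof. by move=> [p [X ->]]; exact: mxtrace_mul_adj_ge0. Qed.

Lemma psd_trM_ge0 n (A B : 'M[C]_n) : psd A -> psd B -> 0 <= \tr (A *m B).
Proof.
move=> [p [X ->]] [q [Y ->]].
suff -> : \tr (X *m X ^t* *m (Y *m Y ^t*)) = \tr ((X ^t* *m Y) *m (X ^t* *m Y) ^t*).
  exact: mxtrace_mul_adj_ge0.
by rewrite adjM trmxCK -!mulmxA mxtrace_mulC !mulmxA.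
Qed.

Lemma psd_conj n (A : 'M[C]_n) : psd A -> psd (mxconj A).
Proof.
move=> [p [X ->]]; exists p, (mxconj X); rewrite map_mxM.
by rewrite map_trmx.
Qed.

(** If K (1 + X X^H) = 0, then |K|^2 + |K X|^2 = 0 in Frobenius norm, so the kernel is trivial. *)
Lemma psd_unit n (A : 'M[C]_n) : psd A -> 1%:M + A \in unitmx.
Proof.
move=> [p [X ->]]; rewrite -row_free_unit -kermx_eq0; apply/eqP.
set K := kermx _; have K0 : K *m (1%:M + X *m X ^t*) = 0 by exact: mulmx_ker.
apply: mxtrace_mul_adj_eq0; apply/eqP.
have h : \tr (K *m K ^t*) + \tr ((K *m X) *m (K *m X) ^t*) = 0.
  have -> : (K *m X) *m (K *m X) ^t* = K *m (1%:M + X *m X ^t*) *m K ^t* - K *m K ^t*.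
    by rewrite mulmxDr mulmx1 mulmxDl adjM !mulmxA addrC addKr.
  by rewrite K0 mul0mx sub0r linearN addrN.
rewrite eq_le -{1}h lerDl !mxtrace_mul_adj_ge0 //=.
Qed.

End ConjugateTranspose.

Section Resolvent.
Context {C : numClosedFieldType} {n l : nat}.
Implicit Types (B : 'M[C]_n) (W : 'M[C]_(n, l)).

(* Z = coef B W minimizes (1 - W Z)^H B (1 - W Z) + Z^H Z for real W, and
   resid B W is the minimum.  The unit penalty on Z makes the problem regular
   without any rank assumption on W. *)
Definition gram B W : 'M[C]_l := 1%:M + W^T *m B *m W.
Definition coef B W : 'M[C]_(l, n) := invmx (gram B W) *m W^T *m B.
Definition defect B W : 'M[C]_n := 1%:M - W *m coef B W.
Definition resid B W : 'M[C]_n := B *m defect B W.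

Lemma mxreal_tr_adj W : mxreal W -> W^T ^t* = W.
Proof. by move=> rW; rewrite trmxK. Qed.

Lemma mxreal_gram_adj W : mxreal W -> (W *m W^T) ^t* = W *m W^T.
Proof. by move=> rW; rewrite adjM mxreal_tr_adj// mxreal_adj. Qed.

Section OneMatrix.
Variables (B : 'M[C]_n) (W : 'M[C]_(n, l)).
Hypotheses (pB : psd B) (rW : mxreal W).

Let aB : B ^t* = B. Proof. exact: psd_adj. Qed.
Let aW : W ^t* = W^T. Proof. exact: mxreal_adj. Qed.
Let aWT : W^T ^t* = W. Proof. exact: mxreal_tr_adj. Qed.

Lemma gram_psd : psd (gram B W).
Proof. by apply: psdD; [exact: psd1|rewrite -{2}aWT; exact: psd_congr]. Qed.

Lemma gram_adj : (gram B W) ^t* = gram B W.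
Proof. exact: psd_adj gram_psd. Qed.

Lemma gram_unit : gram B W \in unitmx.
Proof. by apply: psd_unit; rewrite -{2}aWT; exact: psd_congr. Qed.

Lemma gram_coef : gram B W *m coef B W = W^T *m B.
Proof. by rewrite /coef -mulmxA mulKVmx// gram_unit. Qed.

Lemma coef_adj_gram : (coef B W) ^t* *m gram B W = B *m W.
Proof. by rewrite -{1}gram_adj -adjM gram_coef adjM aB aWT. Qed.

Lemma tr_resid : W^T *m resid B W = coef B W.
Proof.
rewrite /resid /defect !mulmxBr mulmx1 -gram_coef /gram mulmxDl mul1mx !mulmxA.
by rewrite addrK.
Qed.

Lemma defectE : defect B W = 1%:M - W *m W^T *m resid B W.
Proof. by rewrite -mulmxA tr_resid. Qed.

(** Expansion around the minimizer. It gives the variational bound [resid_le_any] and, at Z =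
    [coef B W], the decomposition [residE] into a fitted part and the penalty. *)
Lemma complete_square (Z : 'M[C]_(l, n)) :
  (1%:M - W *m Z) ^t* *m B *m (1%:M - W *m Z) + Z ^t* *m Z =
  resid B W + (Z - coef B W) ^t* *m gram B W *m (Z - coef B W).
Proof.
have E1 : (1%:M - W *m Z) ^t* *m B *m (1%:M - W *m Z) + Z ^t* *m Z =
    B - B *m W *m Z - Z ^t* *m (W^T *m B) + Z ^t* *m gram B W *m Z.
  by rewrite adjB adj1 adjM aW /gram; mxexpand; mxabel.
rewrite E1 adjB /resid /defect -gram_coef -coef_adj_gram.
have -> : B *m (1%:M - W *m coef B W) = B - (coef B W) ^t* *m gram B W *m coef B W.
  by rewrite mulmxBr mulmx1 mulmxA coef_adj_gram.
by mxexpand; mxabel.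
Qed.

Lemma residE :
  resid B W = (defect B W) ^t* *m B *m defect B W + (coef B W) ^t* *m coef B W.
Proof. by rewrite complete_square subrr mulmx0 addr0. Qed.

Lemma resid_psd : psd (resid B W).
Proof.
rewrite residE; apply: psdD.
  by rewrite -{2}(trmxCK (defect B W)); exact: psd_congr.
by rewrite -{2}(trmxCK (coef B W)); exact: psd_mul_adj.
Qed.

Lemma resid_adj : (resid B W) ^t* = resid B W.
Proof. exact: psd_adj resid_psd. Qed.

Lemma resid_le : psd (B - resid B W).
Proof.
rewrite /resid /defect mulmxBr mulmx1 opprB addrCA subrr addr0 mulmxA -coef_adj_gram.
rewrite -{2}(trmxCK (coef B W)); exact: psd_congr gram_psd.
Qed.

Lemma resid_le_any (Z : 'M[C]_(l, n)) :
  psd ((1%:M - W *m Z) ^t* *m B *m (1%:M - W *m Z) + Z ^t* *m Z - resid B W).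
Proof.
rewrite complete_square addrC addKr -{2}(trmxCK (Z - coef B W)).
exact: psd_congr gram_psd.
Qed.

(** Formally [resid B W] is the inverse of B^-1 + W W^T. This identity and [resid_mulr] express that
    without inverting [B]. *)
Lemma resid_mul : (1%:M + B *m (W *m W^T)) *m resid B W = B.
Proof.
rewrite mulmxDl mul1mx -[in RHS](subrK (resid B W) B) addrC; congr (_ + _).
by rewrite {2}/resid defectE mulmxBr mulmx1 opprB addrCA subrr addr0 !mulmxA.
Qed.

Lemma resid_mulr : resid B W *m (1%:M + (W *m W^T) *m B) = B.
Proof.
rewrite -[RHS]aB -[in RHS]resid_mul adjM resid_adj adjD adj1 !adjM aB aW aWT.
by [].
Qed.

Lemma resid_mul_defect_adj : (defect B W) ^t* *m B = resid B W.
Proof. by rewrite -resid_adj /resid adjM aB. Qed.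

End OneMatrix.

End Resolvent.

(** Expand the nonnegative trace tr ((y - conj y)^H h (y - conj y)). Since h is real, the term in
    conj y alone equals the term in y alone. *)
Lemma psd_real_cross (C : numClosedFieldType) n (h y : 'M[C]_n) : psd h -> mxreal h ->
  \tr (y ^t* *m h *m mxconj y) + (\tr (y ^t* *m h *m mxconj y))^*
    <= \tr (y ^t* *m h *m y) *+ 2.
Proof.
move=> ph rh; have ah := psd_adj ph.
have := psd_tr_ge0 (psd_congr ((y - mxconj y) ^t*) ph).
rewrite trmxCK adjB.
have -> : (mxconj y) ^t* = mxconj (y ^t*) by rewrite map_trmx.
have -> : \tr ((y ^t* - mxconj (y ^t*)) *m h *m (y - mxconj y)) =
    \tr (y ^t* *m h *m y) - \tr (y ^t* *m h *m mxconj y)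
    - \tr (mxconj (y ^t*) *m h *m y) + \tr (mxconj (y ^t*) *m h *m mxconj y).
  by rewrite !(mulmxBl, mulmxBr) !linearB /=; ring.
have -> : \tr (mxconj (y ^t*) *m h *m mxconj y) = \tr (y ^t* *m h *m y).
  rewrite -{1}rh -!map_mxM mxtrace_conj.
  have : 0 <= \tr (y ^t* *m h *m y) by rewrite -{2}(trmxCK y); apply/psd_tr_ge0/psd_congr.
  by move/ger0_real/CrealP.
have -> : \tr (mxconj (y ^t*) *m h *m y) = (\tr (y ^t* *m h *m mxconj y))^*.
  rewrite -mxtrace_adj !adjM ah trmxCK mulmxA; congr (\tr (_ *m _ *m _)).
  by rewrite map_trmx.
move=> h0; rewrite -subr_ge0 (le_trans h0)// le_eqVlt; apply/orP; left; apply/eqP; ring.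
Qed.

(** * Sign conditions for a real matrix boosted along a projector *)

Section Boost.
Context {C : numClosedFieldType} {n l : nat}.
Variables (b P : 'M[C]_n) (t : C) (W : 'M[C]_(n, l)).
Hypotheses (pb : psd b) (rb : mxreal b) (ub : b \in unitmx) (t1 : 1 < t).
Hypotheses (aP : P ^t* = P) (PP : P *m P = P) (Pb : P *m b = b *m P) (rW : mxreal W).

(** As P commutes with b, this is t b on the range of P and b on the range of 1 - P. *)
Definition boost : 'M[C]_n := b + (t - 1) *: (b *m P).

Let g := invmx b.
Let ab : b ^t* = b. Proof. exact: psd_adj. Qed.
Let t0 : 0 < t. Proof. exact: lt_trans t1. Qed.

Let ag : g ^t* = g. Proof. by rewrite /g trmx_inv map_invmx ab. Qed.
Let rg : mxreal g. Proof. by rewrite /mxreal /g map_invmx rb. Qed.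
Let pg : psd g.
Proof.
have -> : g = g *m b *m g ^t* by rewrite ag /g mulVmx// mul1mx.
exact: psd_congr.
Qed.
Let Pg : P *m g = g *m P.
Proof.
by rewrite -[RHS]mulmx1 -(mulmxV ub) -/g !mulmxA -(mulmxA g) Pb mulmxA mulVmx// mul1mx.
Qed.

Let pPg : psd (P *m g).
Proof. by rewrite -PP -mulmxA Pg mulmxA -{2}aP; exact: psd_congr. Qed.

Lemma boost_psd : psd boost.
Proof.
apply: psdD => //; apply: psdZ; first by rewrite subr_ge0 ltW.
by rewrite -PP mulmxA -Pb -{2}aP; exact: psd_congr.
Qed.

Let B := boost.
Let F := resid B W.
Let D := defect B W.
Let pF : psd F. Proof. exact: (resid_psd boost_psd). Qed.

Let PgB : P *m g *m B = t *: P.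
Proof.
rewrite /B /boost mulmxDr -scalemxAr mulmxA -(mulmxA P) mulVmx// mulmx1 PP.
by rewrite -[X in X + _]scale1r -scalerDl addrC subrK.
Qed.

(** With [g] the inverse of b, [PgB] turns t tr (P D) into tr (P g F), the trace of a product of two
    positive semidefinite matrices. *)
Lemma boost_tr_defect_ge0 : 0 <= \tr (P *m D).
Proof.
have E : \tr (P *m g *m F) = t * \tr (P *m D).
  by rewrite /F /resid mulmxA PgB -scalemxAl linearZ.
by rewrite -(pmulr_rge0 _ t0) -E; exact: psd_trM_ge0.
Qed.

Lemma boost_tr_compl_le : \tr ((1%:M - P) *m F) <= \tr ((1%:M - P) *m b).
Proof.
have E : (1%:M - P) *m b = (1%:M - P) *m B.
  have h : (1%:M - P) *m (P *m b) = 0 by rewrite mulmxA mulmxBl mul1mx PP subrr mul0mx.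
  by rewrite /B /boost mulmxDr -scalemxAr -Pb h scaler0 addr0.
rewrite E -subr_ge0 -linearB -mulmxBr; apply: psd_trM_ge0.
  have -> : 1%:M - P = (1%:M - P) *m (1%:M - P) ^t*.
    by rewrite adjB adj1 aP mulmxBl mul1mx mulmxBr mulmx1 PP subrr subr0.
  exact: psd_mul_adj.
exact: (resid_le boost_psd).
Qed.

(* The conjugate of D enters through the transposed term in the derivative of
   resid: W is real, but P is not. *)
Lemma boost_cross_ge0 : 0 <= \tr (P *m mxconj D *m F) + (\tr (P *m mxconj D *m F))^*.
Proof.
(* Perturbation from the real matrix b: [N] is chosen so that B = b + b G B, which gives the
   resolvent identity F = s + s G F. Here [s] and [h] are real, so [y] = G F carries everything that
   is not real. *)
pose s := resid b W; pose h := b - s; pose N := 1 - t^-1.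
pose G := N *: (P *m g); pose y := G *m F.
have N0 : 0 < N by rewrite subr_gt0 invf_lt1.
have N1 : 0 <= 1 - N by rewrite opprB addrC subrK invr_ge0 ltW.
have ps : psd s by exact: (resid_psd pb).
have as_ : s ^t* = s by exact: psd_adj.
have rs : mxreal s.
  rewrite /mxreal /s /resid /defect /coef /gram.
  by rewrite !(map_mxM, map_mxB, map_mxD, map_mx1, map_invmx, map_trmx) -?map_trmx !rb !rW.
have ph : psd h by exact: (resid_le pb).
have ah : h ^t* = h by exact: psd_adj.
have rh : mxreal h by rewrite /mxreal /h map_mxB rb rs.
have aF : F ^t* = F by exact: psd_adj.
have aG : G ^t* = G by rewrite /G adjZ adjM ag aP -Pg (CrealP _)// gtr0_real.
have pG : psd G by apply: psdZ => //; exact: ltW.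
have ay : y ^t* = F *m G by rewrite /y adjM aG aF.
have BE : B = b + b *m G *m B.
  rewrite /G -scalemxAr -scalemxAl -(mulmxA b) PgB -[in RHS]scalemxAr scalerA.
  by rewrite /N mulrBl mul1r mulVf ?gt_eqF.
have FE : F = s + s *m G *m F.
  have h1 : (1%:M - s *m (W *m W^T)) *m b = s.
    by rewrite mulmxBl mul1mx -(mulmxA s) -[X in X - _](resid_mulr pb rW) -/s mulmxDr mulmx1 addrK.
  have h2 : F = B - B *m (W *m W^T) *m F.
    by rewrite -[X in X - _](resid_mul boost_psd rW) -/B -/F mulmxDl mul1mx addrK.
  have h3 : (1%:M - s *m (W *m W^T)) *m B = s *m (1%:M + G *m B).
    have BE' : B = b *m (1%:M + G *m B) by rewrite {1}BE [in RHS]mulmxDr mulmx1 mulmxA.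
    by rewrite {1}BE' [LHS]mulmxA h1.
  have h4 : (1%:M - s *m (W *m W^T)) *m F = s *m (1%:M + G *m B) *m (1%:M - (W *m W^T) *m F).
    have h2' : F = B *m (1%:M - (W *m W^T) *m F).
      by rewrite {1}h2 [in RHS]mulmxBr mulmx1 !mulmxA.
    by rewrite -h3 -[RHS]mulmxA -h2'.
  have h5 : F = s *m (1%:M + G *m B) *m (1%:M - (W *m W^T) *m F) + s *m (W *m W^T) *m F.
    by rewrite -h4 mulmxBl mul1mx subrK.
  rewrite {1}h5 {3}h2; mxexpand; mxabel.
(* Conjugation fixes s, W and h, so conj F = s + s conj y and the conjugate survives only on [y]. *)
have PDE : P *m mxconj D = P *m g *m s - P *m g *m h *m mxconj y.
  have cF : mxconj F = s + s *m mxconj y by rewrite {1}FE map_mxD -mulmxA (map_mxM _ s) rs.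
  have cD : mxconj D = 1%:M - W *m W^T *m mxconj F.
    by rewrite /D (defectE boost_psd rW) map_mxB map_mx1 (map_mxM _ (W *m W^T)) (map_mxM _ W) -map_trmx rW.
  have Ws : P *m (W *m W^T) *m s = P *m g *m h.
    have gs : g *m s = 1%:M - W *m W^T *m s.
      by rewrite -(defectE pb rW) /s /resid mulmxA mulVmx// mul1mx.
    have -> : P *m (W *m W^T) *m s = P *m (1%:M - (1%:M - W *m W^T *m s)).
      by rewrite opprB addrC subrK !mulmxA.
    by rewrite -gs /h !mulmxBr mulmx1 -[P *m g *m b]mulmxA mulVmx// mulmx1 !mulmxA.
  have h6 : P *m g *m s = P - P *m g *m h.
    by rewrite /h mulmxBr -[P *m g *m b]mulmxA mulVmx// mulmx1 opprB addrC subrK.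
  rewrite cD cF h6 -Ws (mulmxBr P) mulmx1 (mulmxDr (W *m W^T) s) (mulmxDr P) opprD addrA.
  by rewrite !mulmxA.
have GE : G *m b *m G = N *: G.
  have gbg : P *m g *m b *m (P *m g) = P *m g.
    by rewrite -[P *m g *m b]mulmxA mulVmx// mulmx1 mulmxA PP.
  by rewrite {1}/G -!scalemxAl {1}/G -scalemxAr gbg.
have NPD : N *: (P *m mxconj D) = G *m s - G *m h *m mxconj y.
  by rewrite PDE scalerBr /G -!scalemxAl.
clearbody G.
have FE' : F = s + F *m G *m s.
  rewrite -{1}aF {1}FE adjD (adjM (s *m G)) (adjM s G) as_ aF aG.
  by rewrite [in LHS]mulmxA.
pose z := \tr (P *m mxconj D *m F); pose a := \tr (y ^t* *m h *m mxconj y).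
have zE : N * z = \tr (F - s) - a.
  have -> : F - s = y ^t* *m s by rewrite ay {1}FE' addrC addKr.
  have -> : N * z = \tr (G *m s *m F) - \tr (G *m h *m mxconj y *m F).
    by rewrite -linearB -mulmxBl -NPD -scalemxAl linearZ.
  rewrite /a ay; congr (_ - _).
    by rewrite mxtrace_mulC mulmxA.
  by rewrite mxtrace_mulC !mulmxA.
have yhy : y ^t* *m h *m y = (N - 1) *: (F *m G *m F) + (F - s).
  rewrite ay /h /y mulmxBr mulmxBl.
  have -> : F *m G *m b *m (G *m F) = N *: (F *m G *m F).
    have -> : N *: (F *m G *m F) = F *m (N *: G) *m F by rewrite -scalemxAr -scalemxAl.
    by rewrite -GE !mulmxA.
  have -> : F *m G *m s *m (G *m F) = F *m G *m F - (F - s).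
    have -> : F *m G *m s = F - s by rewrite {2}FE' addrC addKr.
    have sGF : s *m (G *m F) = F - s by rewrite {2}FE mulmxA addrC addKr.
    by rewrite mulmxBl sGF !mulmxA.
  by move: (F *m G *m F) (F - s) => X Y; mxabel.
(* Since F - s exceeds y^H h y by (1 - N) F G F, this bound gives N (z + conj z) = 2 tr (F - s) - (a
   + conj a) >= 2 (1 - N) tr (F G F) >= 0. *)
have aa : a + a^* <= \tr (y ^t* *m h *m y) *+ 2 by exact: psd_real_cross.
suff : 0 <= N * (z + z^*) by rewrite pmulr_rge0.
have NR : N^* = N by apply/CrealP/gtr0_real.
have -> : N * (z + z^*) = N * z + (N * z)^* by rewrite mulrDr rmorphM /= NR.
rewrite zE rmorphB /=.
have p0 : 0 <= \tr (F *m G *m F) by rewrite -{2}aF; apply/psd_tr_ge0/psd_congr.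
have FsR : (\tr (F - s))^* = \tr (F - s).
  have -> : F - s = y ^t* *m h *m y + (1 - N) *: (F *m G *m F).
    by rewrite yhy addrAC -scalerDl subrKA subrr scale0r add0r.
  rewrite linearD linearZ /= rmorphD rmorphM /=; congr (_ + _).
    by apply/CrealP/ger0_real; rewrite -{2}(trmxCK y); apply/psd_tr_ge0/psd_congr.
  by congr (_ * _); apply/CrealP/ger0_real.
rewrite FsR; apply: (@le_trans _ _ (((1 - N) * \tr (F *m G *m F)) *+ 2)).
  by rewrite mulrn_wge0// mulr_ge0.
move: aa; rewrite yhy linearD linearZ /= -subr_ge0 => h0.
rewrite -subr_ge0 (le_trans h0)// le_eqVlt; apply/orP; left; apply/eqP; ring.
Qed.

End Boost.

(** * Matrix fields and Stein's identity *)

Section FunctionClass.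
Context {R : realType} {X : Type}.
Variable Q : (X -> R[i]) -> Prop.
Hypotheses (Qc : forall c, Q (fun _ => c))
  (QD : forall f g, Q f -> Q g -> Q (fun x => f x + g x))
  (QM : forall f g, Q f -> Q g -> Q (fun x => f x * g x))
  (QV : forall f, (forall x, f x != 0) -> Q f -> Q (fun x => (f x)^-1)).

(** The class [Q] of scalar functions is abstract so that the same closure lemmas serve
    differentiability, measurability and boundedness. *)
Definition mxclass m n (F : X -> 'M[R[i]]_(m, n)) :=
  forall i j, Q (fun x => F x i j).

Let Q_eq f g : f =1 g -> Q f -> Q g.
Proof. by move=> /funext ->. Qed.

Lemma class_sum (I : Type) (s : seq I) (f : I -> X -> R[i]) :
  (forall i, Q (f i)) -> Q (fun x => \sum_(i <- s) f i x).
Proof.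
move=> Qf; elim: s => [|i s IH].
  by apply: Q_eq (Qc 0) => x; rewrite big_nil.
by apply: Q_eq (QD (Qf i) IH) => x; rewrite big_cons.
Qed.

Lemma class_prod (I : Type) (s : seq I) (f : I -> X -> R[i]) :
  (forall i, Q (f i)) -> Q (fun x => \prod_(i <- s) f i x).
Proof.
move=> Qf; elim: s => [|i s IH].
  by apply: Q_eq (Qc 1) => x; rewrite big_nil.
by apply: Q_eq (QM (Qf i) IH) => x; rewrite big_cons.
Qed.

Lemma mxclass_cst m n (A : 'M[R[i]]_(m, n)) : mxclass (fun _ => A).
Proof. by move=> i j; exact: Qc. Qed.

Lemma mxclassD m n (F G : X -> 'M[R[i]]_(m, n)) :
  mxclass F -> mxclass G -> mxclass (fun x => F x + G x).
Proof. by move=> QF QG i j; apply: Q_eq (QD (QF i j) (QG i j)) => x; rewrite mxE. Qed.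

Lemma mxclassN m n (F : X -> 'M[R[i]]_(m, n)) :
  mxclass F -> mxclass (fun x => - F x).
Proof.
by move=> QF i j; apply: Q_eq (QM (Qc (-1)) (QF i j)) => x; rewrite mxE mulN1r.
Qed.

Lemma mxclassM m n p (F : X -> 'M[R[i]]_(m, n)) (G : X -> 'M[R[i]]_(n, p)) :
  mxclass F -> mxclass G -> mxclass (fun x => F x *m G x).
Proof.
move=> QF QG i j.
apply: Q_eq (class_sum (index_enum 'I_n) (fun k => QM (QF i k) (QG k j))) => x.
by rewrite mxE.
Qed.

Lemma mxclassT m n (F : X -> 'M[R[i]]_(m, n)) : mxclass F -> mxclass (fun x => (F x)^T).
Proof. by move=> QF i j; apply: Q_eq (QF j i) => x; rewrite mxE. Qed.

Lemma mxclass_tr n (F : X -> 'M[R[i]]_n) : mxclass F -> Q (fun x => \tr (F x)).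
Proof. by move=> QF; apply: class_sum. Qed.

Lemma class_det n (F : X -> 'M[R[i]]_n) : mxclass F -> Q (fun x => \det (F x)).
Proof.
move=> QF; apply: class_sum => s.
by apply: QM => //; exact: class_prod.
Qed.

(** Cramer's rule: entries of the inverse are polynomials in the entries divided by the nonvanishing
    determinant. *)
Lemma mxclassV n (F : X -> 'M[R[i]]_n) : (forall x, F x \in unitmx) ->
  mxclass F -> mxclass (fun x => invmx (F x)).
Proof.
move=> uF QF i j.
have Qdet : Q (fun x => (\det (F x))^-1).
  apply: QV; last exact: class_det.
  by move=> x; rewrite -unitfE -unitmxE.
have Qcof : Q (fun x => cofactor (F x) j i).
  apply: QM => //; apply: class_det => a b.
  by apply: Q_eq (QF (lift j a) (lift i b)) => x; rewrite !mxE.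
by apply: Q_eq (QM Qdet Qcof) => x; rewrite /invmx uF !mxE.
Qed.

Lemma mxclass_resid n l (B : 'M[R[i]]_n) (F : X -> 'M[R[i]]_(n, l)) :
  psd B -> (forall x, mxreal (F x)) -> mxclass F ->
  mxclass (fun x => coef B (F x)) /\ mxclass (fun x => resid B (F x)).
Proof.
move=> pB rF QF.
have QFT := mxclassT QF.
have Qg : mxclass (fun x => gram B (F x)).
  apply: mxclassD; first exact: mxclass_cst.
  by apply: mxclassM => //; apply: mxclassM => //; exact: mxclass_cst.
have Qcoef : mxclass (fun x => coef B (F x)).
  apply: mxclassM; last exact: mxclass_cst.
  by apply: mxclassM => //; apply: mxclassV => // x; exact: gram_unit.
split=> //; apply: mxclassM; first exact: mxclass_cst.
apply: mxclassD; first exact: mxclass_cst.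
by apply: mxclassN; exact: mxclassM.
Qed.

End FunctionClass.

Section ComplexValued.
Context {R : realType}.
Local Notation Re := (@complex.Re R).
Local Notation Im := (@complex.Im R).

Lemma ReD (z w : R[i]) : Re (z + w) = Re z + Re w. Proof. by case: z w => ? ? []. Qed.
Lemma ImD (z w : R[i]) : Im (z + w) = Im z + Im w. Proof. by case: z w => ? ? []. Qed.
Lemma ReM (z w : R[i]) : Re (z * w) = Re z * Re w - Im z * Im w.
Proof. by case: z w => ? ? []. Qed.
Lemma ImM (z w : R[i]) : Im (z * w) = Re z * Im w + Im z * Re w.
Proof. by case: z w => ? ? []. Qed.
Lemma ReV (z : R[i]) : Re z^-1 = Re z * (Re z ^+ 2 + Im z ^+ 2)^-1. Proof. by case: z. Qed.
Lemma ImV (z : R[i]) : Im z^-1 = - Im z * (Re z ^+ 2 + Im z ^+ 2)^-1.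
Proof. by case: z => a b /=; rewrite mulNr. Qed.

Lemma sqr_ReIm_gt0 (z : R[i]) : z != 0 -> 0 < Re z ^+ 2 + Im z ^+ 2.
Proof.
rewrite eq_complex /= negb_and => h.
rewrite lt_neqAle addr_ge0 ?sqr_ge0// andbT eq_sym paddr_eq0 ?sqr_ge0// !sqrf_eq0.
by rewrite negb_and.
Qed.

Definition cmeasurable d (X : measurableType d) (f : X -> R[i]) :=
  measurable_fun setT (fun x => Re (f x)) /\ measurable_fun setT (fun x => Im (f x)).

Section Measurable.
Context d (X : measurableType d).
Implicit Types f g : X -> R[i].

Lemma cmeasurable_cst c : cmeasurable (fun _ : X => c).
Proof. by split; exact: measurable_cst. Qed.

Lemma cmeasurableD f g : cmeasurable f -> cmeasurable g -> cmeasurable (fun x => f x + g x).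
Proof.
move=> [rf mf] [rg mg]; split.
  by under eq_fun do rewrite ReD; exact: measurable_funD.
by under eq_fun do rewrite ImD; exact: measurable_funD.
Qed.

Lemma cmeasurableM f g : cmeasurable f -> cmeasurable g -> cmeasurable (fun x => f x * g x).
Proof.
move=> [rf mf] [rg mg]; split.
  under eq_fun do rewrite ReM.
  by apply: measurable_funB; exact: measurable_funM.
under eq_fun do rewrite ImM.
by apply: measurable_funD; exact: measurable_funM.
Qed.

Lemma cmeasurableV f : (forall x, f x != 0) -> cmeasurable f ->
  cmeasurable (fun x => (f x)^-1).
Proof.
move=> f0 [rf mf].
have h : measurable_fun setT (fun x => (Re (f x) ^+ 2 + Im (f x) ^+ 2)^-1).
  (* The denominator is positive, so its inverse is exp (- ln), a composition of measurable
     functions. *)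
  rewrite (_ : (fun _ => _) = fun x => expR (- ln (Re (f x) ^+ 2 + Im (f x) ^+ 2))).
    apply: measurableT_comp => //; apply: measurableT_comp => //.
    apply: measurableT_comp; first exact: measurable_ln.
    by apply: measurable_funD; exact: measurable_funX.
  by apply/funext => x; rewrite expRN lnK// posrE; exact: sqr_ReIm_gt0.
split.
  by under eq_fun do rewrite ReV; exact: measurable_funM.
under eq_fun do rewrite ImV.
by apply: measurable_funM => //; exact: measurableT_comp.
Qed.

End Measurable.

Definition cderivable (f : R -> R[i]) := forall x : R,
  derivable (fun x => Re (f x)) x 1 /\ derivable (fun x => Im (f x)) x 1.

Lemma cderivable_cst c : cderivable (fun _ => c).
Proof. by move=> x; split; exact: derivable_cst. Qed.

Lemma cderivableD f g : cderivable f -> cderivable g -> cderivable (fun x => f x + g x).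
Proof.
move=> df dg x; have [rf mf] := df x; have [rg mg] := dg x; split.
  by under eq_fun do rewrite ReD; exact: (derivableD rf rg).
by under eq_fun do rewrite ImD; exact: (derivableD mf mg).
Qed.

Lemma cderivableM f g : cderivable f -> cderivable g -> cderivable (fun x => f x * g x).
Proof.
move=> df dg x; have [rf mf] := df x; have [rg mg] := dg x; split.
  under eq_fun do rewrite ReM.
  exact: (derivableB (derivableM rf rg) (derivableM mf mg)).
under eq_fun do rewrite ImM.
exact: (derivableD (derivableM rf mg) (derivableM mf rg)).
Qed.

Lemma cderivableV f : (forall x, f x != 0) -> cderivable f ->
  cderivable (fun x => (f x)^-1).
Proof.
move=> f0 df x; have [rf mf] := df x.
have h : derivable (fun x => (Re (f x) ^+ 2 + Im (f x) ^+ 2)^-1) x 1.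
  apply: derivableV; first by rewrite gt_eqF// sqr_ReIm_gt0.
  under eq_fun do rewrite !expr2.
  exact: (derivableD (derivableM rf rf) (derivableM mf mf)).
split.
  by under eq_fun do rewrite ReV; exact: (derivableM rf h).
under eq_fun do rewrite ImV.
exact: (derivableM (derivableN mf) h).
Qed.

Definition cderive (f : R -> R[i]) (x : R) : R[i] :=
  Complex ('D_1 (fun x => Re (f x)) x) ('D_1 (fun x => Im (f x)) x).

Lemma cderive_cst c x : cderive (fun _ => c) x = 0.
Proof. by rewrite /cderive !derive_cst. Qed.

Lemma cderiveD f g x : cderivable f -> cderivable g ->
  cderive (fun x => f x + g x) x = cderive f x + cderive g x.
Proof.
move=> df dg; have [rf mf] := df x; have [rg mg] := dg x.
rewrite /cderive.
have -> : (fun x => Re (f x + g x)) = (fun x => Re (f x)) + (fun x => Re (g x)).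
  by apply/funext => y; rewrite ReD.
have -> : (fun x => Im (f x + g x)) = (fun x => Im (f x)) + (fun x => Im (g x)).
  by apply/funext => y; rewrite ImD.
by rewrite (deriveD rf rg) (deriveD mf mg).
Qed.

Lemma cderiveM f g x : cderivable f -> cderivable g ->
  cderive (fun x => f x * g x) x = cderive f x * g x + f x * cderive g x.
Proof.
move=> df dg; have [rf mf] := df x; have [rg mg] := dg x.
apply/eqP; rewrite eq_complex /= ReD ImD !ReM !ImM /=; apply/andP; split; apply/eqP.
  under eq_fun do rewrite ReM.
  rewrite (deriveB (derivableM rf rg) (derivableM mf mg)).
  by rewrite (deriveM rf rg) (deriveM mf mg) /GRing.scale /=; ring.
under eq_fun do rewrite ImM.
rewrite (deriveD (derivableM rf mg) (derivableM mf rg)).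
by rewrite (deriveM rf mg) (deriveM mf rg) /GRing.scale /=; ring.
Qed.

End ComplexValued.

Section MatrixDerivative.
Context {R : realType}.
Local Notation Re := (@complex.Re R).
Local Notation Im := (@complex.Im R).
Local Notation C := R[i].

Definition mderivable m n (F : R -> 'M[C]_(m, n)) := mxclass (@cderivable R) F.

Definition mderive m n (F : R -> 'M[C]_(m, n)) (x : R) : 'M[C]_(m, n) :=
  \matrix_(i, j) cderive (fun y => F y i j) x.

Lemma cderive_sum (I : Type) (s : seq I) (f : I -> R -> C) x : (forall i, cderivable (f i)) ->
  cderive (fun x => \sum_(i <- s) f i x) x = \sum_(i <- s) cderive (f i) x.
Proof.
move=> df; elim: s => [|i s IH].
  rewrite big_nil -[RHS](cderive_cst (0 : C) x); congr (cderive _ x).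
  by apply/funext => y; rewrite big_nil.
rewrite big_cons -IH -cderiveD//; last first.
  exact: (class_sum (@cderivable_cst R) (@cderivableD R)).
by congr (cderive _ x); apply/funext => y; rewrite big_cons.
Qed.

Lemma mderive_cst m n (A : 'M[C]_(m, n)) x : mderive (fun _ => A) x = 0.
Proof. by apply/matrixP => i j; rewrite !mxE cderive_cst. Qed.

Lemma mderiveD m n (F G : R -> 'M[C]_(m, n)) x : mderivable F -> mderivable G ->
  mderive (fun y => F y + G y) x = mderive F x + mderive G x.
Proof.
move=> dF dG; apply/matrixP => i j; rewrite !mxE -cderiveD//.
by congr (cderive _ x); apply/funext => y; rewrite mxE.
Qed.

Lemma mderiveM m n p (F : R -> 'M[C]_(m, n)) (G : R -> 'M[C]_(n, p)) x :
  mderivable F -> mderivable G ->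
  mderive (fun y => F y *m G y) x = mderive F x *m G x + F x *m mderive G x.
Proof.
move=> dF dG; apply/matrixP => i j; rewrite !mxE -big_split /=.
rewrite (_ : (fun y => _) = fun y => \sum_k F y i k * G y k j); last first.
  by apply/funext => y; rewrite mxE.
rewrite cderive_sum => [|k]; last exact: cderivableM.
by apply: eq_bigr => k _; rewrite !mxE cderiveM.
Qed.

Lemma mderiveT m n (F : R -> 'M[C]_(m, n)) x : mderive (fun y => (F y)^T) x = (mderive F x)^T.
Proof.
by apply/matrixP => i j; rewrite !mxE; congr (cderive _ x); apply/funext => y; rewrite mxE.
Qed.

Lemma mderive_tr n (F : R -> 'M[C]_n) x : mderivable F ->
  cderive (fun y => \tr (F y)) x = \tr (mderive F x).
Proof. by move=> dF; rewrite cderive_sum//; apply: eq_bigr => i _; rewrite mxE. Qed.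

Local Notation drvD := (mxclassD (@cderivableD R)).
Local Notation drvM := (mxclassM (@cderivable_cst R) (@cderivableD R) (@cderivableM R)).
Local Notation drvC := (mxclass_cst (@cderivable_cst R)).

Lemma mderivable_resid n l (B : 'M[C]_n) (F : R -> 'M[C]_(n, l)) :
  psd B -> (forall x, mxreal (F x)) -> mderivable F ->
  mderivable (fun x => resid B (F x)).
Proof.
move=> pB rF dF.
by case: (mxclass_resid (@cderivable_cst R) (@cderivableD R) (@cderivableM R)
  (@cderivableV R) pB rF dF).
Qed.

(** Differentiate (1 + B G) F = B, where G = W W^T, and multiply by 1 - F G, a left inverse of 1 + B
    G. Since (1 - F G) B = F, this gives F' = - F G' F. *)
Lemma mderive_resid n l (B : 'M[C]_n) (W : R -> 'M[C]_(n, l)) x :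
  psd B -> (forall x, mxreal (W x)) -> mderivable W ->
  mderive (fun x => resid B (W x)) x =
  - (resid B (W x) *m (mderive W x *m (W x)^T + W x *m (mderive W x)^T) *m resid B (W x)).
Proof.
move=> pB rW dW.
have dF := mderivable_resid pB rW dW.
have dWT : mderivable (fun x => (W x)^T) by exact: mxclassT.
have dG : mderivable (fun x => W x *m (W x)^T) by exact: drvM.
have d1 : mderivable (fun _ : R => 1%:M : 'M[C]_n) by exact: drvC.
have dB : mderivable (fun _ : R => B) by exact: drvC.
have dBG : mderivable (fun x => B *m (W x *m (W x)^T)) := drvM dB dG.
have dBG1 : mderivable (fun x => 1%:M + B *m (W x *m (W x)^T)) := drvD d1 dBG.
have h : mderive (fun x => (1%:M + B *m (W x *m (W x)^T)) *m resid B (W x)) x = 0.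
  rewrite (_ : (fun x => _) = fun _ => B); first exact: mderive_cst.
  by apply/funext => y; rewrite resid_mul.
rewrite (mderiveM x dBG1 dF) (mderiveD x d1 dBG) mderive_cst add0r in h.
rewrite (mderiveM x dB dG) mderive_cst mul0mx add0r (mderiveM x dW dWT) mderiveT in h.
set F := resid B (W x) in h *; set F' := mderive (fun x => resid B (W x)) x in h *.
set G' := mderive W x *m _ + _ in h *; set G := W x *m (W x)^T in h.
have hB : (1%:M - F *m G) *m B = F.
  have := resid_mulr pB (rW x); rewrite -/F -/G => hm.
  by rewrite mulmxBl mul1mx -[X in X - _]hm mulmxDr mulmx1 mulmxA addrK.
clearbody F F' G' G.
have h1 : (1%:M - F *m G) *m (1%:M + B *m G) = 1%:M.
  by rewrite mulmxDr mulmx1 [X in _ + X]mulmxA hB subrK.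
have := congr1 (mulmx (1%:M - F *m G)) h.
rewrite mulmx0 mulmxDr [X in _ + X]mulmxA h1 mul1mx !mulmxA hB.
by rewrite -mulmxA => /eqP; rewrite addrC addr_eq0 mulmxA => /eqP.
Qed.

Lemma cderivable_Re (f : R -> C) (x : R) : cderivable f ->
  is_derive x 1 (fun y => Re (f y)) (Re (cderive f x)).
Proof. by move=> df; have [rf _] := df x; split. Qed.

Lemma cderivable_continuous (f : R -> C) : cderivable f -> continuous (fun y => Re (f y)).
Proof.
move=> df x; have [h _] := df x.
exact/differentiable_continuous/derivable1_diffP.
Qed.

Definition entry_path n l (i : 'I_n) (j : 'I_l) (V : 'M[R]_(n, l)) (x : R) : 'M[C]_(n, l) :=
  cmatrix (set_entry i j x V).

Lemma entry_pathE n l (i : 'I_n) (j : 'I_l) V a b : (fun y => entry_path i j V y a b) =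
  if (a == i) && (b == j) then real_complex R else fun _ => (V a b)%:C%C.
Proof.
by case: ifP => ab; apply/funext => y; rewrite /entry_path /cmatrix !mxE ab.
Qed.

Lemma mderivable_entry_path n l (i : 'I_n) (j : 'I_l) V : mderivable (entry_path i j V).
Proof.
move=> a b; rewrite entry_pathE; case: ifP => _ x; last exact: cderivable_cst.
by split; [exact: derivable_id|exact: derivable_cst].
Qed.

Lemma mderive_entry_path n l (i : 'I_n) (j : 'I_l) V x :
  mderive (entry_path i j V) x = delta_mx i j.
Proof.
apply/matrixP => a b; rewrite !mxE entry_pathE; case: ifP => _.
  by rewrite /cderive /= derive_id derive_cst.
exact: cderive_cst.
Qed.

Lemma mxreal_cmatrix m n (V : 'M[R]_(m, n)) : mxreal (cmatrix V).
Proof.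
by apply/matrixP => i j; rewrite !mxE; apply/CrealP; rewrite complex_real.
Qed.

End MatrixDerivative.

(** * Growth of the residual and of its minimizer in the sample *)

Section Growth.
Context {R : realType} {n l : nat}.
Local Notation C := R[i].
Local Notation Re := (@complex.Re R).
Local Notation Im := (@complex.Im R).
Local Notation normc := (@Normc.normc R).
Implicit Types (f g : 'M[R]_(n, l) -> C) (V : 'M[R]_(n, l)).

Definition bdd f := exists K, forall V, normc (f V) <= K.

(** At most linear growth in the norm of V, stated for squares so that it compares directly with
    [wt]. *)
Definition lin_growth f := exists K, forall V, normc (f V) ^+ 2 <= K * wt V.

Lemma normc_ge0 (z : C) : 0 <= normc z.
Proof. by case: z => a b; exact: sqrtr_ge0. Qed.

Lemma normc_Re (z : C) : `|Re z| <= normc z.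
Proof. by rewrite -lecR; exact: normc_ge_Re. Qed.

Lemma normc_sum (I : Type) (s : seq I) (F : I -> C) :
  normc (\sum_(i <- s) F i) <= \sum_(i <- s) normc (F i).
Proof.
elim: s => [|i s IH]; first by rewrite !big_nil Normc.normc0.
by rewrite !big_cons (le_trans (le_normcD _ _))// lerD2l.
Qed.

Lemma normc_real (x : R) : normc x%:C%C = `|x|.
Proof. by rewrite /= expr0n addr0 sqrtr_sqr. Qed.

Lemma normc_conj (z : C) : normc (z^* )%R = normc z.
Proof. apply: complexI; exact: (norm_conjC z). Qed.

Lemma bdd_cst c : bdd (fun _ => c). Proof. by exists (normc c). Qed.

Lemma bddD f g : bdd f -> bdd g -> bdd (fun V => f V + g V).
Proof.
move=> [K fK] [L gL]; exists (K + L) => V.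
exact: (le_trans (le_normcD _ _) (lerD (fK V) (gL V))).
Qed.

Lemma bddM f g : bdd f -> bdd g -> bdd (fun V => f V * g V).
Proof.
by move=> [K fK] [L gL]; exists (K * L) => V; rewrite Normc.normcM ler_pM// normc_ge0.
Qed.

Lemma bdd_lin f : bdd f -> lin_growth f.
Proof.
move=> [K fK]; exists (K ^+ 2) => V.
apply: (@le_trans _ _ (K ^+ 2)); last by rewrite ler_peMr ?sqr_ge0// wt_ge1.
by rewrite !expr2 ler_pM ?normc_ge0.
Qed.

Lemma linD f g : lin_growth f -> lin_growth g -> lin_growth (fun V => f V + g V).
Proof.
move=> [K fK] [L gL]; exists (2 * (K + L)) => V.
have h := le_normcD (f V) (g V); have := fK V; have := gL V.
have f0 := normc_ge0 (f V); have g0 := normc_ge0 (g V); have fg0 := normc_ge0 (f V + g V).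
move=> h1 h2; have h3 : normc (f V + g V) ^+ 2 <= (normc (f V) + normc (g V)) ^+ 2.
  by rewrite !expr2 ler_pM.
have := sqr_ge0 (normc (f V) - normc (g V)); nra.
Qed.

Lemma bddM_lin f g : bdd f -> lin_growth g -> lin_growth (fun V => f V * g V).
Proof.
move=> [K fK] [L gL]; exists (K ^+ 2 * L) => V.
rewrite Normc.normcM exprMn -[leRHS]mulrA; apply: ler_pM => //; try exact: sqr_ge0.
by rewrite !expr2 ler_pM ?normc_ge0.
Qed.

Lemma bdd_eq f g : f =1 g -> bdd f -> bdd g. Proof. by move/funext->. Qed.
Lemma lin_eq f g : f =1 g -> lin_growth f -> lin_growth g. Proof. by move/funext->. Qed.

Lemma bdd_sum (I : Type) (s : seq I) (F : I -> 'M[R]_(n, l) -> C) :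
  (forall i, bdd (F i)) -> bdd (fun V => \sum_(i <- s) F i V).
Proof.
move=> bF; elim: s => [|i s IH].
  by apply: bdd_eq (bdd_cst 0) => x; rewrite big_nil.
by apply: bdd_eq (bddD (bF i) IH) => x; rewrite big_cons.
Qed.

Lemma lin_sum (I : Type) (s : seq I) (F : I -> 'M[R]_(n, l) -> C) :
  (forall i, lin_growth (F i)) -> lin_growth (fun V => \sum_(i <- s) F i V).
Proof.
move=> bF; elim: s => [|i s IH].
  by apply: lin_eq (bdd_lin (bdd_cst 0)) => x; rewrite big_nil.
by apply: lin_eq (linD (bF i) IH) => x; rewrite big_cons.
Qed.

Definition mbdd a b (F : 'M[R]_(n, l) -> 'M[C]_(a, b)) := mxclass bdd F.
Definition mlin a b (F : 'M[R]_(n, l) -> 'M[C]_(a, b)) := mxclass lin_growth F.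

Lemma mbddM a b c (F : 'M[R]_(n, l) -> 'M[C]_(a, b)) (G : 'M[R]_(n, l) -> 'M[C]_(b, c)) :
  mbdd F -> mbdd G -> mbdd (fun V => F V *m G V).
Proof. exact: (mxclassM bdd_cst bddD bddM). Qed.

Lemma mbddM_lin a b c (F : 'M[R]_(n, l) -> 'M[C]_(a, b)) (G : 'M[R]_(n, l) -> 'M[C]_(b, c)) :
  mbdd F -> mlin G -> mlin (fun V => F V *m G V).
Proof.
move=> bF lG i j.
apply: lin_eq (lin_sum (index_enum 'I_b) (fun k => bddM_lin (bF i k) (lG k j))) => V.
by rewrite mxE.
Qed.

Lemma mlin_cmatrix : mlin (fun V => cmatrix V).
Proof.
move=> i j; exists 1 => V; rewrite mul1r mxE normc_real real_normK ?num_real//.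
by apply: le_trans (wt_ge V i j); rewrite lerDr.
Qed.

Lemma sqr_normc_mul_conj (z : C) : (normc z ^+ 2)%:C%C = `|z| ^+ 2.
Proof. by rewrite rmorphXn. Qed.

Lemma RRe_ge0 (z : C) : 0 <= z -> (Re z)%:C%C = z.
Proof. by move=> z0; apply: RRe_real; exact: ger0_real. Qed.

(** For A = X X^H, the arithmetic-geometric inequality bounds entry i j by the mean of diagonal
    entries i and j, and each of these is at most the trace. *)
Lemma psd_entry_le m (A : 'M[C]_m) i j : psd A -> normc (A i j) <= Re (\tr A).
Proof.
move=> pA; rewrite -lecR RRe_ge0 ?psd_tr_ge0//.
rewrite -[X in X <= _]/(`|A i j|).
have [p [X ->]] := pA.
rewrite mxE.
under eq_bigr do rewrite adjE.
have h k : `|X i k * (X j k)^*| <= (`|X i k| ^+ 2 + `|X j k| ^+ 2) / 2.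
  rewrite normrM norm_conjC ler_pdivlMr// mulr_natr.
  rewrite -subr_ge0.
  have -> : `|X i k| ^+ 2 + `|X j k| ^+ 2 - `|X i k| * `|X j k| *+ 2 =
    (`|X i k| - `|X j k|) ^+ 2 by ring.
  by rewrite real_exprn_even_ge0// realB ?normr_real.
apply: (le_trans (ler_norm_sum _ _ _)); apply: (le_trans (ler_sum _ (fun k _ => h k))).
rewrite -mulr_suml big_split /= mxtrace_mul_adj ler_pdivrMr// mulr_natr mulr2n.
have r0 a : 0 <= \sum_k `|X a k| ^+ 2 by apply: sumr_ge0 => k _; exact: exprn_ge0.
have le_tr a : \sum_k `|X a k| ^+ 2 <= \sum_a \sum_k `|X a k| ^+ 2.
  by rewrite (bigD1 a)//= lerDl sumr_ge0.
by apply: lerD.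
Qed.

Section Resid.
Variable B : 'M[C]_n.
Hypothesis pB : psd B.

Definition residV V := resid B (cmatrix V).
Definition coefV V := coef B (cmatrix V).

Lemma residV_psd V : psd (residV V).
Proof. exact: (resid_psd pB (mxreal_cmatrix V)). Qed.

Lemma residV_tr_le V : \tr (residV V) <= \tr B.
Proof.
rewrite -subr_ge0 -linearB; apply: psd_tr_ge0.
exact: (resid_le pB (mxreal_cmatrix V)).
Qed.

Lemma mbdd_resid : mbdd residV.
Proof.
move=> i j; exists (Re (\tr B)) => V.
apply: (le_trans (psd_entry_le _ _ (residV_psd V))).
by have := residV_tr_le V; rewrite lecE => /andP[].
Qed.

(** Here the unit penalty pays off: Z^H Z is a summand of the residual, so the minimizer is bounded
    uniformly in V, whatever the rank of V. *)
Lemma coef_tr_le V : \tr (coefV V *m (coefV V) ^t*) <= \tr B.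
Proof.
apply: le_trans (residV_tr_le V).
rewrite mxtrace_mulC /residV (residE pB (mxreal_cmatrix V)) linearD /= lerDr.
apply: psd_tr_ge0; rewrite -{2}(trmxCK (defect B (cmatrix V))); exact: psd_congr.
Qed.

Lemma coef_entry_le V i j : normc (coefV V i j) <= 1 + Re (\tr B).
Proof.
have h : normc (coefV V i j) ^+ 2 <= Re (\tr B).
  rewrite -lecR RRe_ge0 ?psd_tr_ge0// sqr_normc_mul_conj.
  apply: le_trans (coef_tr_le V); rewrite mxtrace_mul_adj (bigD1 i)//= (bigD1 j)//=.
  rewrite -addrA lerDl addr_ge0//; first by apply: sumr_ge0 => k _; exact: exprn_ge0.
  by apply: sumr_ge0 => a _; apply: sumr_ge0 => k _; exact: exprn_ge0.
have := sqr_ge0 (normc (coefV V i j) - 1); have := normc_ge0 (coefV V i j); nra.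
Qed.

Lemma mbdd_coef : mbdd coefV.
Proof. by move=> i j; exists (1 + Re (\tr B)) => V; exact: coef_entry_le. Qed.

Lemma mbdd_coef_adj : mbdd (fun V => (coefV V) ^t*).
Proof.
move=> i j; have [K hK] := mbdd_coef j i; exists K => V.
by rewrite adjE normc_conj.
Qed.

End Resid.

End Growth.

Section RegularFields.
Context {R : realType} {n l : nat}.
Local Notation C := R[i].
Local Notation Re := (@complex.Re R).
Local Notation Im := (@complex.Im R).
Implicit Types (f g : 'M[R]_(n, l) -> C) (V : 'M[R]_(n, l)).

(** Differentiability is required along single entries only, which is what the entrywise [stein]
    uses. *)
Definition regular f := cmeasurable (f : @mx_space R n l -> C) /\
  forall i j V, cderivable (fun x => f (set_entry i j x V)).

Lemma regular_cst c : regular (fun _ => c).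
Proof. by split=> [|i j V]; [exact: cmeasurable_cst|exact: cderivable_cst]. Qed.

Lemma regularD f g : regular f -> regular g -> regular (fun V => f V + g V).
Proof.
by move=> [mf df] [mg dg]; split=> [|i j V]; [exact: cmeasurableD|exact: cderivableD].
Qed.

Lemma regularM f g : regular f -> regular g -> regular (fun V => f V * g V).
Proof.
by move=> [mf df] [mg dg]; split=> [|i j V]; [exact: cmeasurableM|exact: cderivableM].
Qed.

Lemma regularV f : (forall V, f V != 0) -> regular f -> regular (fun V => (f V)^-1).
Proof.
by move=> f0 [mf df]; split=> [|i j V]; [exact: cmeasurableV|exact: cderivableV].
Qed.

Definition mregular a b (F : 'M[R]_(n, l) -> 'M[C]_(a, b)) := mxclass regular F.

Definition mregularC := @mxclass_cst R _ _ regular_cst.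
Definition mregularD := @mxclassD R _ _ regularD.
Definition mregularN := @mxclassN R _ _ regular_cst regularM.
Definition mregularM := @mxclassM R _ _ regular_cst regularD regularM.
Definition mregularT := @mxclassT R _ regular.
Definition mregular_tr := @mxclass_tr R _ _ regular_cst regularD.

Lemma mregular_cmatrix : mregular (fun V => cmatrix V).
Proof.
move=> a b; split=> [|i j V]; last exact: mderivable_entry_path.
split.
  rewrite (_ : (fun _ => _) = fun V : @mx_space R n l => (V : 'M[R]_(n, l)) a b).
    exact: measurable_mx_coord.
  by apply/funext => V; rewrite mxE.
rewrite (_ : (fun _ => _) = fun V : @mx_space R n l => 0 : R); first exact: measurable_cst.
by apply/funext => V; rewrite mxE.
Qed.

Lemma mregular_resid (B : 'M[C]_n) : psd B ->
  mregular (coefV (l := l) B) /\ mregular (residV (l := l) B).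
Proof.
move=> pB; apply: (mxclass_resid regular_cst regularD regularM regularV pB).
  exact: mxreal_cmatrix.
exact: mregular_cmatrix.
Qed.

Lemma lin_growth_Re f : lin_growth f -> exists2 K, 0 <= K & forall V, Re (f V) ^+ 2 <= K * wt V.
Proof.
move=> [K fK]; exists `|K| => // V.
have h := normc_Re (f V).
apply: (@le_trans _ _ (K * wt V)); last first.
  by rewrite ler_wpM2r ?ler_norm// (le_trans _ (wt_ge1 V)).
apply: le_trans (fK V); rewrite -(real_normK (num_real (Re _))).
by rewrite !expr2 ler_pM.
Qed.

End RegularFields.

Section SteinFields.
Context {d : measure_display} {T : measurableType d} {R : realType}.
Variables (P : probability T R) (n l : nat) (W : 'I_n -> 'I_l -> {RV P >-> R}).
Hypothesis hW : gaussian_matrix W.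
Local Notation C := R[i].
Local Notation Re := (@complex.Re R).

Lemma tame_Re (f : 'M[R]_(n, l) -> C) : regular f -> lin_growth f ->
  tame (fun V => Re (f V)).
Proof.
move=> [[mf _] _] /lin_growth_Re[K K0 fK].
exact: tame_sqr_bound fK.
Qed.

Lemma Re_sum (I : Type) (s : seq I) (F : I -> C) :
  Re (\sum_(i <- s) F i) = \sum_(i <- s) Re (F i).
Proof. by elim/big_rec2: _ => // i x y _ <-; rewrite ReD. Qed.

(** Divergence form of Stein's identity: [Psi i j] is the derivative of entry i j of [Phi] in the
    same entry of V. Both sides are kept in one integrand [h], so that a pointwise bound on [h] can
    be integrated directly. *)
Lemma stein_field (Phi : 'M[R]_(n, l) -> 'M[C]_(n, l))
    (Psi : 'I_n -> 'I_l -> 'M[R]_(n, l) -> C) :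
  mregular Phi -> mlin Phi ->
  (forall i j, regular (Psi i j)) -> (forall i j, lin_growth (Psi i j)) ->
  (forall i j V x, cderive (fun x => Phi (set_entry i j x V) i j) x =
     Psi i j (set_entry i j x V)) ->
  let h := fun V => Re (\tr ((cmatrix V)^T *m Phi V) - \sum_i \sum_j Psi i j V) in
  tame h /\ Ex W h = 0.
Proof.
move=> rPhi lPhi rPsi lPsi dPhi h.
pose a ij := fun V : 'M[R]_(n, l) => V ij.1 ij.2 * Re (Phi V ij.1 ij.2).
pose b ij := fun V : 'M[R]_(n, l) => Re (Psi ij.1 ij.2 V).
have ta ij : tame (a ij).
  have [K K0 fK] := lin_growth_Re (lPhi ij.1 ij.2).
  by apply: tame_entryM fK; case: (rPhi ij.1 ij.2) => -[].
have tb ij : tame (b ij) by exact: tame_Re.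
have tab ij : tame (fun V => a ij V + -1 * b ij V) by apply: tameD => //; exact: tameZ.
have hE : h = fun V => \sum_(ij <- index_enum _) (a ij V + -1 * b ij V).
  apply/funext => V; rewrite /h [in RHS]big_split /=.
  have -> (z w : C) : Re (z - w) = Re z + -1 * Re w.
    by case: z w => x y [u v] /=; rewrite mulN1r.
  congr (_ + _).
    have -> : \tr ((cmatrix V)^T *m Phi V) = \sum_j \sum_i (V i j)%:C%C * Phi V i j.
      by apply: eq_bigr => j _; rewrite mxE; apply: eq_bigr => i _; rewrite !mxE.
    rewrite exchange_big pair_bigA /= Re_sum; apply: eq_bigr => -[i j] _ /=.
    by rewrite ReM /= mul0r subr0.
  rewrite pair_bigA /= Re_sum mulr_sumr; apply: eq_bigr => -[i j] _ //.
rewrite hE; split; first exact: tame_sum.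
rewrite (Ex_sum hW)//; apply: big1 => -[i j] _.
rewrite (ExD hW)//; last exact: tameZ.
rewrite (ExZ hW)// mulN1r; apply/eqP; rewrite subr_eq0; apply/eqP.
have [K K0 fK] := lin_growth_Re (lPhi i j).
have [L L0 gL] := lin_growth_Re (lPsi i j).
have KL (x : R) V : (x <= K * wt V) || (x <= L * wt V) -> x <= (K + L) * wt V.
  have w0 := le_trans ler01 (wt_ge1 V).
  by rewrite mulrDl => /orP[] /le_trans ->//; rewrite ?lerDl ?lerDr mulr_ge0.
apply: (@stein _ _ _ _ _ _ _ hW i j (fun V => Re (Phi V i j)) (fun V => Re (Psi i j V)) (K + L)).
- by case: (rPhi i j) => -[].
- by case: (rPsi i j) => -[].
- by move=> V; apply: KL; rewrite fK.
- by move=> V; apply: KL; rewrite gL orbT.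
- move=> V x; rewrite -dPhi; apply: cderivable_Re.
  by case: (rPhi i j) => _ /(_ i j V).
- move=> V; apply: cderivable_continuous.
  by case: (rPsi i j) => _ /(_ i j V).
Qed.

End SteinFields.

Section DeltaSums.
Context {C : comNzRingType}.

Lemma mulmx_deltaE m n p q (A : 'M[C]_(m, n)) (B : 'M[C]_(p, q)) i j a b :
  (A *m delta_mx i j *m B) a b = A a i * B j b.
Proof.
rewrite mxE (bigD1 j)//= [X in _ + X]big1 ?addr0 => [|k kj]; last first.
  rewrite mxE big1 ?mul0r// => s _.
  by rewrite mxE (negbTE kj) andbF mulr0.
rewrite mxE (bigD1 i)//= [X in (_ + X) * _]big1 ?addr0 => [|k ki]; last first.
  by rewrite mxE (negbTE ki) mulr0.
by rewrite mxE !eqxx mulr1.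
Qed.

(** This and the next two sums evaluate divergences of matrix products: an increment enclosed
    between two factors gives a product of traces, a transposed increment gives a single trace. *)
Lemma sum_mulmx_delta_mul n l (A : 'M[C]_n) (B : 'M[C]_l) :
  \sum_i \sum_j (A *m delta_mx i j *m B) i j = \tr A * \tr B.
Proof.
rewrite mulr_suml; apply: eq_bigr => i _; rewrite mulr_sumr; apply: eq_bigr => j _.
by rewrite mulmx_deltaE.
Qed.

Lemma sum_mulmx_delta_tr n l (A : 'M[C]_(n, l)) (B : 'M[C]_(n, l)) :
  \sum_i \sum_j (A *m (delta_mx i j)^T *m B) i j = \tr (A^T *m B).
Proof.
rewrite exchange_big; apply: eq_bigr => j _; rewrite mxE; apply: eq_bigr => i _.
by rewrite trmx_delta mulmx_deltaE !mxE.
Qed.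

Lemma sum_mulmx_delta n l (A : 'M[C]_n) :
  \sum_i \sum_(j < l) (A *m delta_mx i j) i j = \tr A *+ l.
Proof.
rewrite -sumrMnl; apply: eq_bigr => i _; rewrite -[in RHS](card_ord l) -sumr_const.
apply: eq_bigr => j _.
by rewrite -[_ *m _]mulmx1 mulmx_deltaE mxE eqxx mulr1.
Qed.

Lemma mxtrace_mulmx_delta n l m (A : 'M[C]_(m, n)) (B : 'M[C]_(l, m)) i j :
  \tr (A *m delta_mx i j *m B) = (B *m A) j i.
Proof.
rewrite mxE; apply: eq_bigr => a _.
by rewrite mulmx_deltaE mulrC.
Qed.

End DeltaSums.

(** * Stein's identity for the residual and the bound for boosted matrices *)

Section SteinResidual.
Context {d : measure_display} {T : measurableType d} {R : realType}.
Variables (P : probability T R) (n l : nat) (W : 'I_n -> 'I_l -> {RV P >-> R}).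
Hypothesis hW : gaussian_matrix W.
Local Notation C := R[i].
Local Notation Re := (@complex.Re R).
Variable B : 'M[C]_n.
Hypothesis pB : psd B.
Local Notation F := (residV (l := l) B).
Local Notation Z := (coefV (l := l) B).
Local Notation Wc V := (cmatrix V : 'M[C]_(n, l)).

Let rF : mregular F. Proof. by case: (mregular_resid (l := l) pB). Qed.
Let rZ : mregular Z. Proof. by case: (mregular_resid (l := l) pB). Qed.
Let rW := @mregular_cmatrix R n l.
Let bF := @mbdd_resid R n l _ pB.
Let bZ := @mbdd_coef R n l _ pB.
Let lW := @mlin_cmatrix R n l.

Lemma residV_mul_cmatrix V : F V *m Wc V = (Z V) ^t*.
Proof.
have rV := mxreal_cmatrix V.
by rewrite /coefV -(tr_resid pB rV) adjM (resid_adj pB rV) mxreal_tr_adj.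
Qed.

Lemma tr_cmatrix_mul_residV V : (Wc V)^T *m F V = Z V.
Proof. exact: (tr_resid pB (mxreal_cmatrix V)). Qed.

Let rZa : mregular (fun V => (Z V) ^t*).
Proof.
move=> i j; have := mregularM rF rW i j.
rewrite (_ : (fun V => (F V *m Wc V) i j) = fun V => (Z V) ^t* i j)//.
by apply/funext => V; rewrite residV_mul_cmatrix.
Qed.
Let bZa := @mbdd_coef_adj R n l _ pB.

Lemma mderivable_residV i j V : mderivable (fun x => F (set_entry i j x V)).
Proof. by move=> a b; case: (rF a b) => _; exact. Qed.

Lemma mderive_residV i j V x : mderive (fun x => F (set_entry i j x V)) x =
  - (F (set_entry i j x V) *m delta_mx i j *m Z (set_entry i j x V) +
     (Z (set_entry i j x V)) ^t* *m (delta_mx i j)^T *m F (set_entry i j x V)).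
Proof.
have rV y : mxreal (entry_path i j V y) by exact: mxreal_cmatrix.
rewrite (mderive_resid x pB rV (mderivable_entry_path i j V)) mderive_entry_path.
rewrite -residV_mul_cmatrix -tr_cmatrix_mul_residV mulmxDr mulmxDl.
by rewrite /residV /entry_path !mulmxA.
Qed.

(** The field is F M V. The derivative of F has one term for each occurrence of V in V V^T: the
    first produces tr F tr (M V Z), the second has a transposed increment and produces conj Z, the
    plain transpose of Z^H. *)
Lemma stein_resid (M : 'M[C]_n) :
  let h := fun V => Re ((1 + \tr (F V)) * \tr (M *m (Wc V *m Z V))
     - \tr (F V *m M) *+ l + \tr (Wc V *m mxconj (Z V) *m F V *m M)) in
  tame h /\ Ex W h = 0.
Proof.
pose Phi V := F V *m M *m Wc V.
pose Psi i j V := (F V *m M *m delta_mx i j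
   - (F V *m delta_mx i j *m Z V + (Z V) ^t* *m (delta_mx i j)^T *m F V) *m M *m Wc V) i j.
have rM : mregular (fun _ : 'M[R]_(n, l) => M) by exact: mregularC.
have bC a b (A : 'M[C]_(a, b)) : mbdd (fun _ : 'M[R]_(n, l) => A).
  by move=> ? ?; exact: bdd_cst.
have rC a b (A : 'M[C]_(a, b)) : mregular (fun _ : 'M[R]_(n, l) => A) by exact: mregularC.
have rFM := mregularM rF rM; have bFM := mbddM bF (bC _ _ M).
have rPhi : mregular Phi := mregularM rFM rW.
have lPhi : mlin Phi := mbddM_lin bFM lW.
have rPsi i j : regular (Psi i j).
  have r1 := mregularM rFM (rC _ _ (delta_mx i j)).
  have r2 := mregularM (mregularM rF (rC _ _ (delta_mx i j))) rZ.
  have r3 := mregularM (mregularM rZa (rC _ _ (delta_mx i j)^T)) rF.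
  exact: (mregularD r1 (mregularN (mregularM (mregularM (mregularD r2 r3) rM) rW))).
have lPsi i j : lin_growth (Psi i j).
  have b1 := mbddM bFM (bC _ _ (delta_mx i j)) i j.
  have b2 := mbddM (mbddM bF (bC _ _ (delta_mx i j))) bZ.
  have b3 := mbddM (mbddM bZa (bC _ _ (delta_mx i j)^T)) bF.
  have l4 := mbddM_lin (mbddM (mxclassD (@bddD R n l) b2 b3) (bC _ _ M)) lW i j.
  apply: lin_eq (linD (bdd_lin b1) (bddM_lin (bdd_cst (-1)) l4)) => V.
  by rewrite /Psi [in RHS]mxE [X in _ = _ + X]mxE mulN1r.
have dPhi i j V x : cderive (fun x => Phi (set_entry i j x V) i j) x =
    Psi i j (set_entry i j x V).
  have -> : cderive (fun x => Phi (set_entry i j x V) i j) x =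
      mderive (fun x => Phi (set_entry i j x V)) x i j by rewrite mxE.
  rewrite /Psi; congr (fun_of_matrix _ i j); rewrite /Phi.
  have dF := @mderivable_residV i j V.
  have dM : mderivable (fun _ : R => M) by apply: mxclass_cst; exact: cderivable_cst.
  have dFM : mderivable (fun x => F (set_entry i j x V) *m M).
    exact: (mxclassM (@cderivable_cst R) (@cderivableD R) (@cderivableM R) dF dM).
  have dW := mderivable_entry_path i j V.
  rewrite (mderiveM x dFM dW) (mderiveM x dF dM) mderive_cst mulmx0 addr0.
  by rewrite mderive_residV mderive_entry_path !mulNmx addrC.
have [th eh] := stein_field hW rPhi lPhi rPsi lPsi dPhi.
suff hE : (fun V => Re (\tr ((cmatrix V)^T *m Phi V) - \sum_i \sum_j Psi i j V)) =
  fun V => Re ((1 + \tr (F V)) * \tr (M *m (Wc V *m Z V))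
     - \tr (F V *m M) *+ l + \tr (Wc V *m mxconj (Z V) *m F V *m M)).
  by rewrite hE in th eh.
apply/funext => V; congr Re.
have t1 : \tr ((cmatrix V)^T *m Phi V) = \tr (M *m (Wc V *m Z V)).
  rewrite /Phi; have := tr_cmatrix_mul_residV V.
  move: (F V) (Z V) => F0 Z0 tZ.
  by rewrite !mulmxA tZ -mulmxA mxtrace_mulC ?mulmxA.
have t2 : \sum_i \sum_j Psi i j V = \tr (F V *m M) *+ l
    - \tr (F V) * \tr (M *m (Wc V *m Z V)) - \tr (Wc V *m mxconj (Z V) *m F V *m M).
  have -> : \sum_i \sum_j Psi i j V = \sum_i \sum_(j < l) (F V *m M *m delta_mx i j) i j -
    \sum_i \sum_j (F V *m delta_mx i j *m (Z V *m M *m Wc V)) i j -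
    \sum_i \sum_j ((Z V) ^t* *m (delta_mx i j)^T *m (F V *m M *m Wc V)) i j.
    rewrite -!sumrB; apply: eq_bigr => i _; rewrite -!sumrB; apply: eq_bigr => j _.
    rewrite /Psi; move: (F V) (Z V) => F0 Z0.
    by rewrite mxE [X in _ + X]mxE !mulmxDl [X in _ - X]mxE opprD addrA !mulmxA.
  rewrite sum_mulmx_delta sum_mulmx_delta_mul sum_mulmx_delta_tr.
  move: (F V) (Z V) => F0 Z0; congr (_ - _ * _ - _).
    by rewrite -mulmxA mxtrace_mulC -?mulmxA.
  by rewrite map_trmx trmxK -!mulmxA [in RHS]mxtrace_mulC ?mulmxA.
rewrite t1 t2.
have ring_eq (a b c e : C) : a - (b - e * a - c) = (1 + e) * a - b + c by ring.
exact: ring_eq.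
Qed.

End SteinResidual.

Section MeanResidual.
Context {d : measure_display} {T : measurableType d} {R : realType}.
Variables (P : probability T R) (n l : nat) (W : 'I_n -> 'I_l -> {RV P >-> R}).
Hypothesis hW : gaussian_matrix W.
Local Notation C := R[i].
Local Notation Re := (@complex.Re R).

Definition mean_resid (B : 'M[C]_n) : R := Ex W (fun V => Re (\tr (residV (l := l) B V))).

Lemma Re_le (z w : C) : z <= w -> Re z <= Re w.
Proof. by rewrite lecE => /andP[]. Qed.

Lemma ReN (z : C) : Re (- z) = - Re z. Proof. by case: z. Qed.
Lemma Re_mulrn (z : C) k : Re (z *+ k) = Re z *+ k.
Proof. by elim: k => [|k IH] //; rewrite !mulrS ReD IH. Qed.

Lemma tame_tr_resid (B : 'M[C]_n) : psd B ->
  tame (fun V => Re (\tr (residV (l := l) B V))).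
Proof.
move=> pB; apply: tame_Re.
  by apply: mregular_tr; case: (mregular_resid (l := l) pB).
by apply: bdd_lin; apply: bdd_sum => i; exact: mbdd_resid.
Qed.

(** Take M = P in [stein_resid] and write V Z = 1 - D. The terms in D have a favourable sign and are
    dropped, and tr (F P) is at least tr F - tr ((1 - P) b). In the result, k = tr P and l - 1 is l
    from the divergence of V minus 1 from the transposed term. *)
Lemma mean_resid_boost_le (b Pr : 'M[C]_n) (t : C) (k : nat) : (0 < l)%N ->
  psd b -> mxreal b -> b \in unitmx -> 1 < t ->
  Pr ^t* = Pr -> Pr *m Pr = Pr -> Pr *m b = b *m Pr -> \tr Pr = k%:R ->
  (l%:R - 1 - k%:R) * mean_resid (boost b Pr t) <=
  k%:R + (l%:R - 1) * Re (\tr ((1%:M - Pr) *m b)).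
Proof.
move=> l0 pb rb ub t1 aP PP Pb trP.
have pB : psd (boost b Pr t) by exact: boost_psd.
have [th eh] := stein_resid hW pB Pr.
set h := fun V => _ in th eh.
have tF := tame_tr_resid pB.
set c := Re (\tr ((1%:M - Pr) *m b)).
suff hle V : h V <= (k%:R + (l%:R - 1) * c)
    + - (l%:R - 1 - k%:R) * Re (\tr (residV (l := l) (boost b Pr t) V)).
  have tR : tame (fun V : 'M[R]_(n, l) => - (l%:R - 1 - k%:R) *
      Re (\tr (residV (l := l) (boost b Pr t) V))) by exact: tameZ.
  have tC : tame (fun V : 'M[R]_(n, l) => k%:R + (l%:R - 1) * c) by exact: tame_cst.
  have := le_Ex hW th (tameD tC tR) hle.
  rewrite eh (ExD hW)// (Ex_cst W) (ExZ hW)// -/(mean_resid _).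
  by rewrite mulNr subr_ge0.
have rV := mxreal_cmatrix V.
have pF : psd (residV (l := l) (boost b Pr t) V) by exact: residV_psd.
have hD := boost_tr_defect_ge0 pb ub t1 aP PP Pb rV.
have hC := boost_tr_compl_le pb t1 aP PP Pb rV.
have hX := boost_cross_ge0 pb rb ub t1 aP PP Pb rV.
rewrite /h.
have hZ : coefV (l := l) (boost b Pr t) V = coef (boost b Pr t) (cmatrix V) by [].
rewrite hZ; move: hD hC hX; rewrite /defect -/(residV (boost b Pr t) V).
set F := residV _ _ in pF *; set Z := coef _ _; set Wc := cmatrix V in rV *.
clearbody F Z => hD hC hX.
have e1 : \tr (Pr *m (Wc *m Z)) = k%:R - \tr (Pr *m (1%:M - Wc *m Z)).
  by rewrite mulmxBr mulmx1 linearB /= trP opprB addrC subrK.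
have e2 : \tr (Wc *m mxconj Z *m F *m Pr) =
    \tr (F *m Pr) - \tr (Pr *m mxconj (1%:M - Wc *m Z) *m F).
  rewrite map_mxB map_mx1 map_mxM rV mulmxBr mulmx1 mulmxBl linearB /=.
  rewrite [\tr (Pr *m F)]mxtrace_mulC opprB addrC subrK.
  by rewrite [LHS]mxtrace_mulC !mulmxA.
have e3 : \tr ((1%:M - Pr) *m F) = \tr F - \tr (F *m Pr).
  by rewrite mulmxBl mul1mx linearB /= [\tr (Pr *m F)]mxtrace_mulC.
rewrite e1 e2; rewrite e3 in hC.
have F0 := psd_tr_ge0 pF.
move/Re_le : hX; rewrite ReD.
have -> (z : C) : Re (z^*)%R = Re z by case: z.
move: hC => /Re_le; rewrite ReD ReN -/c => hC hX.
rewrite !ReD ReN Re_mulrn ReM ReD ReN !ReD ReN /=.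
(* The traces of F and of P D are nonnegative in C, hence real, so the real part of their product
   splits. *)
move/Re_le : (hD) => /= hD'; have := ger0_Im hD; have := ger0_Im F0.
move/Re_le : (F0) => /= F0'.
move=> iF iD; rewrite ImD iF /= addr0 mul0r subr0.
have -> : Re (k%:R : C) = k%:R by rewrite -(rmorph_nat (real_complex R)).
move: hX hC F0' hD'; rewrite -mulr_natr /=.
move: (Re (\tr F)) (Re (\tr (F *m Pr))) (Re (\tr (Pr *m (1%:M - Wc *m Z)))) (Re _).
move=> f x delta y hX hC f0 delta0.
have l1 : 0 <= l%:R - 1 :> R by rewrite subr_ge0 ler1n.
have p1 : 0 <= (l%:R - 1) * (c - (f - x)) by rewrite mulr_ge0// subr_ge0.
have p2 : 0 <= (1 + f) * delta by rewrite mulr_ge0// addr_ge0.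
have {hX} y0 : 0 <= y by rewrite -mulr2n pmulrn_lge0 in hX.
rewrite -subr_ge0; apply: (le_trans (addr_ge0 (addr_ge0 p1 p2) y0)).
by rewrite le_eqVlt; apply/orP; left; apply/eqP; ring.
Qed.

End MeanResidual.

(** * Orthogonal invariance *)

Section RotationStep.
Context {d : measure_display} {T : measurableType d} {R : realType}.
Variables (P : probability T R) (n l : nat) (W : 'I_n -> 'I_l -> {RV P >-> R}).
Hypothesis hW : gaussian_matrix W.
Local Notation C := R[i].
Local Notation Re := (@complex.Re R).
Local Notation normc := (@Normc.normc R).
Implicit Types (V : 'M[R]_(n, l)) (B : 'M[C]_n).

Definition defectV B V := defect B (cmatrix V : 'M[C]_(n, l)).

Lemma normc_entry_sqrt V i j : `|V i j| <= Num.sqrt (wt V).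
Proof.
rewrite -sqrtr_sqr ler_wsqrtr//; apply: le_trans (wt_ge V i j).
by rewrite lerDr.
Qed.

Lemma sqrt_wt_ge1 V : 1 <= Num.sqrt (wt V).
Proof. by rewrite -[X in X <= _]sqrtr1 ler_wsqrtr// wt_ge1. Qed.

Lemma defect_entry_le B V c a b : psd B -> Re (\tr B) <= c ->
  normc (defectV B V a b) <= (1 + l%:R * (1 + c)) * Num.sqrt (wt V).
Proof.
move=> pB Bc; rewrite /defectV /defect mxE.
have r1 := sqrt_wt_ge1 V; set r := Num.sqrt (wt V) in r1 *.
apply: (le_trans (le_normcD _ _)); rewrite mulrDl mul1r; apply: lerD.
  apply: le_trans r1; rewrite mxE; case: (_ == _) => /=.
    by rewrite expr1n expr0n addr0 sqrtr1.
  by rewrite expr0n addr0 sqrtr0.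
rewrite mxE normcN mxE; apply: (le_trans (normc_sum _ _)).
rewrite -mulrA mulr_natl -[X in _ *+ X]card_ord -sumr_const; apply: ler_sum => j _.
rewrite Normc.normcM mulrC ler_pM ?normc_ge0//.
  by apply: (le_trans (coef_entry_le pB _ _ _)); rewrite lerD2l.
by rewrite mxE normc_real normc_entry_sqrt.
Qed.

(** One factor n for each of the three index sums in tr (Y D D^H), times the square of the constant
    in [defect_entry_le]. *)
Definition step_const (c : R) : R := n%:R * (n%:R * (n%:R * (1 + l%:R * (1 + c)) ^+ 2)).

Lemma step_const_ge0 c : 0 <= step_const c.
Proof. by do 3!(apply: mulr_ge0 => //); exact: sqr_ge0. Qed.

Lemma tr_defect_le B V (Y : 'M[C]_n) c y : psd B -> Re (\tr B) <= c ->
  (forall a b, normc (Y a b) <= y) ->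
  `|Re (\tr (Y *m (defectV B V *m (defectV B V) ^t*)))| <= y * step_const c * wt V.
Proof.
move=> pB Bc Yy.
have K0 (a b : 'I_n) : 0 <= y by exact: le_trans (normc_ge0 (Y a b)) (Yy a b).
apply: (le_trans (normc_Re _)); apply: (le_trans (normc_sum _ _)).
have -> : y * step_const c * wt V = \sum_(a < n) \sum_(b < n) \sum_(e < n)
    (y * ((1 + l%:R * (1 + c)) * Num.sqrt (wt V)) ^+ 2).
  have sc (x : R) : \sum_(i < n) x = n%:R * x by rewrite sumr_const card_ord mulr_natl.
  rewrite !sc /step_const exprMn sqr_sqrtr; last first.
    exact: le_trans (wt_ge1 V).
  ring.
apply: ler_sum => a _; rewrite mxE; apply: (le_trans (normc_sum _ _)).
apply: ler_sum => b _; rewrite Normc.normcM mxE.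
apply: (le_trans (ler_wpM2l (normc_ge0 _) (normc_sum _ _))).
rewrite mulr_sumr; apply: ler_sum => e _.
rewrite Normc.normcM adjE normc_conj; apply: ler_pM; rewrite ?mulr_ge0 ?normc_ge0//.
by rewrite expr2 ler_pM ?normc_ge0 ?defect_entry_le.
Qed.

(** The closure rules for [regular] do not cover conjugation, so D^H is needed in a form free of
    it. *)
Lemma defect_adj B V : psd B ->
  (defectV B V) ^t* = 1%:M - residV B V *m (cmatrix V *m (cmatrix V)^T).
Proof.
move=> pB; rewrite /defectV /residV (defectE pB (mxreal_cmatrix V)).
have rV := mxreal_cmatrix V.
have aG := mxreal_gram_adj rV.
move: (resid_adj pB rV); move: (resid B (cmatrix V)) => F aF.
by rewrite adjB adj1 adjM aF aG.
Qed.

Lemma regular_defect B : psd B ->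
  mregular (fun V => defectV B V *m (defectV B V) ^t*).
Proof.
move=> pB; have [rZ rF] := mregular_resid (l := l) pB.
have rW := @mregular_cmatrix R n l.
have r1 : mregular (fun _ : 'M[R]_(n, l) => 1%:M : 'M[C]_n) by exact: mregularC.
have rD : mregular (defectV B) := mregularD r1 (mregularN (mregularM rW rZ)).
have rDa : mregular (fun V => (defectV B V) ^t*).
  rewrite (_ : (fun V => _) = fun V => 1%:M + - (residV B V *m (cmatrix V *m (cmatrix V)^T))).
    exact: (mregularD r1 (mregularN (mregularM rF (mregularM rW (mregularT rW))))).
  by apply/funext => V; rewrite defect_adj.
exact: (mregularM rD rDa).
Qed.

Lemma tame_tr_defect B (Y : 'M[C]_n) : psd B ->
  tame (fun V => Re (\tr (Y *m (defectV B V *m (defectV B V) ^t*)))).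
Proof.
move=> pB.
have rY : mregular (fun _ : 'M[R]_(n, l) => Y) by exact: mregularC.
split; first by have [[] ] := mregular_tr (mregularM rY (regular_defect pB)).
exists ((\sum_a \sum_b normc (Y a b)) * step_const (Re (\tr B))) => V.
apply: tr_defect_le => // a b.
rewrite (bigD1 a)//= (bigD1 b)//= -addrA lerDl addr_ge0//.
  by rewrite sumr_ge0// => i _; exact: normc_ge0.
by rewrite sumr_ge0// => i _; rewrite sumr_ge0// => j _; exact: normc_ge0.
Qed.

(** The minimizer for [B] is a competitor for [B']. The matrix D D^H thus acts as a supergradient at
    [B] of a concave function. *)
Lemma mean_resid_le B B' : psd B -> psd B' ->
  mean_resid (l := l) W B' <=
  mean_resid W B + Ex W (fun V => Re (\tr ((B' - B) *m (defectV B V *m (defectV B V) ^t*)))).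
Proof.
move=> pB pB'.
have tB := tame_tr_resid l pB; have tB' := tame_tr_resid l pB'.
have tD := tame_tr_defect (B' - B) pB.
rewrite /mean_resid -(ExD hW)//; apply: le_Ex => //; first exact: tameD.
move=> V /=; rewrite -ReD; apply: Re_le.
have rV := mxreal_cmatrix V.
have := psd_tr_ge0 (resid_le_any pB' rV (coef B (cmatrix V))).
rewrite -/(defect B (cmatrix V)) linearB /= subr_ge0 => /le_trans; apply.
rewrite -[defect B (cmatrix V)]/(defectV B V).
have -> : \tr (residV B V) = \tr ((defectV B V) ^t* *m B *m defectV B V +
    (coef B (cmatrix V)) ^t* *m coef B (cmatrix V)).
  by rewrite /residV (residE pB rV).
move: (defectV B V) (coef B (cmatrix V)) => D Z.
have -> : \tr ((B' - B) *m (D *m D ^t*)) = \tr (D ^t* *m B' *m D) - \tr (D ^t* *m B *m D).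
  by rewrite mulmxA mxtrace_mulC !mulmxA -linearB /= -mulmxBl -mulmxBr.
rewrite [X in X <= _]mxtraceD [X in _ <= X + _]mxtraceD addrAC addrCA subrr addr0.
by [].
Qed.

End RotationStep.

Section RotationInvariance.
Context {d : measure_display} {T : measurableType d} {R : realType}.
Variables (P : probability T R) (n l : nat) (W : 'I_n -> 'I_l -> {RV P >-> R}).
Hypothesis hW : gaussian_matrix W.
Local Notation C := R[i].
Local Notation Re := (@complex.Re R).
Local Notation normc := (@Normc.normc R).
Implicit Types (V : 'M[R]_(n, l)) (B J : 'M[C]_n).

(** Stein's identity for the field tr (F) J V. As J is antisymmetric, J V is tangent to the
    rotations of V: tr (V^T J V) = 0 and its divergence l tr J is 0. Only the derivative of tr F
    along J V remains, and its mean must vanish. *)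
Lemma stein_skew B J : psd B -> J^T = - J ->
  Ex W (fun V => Re (\tr (J *m (cmatrix V *m (cmatrix V)^T) *m (residV B V *m residV B V))
    - \tr (J *m (residV B V *m residV B V) *m (cmatrix V *m (cmatrix V)^T)))) = 0.
Proof.
move=> pB JT.
pose F V := residV (l := l) B V; pose Z V := coefV (l := l) B V.
pose Wc V : 'M[C]_(n, l) := cmatrix V.
pose Phi V := \tr (F V) *: (J *m Wc V).
pose Psi i j V := - (\tr (F V *m delta_mx i j *m Z V) +
    \tr ((F V *m Wc V) *m (delta_mx i j)^T *m F V)) * (J *m Wc V) i j
  + \tr (F V) * (J *m delta_mx i j : 'M[C]_(n, l)) i j.
have [rZ rF] := mregular_resid (l := l) pB.
have rW := @mregular_cmatrix R n l; have lW := @mlin_cmatrix R n l.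
have bF := @mbdd_resid R n l _ pB; have bZ := @mbdd_coef R n l _ pB.
have bFW : mbdd (fun V => F V *m Wc V).
  move=> i j; have := mbdd_coef_adj (l := l) pB i j; apply: bdd_eq => V.
  by rewrite residV_mul_cmatrix.
have bC a b (A : 'M[C]_(a, b)) : mbdd (fun _ : 'M[R]_(n, l) => A).
  by move=> ? ?; exact: bdd_cst.
have rC a b (A : 'M[C]_(a, b)) : mregular (fun _ : 'M[R]_(n, l) => A) by exact: mregularC.
have rJW : mregular (fun V => J *m Wc V) := mregularM (rC _ _ J) rW.
have lJW : mlin (fun V => J *m Wc V) := mbddM_lin (bC _ _ J) lW.
have btr (G : 'M[R]_(n, l) -> 'M[C]_n) : mbdd G -> bdd (fun V => \tr (G V)).
  by move=> bG; apply: bdd_sum => i; exact: bG.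
have rtF : regular (fun V => \tr (F V)) := mregular_tr rF.
have btF : bdd (fun V => \tr (F V)) := btr _ bF.
have rPhi : mregular Phi.
  move=> i j; have := regularM rtF (rJW i j).
  by rewrite (_ : (fun V => Phi V i j) = fun V => \tr (F V) * (J *m Wc V) i j)//; apply/funext => V; rewrite mxE.
have lPhi : mlin Phi.
  move=> i j; apply: lin_eq (bddM_lin btF (lJW i j)) => V.
  by rewrite [RHS]mxE.
have rPsi i j : regular (Psi i j).
  have r1 := mregular_tr (mregularM (mregularM rF (rC _ _ (delta_mx i j))) rZ).
  have r2 := mregular_tr (mregularM (mregularM (mregularM rF rW) (rC _ _ (delta_mx i j)^T)) rF).
  have r3 := regularM (regularM (regular_cst (-1)) (regularD r1 r2)) (rJW i j).
  have := regularD r3 (regularM rtF (rC _ _ (J *m delta_mx i j : 'M[C]_(n, l)) i j)).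
  rewrite (_ : Psi i j = (fun V => -1 * (\tr (residV B V *m delta_mx i j *m coefV B V) +
    \tr ((residV B V *m cmatrix V) *m (delta_mx i j)^T *m residV B V)) * (J *m Wc V) i j
  + \tr (F V) * (J *m delta_mx i j : 'M[C]_(n, l)) i j))//.
  by apply/funext => V; rewrite mulN1r.
have lPsi i j : lin_growth (Psi i j).
  have b1 := btr _ (mbddM (mbddM bF (bC _ _ (delta_mx i j))) bZ).
  have b2 := btr _ (mbddM (mbddM bFW (bC _ _ (delta_mx i j)^T)) bF).
  have l3 := bddM_lin (bddM (bdd_cst (-1)) (bddD b1 b2)) (lJW i j).
  have b4 := bddM btF (bC _ _ (J *m delta_mx i j : 'M[C]_(n, l)) i j).
  by apply: lin_eq (linD l3 (bdd_lin b4)) => V; rewrite /Psi mulN1r.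
have dPhi i j V x : cderive (fun x => Phi (set_entry i j x V) i j) x =
    Psi i j (set_entry i j x V).
  rewrite (_ : (fun y => Phi (set_entry i j y V) i j) = fun y =>
    \tr (F (set_entry i j y V)) * (J *m entry_path i j V y) i j); last first.
    by apply/funext => y; rewrite mxE.
  have dF : mderivable (fun y => F (set_entry i j y V)) := mderivable_residV pB i j V.
  have dJ : mderivable (fun _ : R => J) by apply: mxclass_cst; exact: cderivable_cst.
  have dW := mderivable_entry_path i j V.
  have dJW : mderivable (fun y => J *m entry_path i j V y).
    exact: (mxclassM (@cderivable_cst R) (@cderivableD R) (@cderivableM R) dJ dW).
  have dt : cderivable (fun y => \tr (F (set_entry i j y V))).
    exact: (mxclass_tr (@cderivable_cst R) (@cderivableD R) dF).
  rewrite cderiveM// (mderive_tr x dF) mderive_residV//.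
  have -> : cderive (fun y => (J *m entry_path i j V y) i j) x =
      mderive (fun y => J *m entry_path i j V y) x i j by rewrite mxE.
  rewrite (mderiveM x dJ dW) mderive_cst mul0mx add0r mderive_entry_path.
  by rewrite linearN linearD /= -residV_mul_cmatrix.
have [th eh] := stein_field hW rPhi lPhi rPsi lPsi dPhi.
rewrite -[RHS]eh; congr (Ex W _); apply/funext => V; congr (Re _).
have t1 : \tr ((Wc V)^T *m Phi V) = 0.
  rewrite /Phi -scalemxAr linearZ /=.
  have h : \tr ((Wc V)^T *m (J *m Wc V)) = - \tr ((Wc V)^T *m (J *m Wc V)).
    rewrite -[LHS]mxtrace_tr !trmx_mul trmxK JT mulmxN mulNmx linearN /=.
    by rewrite -mulmxA.
  have : \tr ((Wc V)^T *m (J *m Wc V)) *+ 2 = 0 by rewrite mulr2n {1}h addNr.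
  by move/eqP; rewrite mulrn_eq0 /= => /eqP ->; rewrite mulr0.
have tJ : \tr J = 0.
  have h : \tr J = - \tr J by rewrite -[LHS]mxtrace_tr JT linearN.
  have : \tr J *+ 2 = 0 by rewrite mulr2n {1}h addNr.
  by move/eqP; rewrite mulrn_eq0 /= => /eqP.
have tZ : (Wc V)^T *m F V = Z V by exact: tr_cmatrix_mul_residV.
have s1 : \sum_i \sum_j \tr (F V *m delta_mx i j *m Z V) * (J *m Wc V) i j =
    \tr (J *m (Wc V *m (Wc V)^T) *m (F V *m F V)).
  move: (F V) (Z V) (Wc V) tZ => F0 Z0 W0 tZ.
  transitivity (\tr (Z0 *m F0 *m (J *m W0))).
    rewrite exchange_big; apply: eq_bigr => j _; rewrite mxE; apply: eq_bigr => i _.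
    by rewrite mxtrace_mulmx_delta.
  by rewrite mxtrace_mulC -tZ !mulmxA.
have s2 : \sum_i \sum_j \tr (F V *m Wc V *m (delta_mx i j)^T *m F V) * (J *m Wc V) i j =
    - \tr (J *m (F V *m F V) *m (Wc V *m (Wc V)^T)).
  move: (F V) (Wc V) => F0 W0.
  transitivity (\tr ((F0 *m F0 *m W0)^T *m (J *m W0))).
    rewrite exchange_big; apply: eq_bigr => j _; rewrite mxE; apply: eq_bigr => i _.
    by rewrite trmx_delta mxtrace_mulmx_delta [(_^T) j i]mxE !mulmxA.
  rewrite -[LHS]mxtrace_tr trmx_mul trmxK trmx_mul JT mulmxN mulNmx linearN /=; congr (- _).
  by rewrite -!mulmxA mxtrace_mulC !mulmxA.
have s3 : \sum_i \sum_j Psi i j V = - (\tr (J *m (Wc V *m (Wc V)^T) *m (F V *m F V)) -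
    \tr (J *m (F V *m F V) *m (Wc V *m (Wc V)^T))).
  rewrite -s1 -s2.
  transitivity (- (\sum_i \sum_j \tr (F V *m delta_mx i j *m Z V) * (J *m Wc V) i j +
    \sum_i \sum_j \tr (F V *m Wc V *m (delta_mx i j)^T *m F V) * (J *m Wc V) i j)
    + \tr (F V) * (\sum_i \sum_(j < l) (J *m delta_mx i j) i j)); last first.
    by rewrite sum_mulmx_delta tJ mul0rn mulr0 addr0.
  rewrite mulr_sumr -big_split /= -sumrN -big_split /=; apply: eq_bigr => i _.
  rewrite mulr_sumr -big_split /= -sumrN -big_split /=; apply: eq_bigr => j _.
  by rewrite /Psi mulNr mulrDl.
by rewrite t1 s3 opprK add0r.
Qed.

End RotationInvariance.

(** * The unit sphere and Householder reflections *)

Section UnitSphere.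
Context {R : realType} {n : nat}.
Implicit Types e f : 'rV[R]_n.

Definition rdot e f : R := (e *m f^T) 0 0.

Lemma rdotC e f : rdot e f = rdot f e.
Proof. by rewrite /rdot -[in LHS](trmxK (e *m f^T)) trmx_mul trmxK mxE. Qed.
Lemma rdotDl e f g : rdot (e + f) g = rdot e g + rdot f g.
Proof. by rewrite /rdot mulmxDl mxE. Qed.
Lemma rdotZl a e f : rdot (a *: e) f = a * rdot e f.
Proof. by rewrite /rdot -scalemxAl mxE. Qed.
Lemma rdotNl e f : rdot (- e) f = - rdot e f.
Proof. by rewrite -scaleN1r rdotZl mulN1r. Qed.
Lemma rdotDr e f g : rdot g (e + f) = rdot g e + rdot g f.
Proof. by rewrite rdotC rdotDl !(rdotC _ g). Qed.
Lemma rdotZr a e f : rdot f (a *: e) = a * rdot f e.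
Proof. by rewrite rdotC rdotZl rdotC. Qed.
Lemma rdotNr e f : rdot f (- e) = - rdot f e.
Proof. by rewrite rdotC rdotNl rdotC. Qed.

Lemma rdot_sum e f : rdot e f = \sum_a e 0 a * f 0 a.
Proof. by rewrite /rdot mxE; apply: eq_bigr => a _; rewrite mxE. Qed.

Lemma sqr_entry_le_rdot e a : e 0 a ^+ 2 <= rdot e e.
Proof.
rewrite rdot_sum (bigD1 a)//= -expr2 lerDl sumr_ge0// => b _.
by rewrite -expr2 sqr_ge0.
Qed.

Lemma rdot_ge0 e : 0 <= rdot e e.
Proof. by rewrite rdot_sum sumr_ge0// => a _; rewrite -expr2 sqr_ge0. Qed.

Lemma unit_rdot_sub e f : rdot e e = 1 -> rdot f f = 1 ->
  rdot (f - e) (f - e) = 2 - 2 * rdot e f.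
Proof.
move=> e1 f1; rewrite !(rdotDl, rdotDr, rdotNl, rdotNr) e1 f1 (rdotC f e); ring.
Qed.

(* Two points at distance d on the sphere have a midpoint whose squared
   distance to both is at most d^2 / 3, so a function whose increments are
   quadratic in the distance is constant. *)
Lemma sphere_bisection (Phi : 'rV[R]_n -> R) (K : R) : 0 <= K ->
  (forall e f, rdot e e = 1 -> rdot f f = 1 ->
     Phi f <= Phi e + K * rdot (f - e) (f - e)) ->
  (forall e, Phi (- e) = Phi e) ->
  forall e f, rdot e e = 1 -> rdot f f = 1 -> Phi f <= Phi e.
Proof.
move=> K0 hPhi PhiN.
(* Bisection replaces one step by two, each with at most a third of the squared distance, so the
   constant shrinks by 2/3. With s = |e + f|, each half has squared length 2 - s, and the bound by
   (4 - s^2) / 3 needs 1 <= s <= 2. Both halves are again at an acute angle, as their inner product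
   is s / 2. *)
have step N : forall e f, rdot e e = 1 -> rdot f f = 1 -> 0 <= rdot e f ->
    Phi f <= Phi e + K * (2 / 3) ^+ N * rdot (f - e) (f - e).
  elim: N => [|N IH] e f e1 f1 ef0; first by rewrite expr0 mulr1 hPhi.
  pose s := Num.sqrt (2 + 2 * rdot e f).
  have s2 : s ^+ 2 = 2 + 2 * rdot e f by rewrite sqr_sqrtr// addr_ge0// mulr_ge0.
  have s1 : 1 <= s.
    rewrite -[X in X <= _]sqrtr1 ler_wsqrtr//.
    have : 0 <= 2 * rdot e f by rewrite mulr_ge0.
    lra.
  have s_le2 : s <= 2.
    have := rdot_ge0 (f - e); rewrite unit_rdot_sub// => h.
    have h' : s ^+ 2 <= 4 by rewrite s2; lra.
    rewrite leNgt; apply/negP => h2.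
    have : 2 * 2 < s * s by rewrite ltr_pM.
    rewrite -expr2; lra.
  have s0 : s != 0 by rewrite gt_eqF// (lt_le_trans ltr01).
  pose m := s^-1 *: (e + f).
  have m1 : rdot m m = 1.
    have ss : rdot (e + f) (e + f) = s ^+ 2.
      by rewrite s2 rdotDl !rdotDr e1 f1 (rdotC f e); ring.
    by rewrite rdotZl rdotZr ss; field.
  have em : rdot e m = s / 2.
    rewrite rdotZr rdotDr e1; have -> : 1 + rdot e f = s ^+ 2 / 2 by rewrite s2; field.
    by field.
  have mf : rdot m f = s / 2.
    rewrite rdotZl rdotDl f1; have -> : rdot e f + 1 = s ^+ 2 / 2 by rewrite s2; field.
    by field.
  have s20 : 0 <= s / 2 by rewrite divr_ge0// (le_trans ler01).
  have h1 := IH e m e1 m1; have h2 := IH m f m1 f1.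
  rewrite em in h1; rewrite mf in h2; have {}h1 := h1 s20; have {}h2 := h2 s20.
  rewrite unit_rdot_sub// em in h1; rewrite unit_rdot_sub// mf in h2.
  rewrite unit_rdot_sub//; have := s2 => s2'.
  have q0 : 0 <= K * (2 / 3) ^+ N by rewrite mulr_ge0// exprn_ge0.
  apply: (le_trans h2); rewrite exprS.
  have h3 : 2 - 2 * (s / 2) <= (2 - 2 * rdot e f) / 3.
    have : 2 * rdot e f = s ^+ 2 - 2 by rewrite s2; ring.
    move=> ->; rewrite -subr_ge0.
    have -> : (2 - (s ^+ 2 - 2)) / 3 - (2 - 2 * (s / 2)) = (s - 1) * (2 - s) / 3 by field.
    by rewrite divr_ge0// mulr_ge0// subr_ge0.
  have h4 := ler_wpM2l q0 h3.
  have -> : K * (2 / 3 * (2 / 3) ^+ N) * (2 - 2 * rdot e f) =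
    2 * (K * (2 / 3) ^+ N * ((2 - 2 * rdot e f) / 3)) by field.
  lra.
have acute e f : rdot e e = 1 -> rdot f f = 1 -> 0 <= rdot e f -> Phi f <= Phi e.
  move=> e1 f1 ef; apply/ler_addgt0Pr => eps eps0.
  have : (K * rdot (f - e) (f - e)) * (2 / 3) ^+ N @[N --> \oo] --> (0 : R).
    rewrite -[X in _ --> X](mulr0 (K * rdot (f - e) (f - e))).
    apply: cvgMr; apply: cvg_expr; rewrite ger0_norm//; lra.
  move/cvgrPdist_lt => /(_ eps eps0)[N _ /(_ N (leqnn N))] /=.
  rewrite sub0r normrN => /(le_lt_trans (ler_norm _)) h.
  apply: (le_trans (step N e f e1 f1 ef)); rewrite lerD2l; apply: le_trans (ltW h).
  by rewrite mulrAC.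
(* At an obtuse angle, e is replaced by its antipode, where [Phi] has the same value. *)
move=> e f e1 f1; have [ef|ef] := leP 0 (rdot e f); first exact: acute.
rewrite -(PhiN e); apply: acute => //; first by rewrite rdotNl rdotNr opprK.
by rewrite rdotNl oppr_ge0 ltW.
Qed.

Definition refl e : 'M[R]_n := 1%:M - 2 *: (e^T *m e).

Lemma refl_tr e : (refl e)^T = refl e.
Proof. by rewrite /refl linearB /= linearZ /= trmx1 trmx_mul trmxK. Qed.

Lemma refl_sqr e : rdot e e = 1 -> refl e *m refl e = 1%:M.
Proof.
move=> e1; have ee : e *m e^T = 1%:M by apply/matrixP => i j; rewrite !ord1 [RHS]mxE -e1.
have pp : e^T *m e *m (e^T *m e) = e^T *m e.
  by rewrite -mulmxA (mulmxA e) ee mul1mx.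
rewrite /refl mulmxBl mul1mx mulmxBr mulmx1 -scalemxAl -scalemxAr pp scalerA.
move: (e^T *m e) => E; mxabel.
Qed.

Lemma reflN e : refl (- e) = refl e.
Proof.
have aN : (- e)^T = - e^T by rewrite linearN.
by rewrite /refl aN mulNmx mulmxN opprK.
Qed.

Lemma reflE e a b : refl e a b = (a == b)%:R - 2 * (e 0 a * e 0 b).
Proof. by rewrite !mxE big_ord1 !mxE. Qed.

(** As [refl e] is an involution, the difference is (refl f - refl e) refl e. The entries of the two
    factors are at most 4 delta and 3, and n products are summed. *)
Lemma refl_mul_sub_le e f a b : rdot e e = 1 -> rdot f f = 1 ->
  `|(refl f *m refl e - 1%:M) a b| <= 12 * n%:R * Num.sqrt (rdot (f - e) (f - e)).
Proof.
move=> e1 f1; set delta := Num.sqrt _.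
have d0 : 0 <= delta by exact: sqrtr_ge0.
have le1 (g : 'rV[R]_n) c : rdot g g = 1 -> `|g 0 c| <= 1.
  by move=> g1; rewrite -sqrtr_sqr -[X in _ <= X]sqrtr1 ler_wsqrtr// -g1 sqr_entry_le_rdot.
have led c : `|f 0 c - e 0 c| <= delta.
  rewrite -sqrtr_sqr ler_wsqrtr//.
  by have := sqr_entry_le_rdot (f - e) c; rewrite !mxE.
rewrite -(refl_sqr e1) -mulmxBl mxE.
apply: (le_trans (ler_norm_sum _ _ _)).
have -> : 12 * n%:R * delta = \sum_(k < n) (4 * delta * 3).
  by rewrite sumr_const card_ord -mulr_natl; ring.
apply: ler_sum => k _; rewrite normrM ler_pM//.
  rewrite mxE [X in _ + X]mxE !reflE.
  have -> : (a == k)%:R - 2 * (f 0 a * f 0 k) - ((a == k)%:R - 2 * (e 0 a * e 0 k)) =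
    - (2 * (f 0 a * (f 0 k - e 0 k) + (f 0 a - e 0 a) * e 0 k)) by ring.
  rewrite normrN normrM ger0_norm//.
  have -> : 4 * delta = 2 * (delta + delta) by ring.
  rewrite ler_wpM2l//; apply: (le_trans (ler_normD _ _)); rewrite !normrM.
  apply: lerD; first by rewrite -[X in _ <= X]mul1r ler_pM// le1.
  by rewrite -[X in _ <= X]mulr1 ler_pM// le1.
rewrite reflE; apply: (le_trans (ler_normB _ _)).
have -> : 3 = 1 + 2 * (1 * 1) :> R by ring.
apply: lerD; first by case: (_ == _); rewrite ?normr1 ?normr0.
by rewrite normrM ger0_norm// ler_wpM2l// normrM ler_pM// le1.
Qed.

End UnitSphere.

Section OrthogonalInvariance.
Context {d : measure_display} {T : measurableType d} {R : realType}.
Variables (P : probability T R) (n l : nat) (W : 'I_n -> 'I_l -> {RV P >-> R}).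
Hypothesis hW : gaussian_matrix W.
Local Notation C := R[i].
Local Notation Re := (@complex.Re R).
Local Notation normc := (@Normc.normc R).
Implicit Types (V : 'M[R]_(n, l)) (B J : 'M[C]_n) (O : 'M[R]_n).

Lemma normc_mulmx_le m p q (A : 'M[C]_(m, p)) (B : 'M[C]_(p, q)) x y i j :
  (forall i j, normc (A i j) <= x) -> (forall i j, normc (B i j) <= y) ->
  normc ((A *m B) i j) <= p%:R * (x * y).
Proof.
move=> Ax By; rewrite mxE; apply: (le_trans (normc_sum _ _)).
rewrite mulr_natl -[X in _ *+ X]card_ord -sumr_const; apply: ler_sum => k _.
by rewrite Normc.normcM ler_pM ?normc_ge0.
Qed.

Lemma cmatrixM m p q (A : 'M[R]_(m, p)) (B : 'M[R]_(p, q)) :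
  cmatrix (A *m B) = cmatrix A *m cmatrix B.
Proof. exact: map_mxM. Qed.

Lemma cmatrix1 m : cmatrix (1%:M : 'M[R]_m) = 1%:M.
Proof. exact: map_mx1. Qed.

Lemma cmatrixT m p (A : 'M[R]_(m, p)) : cmatrix A^T = (cmatrix A)^T.
Proof. by rewrite /cmatrix map_trmx. Qed.

Lemma cmatrix_adj m p (A : 'M[R]_(m, p)) : (cmatrix A) ^t* = cmatrix A^T.
Proof. by rewrite mxreal_adj ?cmatrixT//; exact: mxreal_cmatrix. Qed.

Lemma psd_orth O B : psd B -> psd (cmatrix O *m B *m cmatrix O^T).
Proof. by move=> pB; rewrite -cmatrix_adj; exact: psd_congr. Qed.

Lemma tr_orth O B : O^T *m O = 1%:M -> \tr (cmatrix O *m B *m cmatrix O^T) = \tr B.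
Proof.
by move=> OO; rewrite -mulmxA mxtrace_mulC -mulmxA -cmatrixM OO cmatrix1 mulmx1.
Qed.

Let omega := Ex W (@wt R n l).

Lemma tame_wt : tame (@wt R n l).
Proof.
split; first exact: measurable_wt.
by exists 1 => V; rewrite mul1r ger0_norm// (le_trans _ (wt_ge1 V)).
Qed.

Lemma Ex_wt_ge0 : 0 <= omega.
Proof.
rewrite /omega -[X in X <= _](Ex_cst W 0); apply: (le_Ex hW).
- exact: tame_cst.
- exact: tame_wt.
- by move=> V; exact: le_trans (wt_ge1 V).
Qed.

(** Write O = 1 + X. Orthogonality makes the symmetric part of X equal to - X X^T / 2, so up to a
    term [Y] of order xi^2 the change of B is the commutator J B - B J with the skew part J. The
    supergradient inequality then leaves a first-order term of mean zero by [stein_skew]. *)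
Lemma mean_resid_rotation_step O B c xi : psd B -> Re (\tr B) <= c ->
  O *m O^T = 1%:M -> (forall a b, `|(O - 1%:M) a b| <= xi) ->
  mean_resid (l := l) W (cmatrix O *m B *m cmatrix O^T) <=
  mean_resid W B + 2 * n%:R ^+ 2 * c * xi ^+ 2 * (step_const n l c * omega).
Proof.
move=> pB Bc OO Oxi.
apply: (le_trans (mean_resid_le hW pB (psd_orth O pB))); rewrite lerD2l.
pose X : 'M[C]_n := cmatrix (O - 1%:M).
have OX : cmatrix O = 1%:M + X by rewrite /X /cmatrix map_mxB map_mx1 addrC subrK.
have OXT : cmatrix O^T = 1%:M + X^T by rewrite cmatrixT OX linearD /= trmx1.
have XX : X + X^T = - (X *m X^T).
  have : cmatrix O *m cmatrix O^T = 1%:M by rewrite -cmatrixM OO cmatrix1.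
  rewrite OX OXT mulmxDl mul1mx mulmxDr mulmx1 -addrA -[X in _ = X]addr0.
  move/addrI; rewrite addrA => /eqP; rewrite addr_eq0 => /eqP h.
  by rewrite addrC h.
have Xxi a b : normc (X a b) <= xi by rewrite mxE normc_real.
clearbody X.
pose J := 2^-1 *: (X - X^T).
have JT : J^T = - J by rewrite /J linearZ /= linearB /= trmxK -scalerN opprB.
pose Y := X *m B *m X^T - 2^-1 *: (X *m X^T *m B + B *m (X *m X^T)).
have GE : X *m X^T = - (X + X^T) by rewrite XX opprK.
have XJ : X = J - 2^-1 *: (X *m X^T).
  by rewrite GE /J; apply/matrixP => i j; rewrite !mxE; field.
have XTJ : X^T = - J - 2^-1 *: (X *m X^T).
  by rewrite GE /J; apply/matrixP => i j; rewrite !mxE; field.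
have BY : cmatrix O *m B *m cmatrix O^T - B = (J *m B - B *m J) + Y.
  rewrite OX OXT mulmxDl mul1mx mulmxDr mulmx1 mulmxDl.
  have -> : B + X *m B + (B *m X^T + X *m B *m X^T) - B = X *m B + B *m X^T + X *m B *m X^T.
    by mxabel.
  rewrite {1}XJ {2}XTJ /Y !(mulmxBl, mulmxBr) mulmxN -!scalemxAl -!scalemxAr scalerDr.
  by mxabel.
have XTxi a b : normc (X^T a b) <= xi by rewrite mxE.
have Bc' a b : normc (B a b) <= c by exact: le_trans (psd_entry_le _ _ pB) Bc.
have XXxi a b : normc ((X *m X^T) a b) <= n%:R * (xi * xi) by exact: normc_mulmx_le.
(* Each of the three products in [Y] has entries at most n^2 c xi^2, and their weights 1, 1/2, 1/2
   add up to 2. *)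
have Yxi a b : normc (Y a b) <= 2 * n%:R ^+ 2 * c * xi ^+ 2.
  have y1 := normc_mulmx_le a b (fun i j => normc_mulmx_le i j Xxi Bc') XTxi.
  have y2 := normc_mulmx_le a b XXxi Bc'.
  have y3 := normc_mulmx_le a b Bc' XXxi.
  have -> : Y a b = (X *m B *m X^T) a b
      - 2^-1 * ((X *m X^T *m B) a b + (B *m (X *m X^T)) a b).
    rewrite /Y; move: (X *m B *m X^T) (X *m X^T *m B) (B *m (X *m X^T)) => U1 U2 U3.
    by rewrite !mxE.
  apply: (le_trans (le_normcD _ _)); rewrite normcN Normc.normcM.
  have -> : normc (2^-1 : C) = 2^-1.
    rewrite Normc.normcV -[2 : C](rmorph_nat (real_complex R)) normc_real.
    by rewrite ger0_norm.
  have y4 := le_normcD ((X *m X^T *m B) a b) ((B *m (X *m X^T)) a b).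
  have y5 := le_trans y4 (lerD y2 y3).
  have y6 : 2^-1 * normc ((X *m X^T *m B) a b + (B *m (X *m X^T)) a b) <=
     2^-1 * (n%:R * (n%:R * (xi * xi) * c) + n%:R * (c * (n%:R * (xi * xi)))).
    by rewrite ler_wpM2l// invr_ge0.
  apply: (le_trans (lerD y1 y6)); rewrite le_eqVlt; apply/orP; left; apply/eqP.
  by field.
have tJ := tame_tr_defect l (J *m B - B *m J) pB.
have tY := tame_tr_defect l Y pB.
rewrite (_ : (fun V => _) = (fun V =>
   Re (\tr ((J *m B - B *m J) *m (defectV (l := l) B V *m (defectV B V) ^t*))) +
   Re (\tr (Y *m (defectV (l := l) B V *m (defectV B V) ^t*))))); last first.
  by apply/funext => V; rewrite BY -ReD -mxtraceD -mulmxDl.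
rewrite (ExD hW tJ tY).
(* Using B D = F = D^H B and D = 1 - G F, both halves of the commutator produce tr (J F), which
   cancels, and the integrand of [stein_skew] remains. *)
have -> : Ex W (fun V => Re (\tr ((J *m B - B *m J) *m (defectV (l := l) B V *m (defectV B V) ^t*)))) = 0.
  rewrite -[RHS](stein_skew hW pB JT); congr (Ex W _); apply/funext => V; congr (Re _).
  have rV := mxreal_cmatrix V.
  have BD : B *m defectV (l := l) B V = residV B V by [].
  have DB : (defectV (l := l) B V) ^t* *m B = residV B V.
    exact: (resid_mul_defect_adj pB rV).
  have DE : defectV (l := l) B V = 1%:M - cmatrix V *m (cmatrix V)^T *m residV B V.
    exact: (defectE pB rV).
  have DaE := defect_adj V pB.
  move: (defectV B V) (residV B V) (cmatrix V *m (cmatrix V)^T) DE DaE BD DB.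
  move=> D F G DE DaE BD DB.
  have h1 : \tr (J *m B *m (D *m D ^t*)) = \tr (J *m F) - \tr (J *m (F *m F) *m G).
    by rewrite -[J *m B *m _]mulmxA (mulmxA B) BD DaE mulmxBr mulmx1 mulmxBr linearB /= !mulmxA.
  have h2 : \tr (B *m J *m (D *m D ^t*)) = \tr (J *m F) - \tr (J *m G *m (F *m F)).
    rewrite -[B *m J *m _]mulmxA mxtrace_mulC -!mulmxA DB DE mulmxBl mul1mx mulmxBr linearB /=.
    by rewrite !mulmxA.
  by rewrite mulmxBl linearB /= h1 h2 opprB addrC addrA subrK.
rewrite add0r mulrA -(ExZ hW); last exact: tame_wt.
apply: (le_Ex hW) => //; first by apply: tameZ; exact: tame_wt.
move=> V; apply: (le_trans (ler_norm _)); exact: tr_defect_le.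
Qed.

End OrthogonalInvariance.

Lemma resid_orth (C : numClosedFieldType) n l (O B : 'M[C]_n) (W : 'M[C]_(n, l)) :
  resid (O *m B *m O^T) W = O *m resid B (O^T *m W) *m O^T.
Proof.
rewrite /resid /defect /coef.
have -> : gram (O *m B *m O^T) W = gram B (O^T *m W).
  by rewrite /gram trmx_mul trmxK !mulmxA.
rewrite trmx_mul trmxK; move: (invmx _) => G.
by mxexpand.
Qed.

Lemma pinch_midpoint (C : numClosedFieldType) n (Pi B : 'M[C]_n) :
  2^-1 *: (B + (1%:M - 2 *: Pi) *m B *m (1%:M - 2 *: Pi)) =
  Pi *m B *m Pi + (1%:M - Pi) *m B *m (1%:M - Pi).
Proof.
rewrite !(mulmxBl, mulmxBr, mul1mx, mulmx1) -?(scalemxAl, scalemxAr).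
move: (Pi *m B *m Pi) (Pi *m B) (B *m Pi) => X Y Z.
by apply/matrixP => i j; rewrite !mxE; field.
Qed.

(** * Invariance under reflections, concavity and pinching by one block *)

Section HouseholderInvariance.
Context {d : measure_display} {T : measurableType d} {R : realType}.
Variables (P : probability T R) (n l : nat) (W : 'I_n -> 'I_l -> {RV P >-> R}).
Hypothesis hW : gaussian_matrix W.
Local Notation C := R[i].
Local Notation Re := (@complex.Re R).
Local Notation MT := (@mx_space R n l).
Implicit Types (V : 'M[R]_(n, l)) (B : 'M[C]_n).

(** The list of columns allows a whole row to be negated by induction, one entry at a time. *)
Definition flip_entries (i : 'I_n) (s : seq 'I_l) V : 'M[R]_(n, l) :=
  \matrix_(a, b) if (a == i) && (b \in s) then - V a b else V a b.

Lemma measurable_flip_entries i s :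
  measurable_fun setT (fun V : MT => flip_entries i s V : MT).
Proof.
apply: measurable_mxP => a b.
have [ab|ab] := boolP ((a == i) && (b \in s)).
  rewrite (_ : (fun _ => _) = fun V : MT => - (V : 'M[R]_(n, l)) a b).
    by apply: measurableT_comp => //; exact: measurable_mx_coord.
  by apply/funext => V; rewrite mxE ab.
rewrite (_ : (fun _ => _) = fun V : MT => (V : 'M[R]_(n, l)) a b).
  exact: measurable_mx_coord.
by apply/funext => V; rewrite mxE (negbTE ab).
Qed.

Lemma Ex_flip_entries i s (f : 'M[R]_(n, l) -> R) : uniq s ->
  measurable_fun setT (f : MT -> R) -> (forall V, 0 <= f V) ->
  Ex W (fun V => f (flip_entries i s V)) = Ex W f.
Proof.
move=> + mf f0; elim: s => [_|j s IH /= /andP[js us]].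
  congr (Ex W _); apply/funext => V; congr f; apply/matrixP => a b.
  by rewrite mxE andbF.
rewrite -(IH us) -[RHS](ge0_ExN_entry hW i j)//; last first.
  exact: (measurableT_comp mf (measurable_flip_entries i s)).
congr (Ex W _); apply/funext => V; congr f; apply/matrixP => a b.
rewrite !mxE inE; have [ai|ai] := eqVneq a i; last by [].
rewrite /=; have [bj|bj] := eqVneq b j; last by [].
by rewrite ai bj (negbTE js).
Qed.

Lemma tr_residV_ge0 B V : psd B -> 0 <= Re (\tr (residV B V)).
Proof. by move=> pB; have /Re_le := psd_tr_ge0 (residV_psd (l := l) pB V). Qed.

Lemma measurable_tr_residV B : psd B ->
  measurable_fun setT ((fun V => Re (\tr (residV B V))) : MT -> R).
Proof. by move=> pB; case: (tame_tr_resid l pB). Qed.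

Lemma refl_deltaE (i : 'I_n) V a b :
  (refl (delta_mx 0 i) *m V) a b = if a == i then - V a b else V a b.
Proof.
rewrite mxE (bigD1 a)//= big1 ?addr0 => [|k ka]; last first.
  rewrite reflE [a == k]eq_sym (negbTE ka) !mxE /=.
  have [ai|ai] := eqVneq a i; last by rewrite mul0r mulr0 subrr mul0r.
  by rewrite -ai (negbTE ka) mulr0 mulr0 subrr mul0r.
rewrite reflE eqxx !mxE /=; have [_|_] := eqVneq a i.
  by rewrite mulr1 mulr1; ring.
by rewrite mul0r mulr0 subr0 mul1r.
Qed.

Lemma mean_resid_orthE (O : 'M[R]_n) B : O^T *m O = 1%:M ->
  mean_resid (l := l) W (cmatrix O *m B *m cmatrix O^T) =
  Ex W (fun V => Re (\tr (residV B (O^T *m V)))).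
Proof.
move=> OO; rewrite /mean_resid; apply: (congr1 (Ex W)); apply/funext => V; apply: (congr1 Re).
have -> : residV (cmatrix O *m B *m cmatrix O^T) V =
    cmatrix O *m residV B (O^T *m V) *m cmatrix O^T.
  rewrite /residV cmatrixT resid_orth; apply: (congr1 (fun X => _ *m X *m _)).
  by apply: (congr1 (resid B)); rewrite -cmatrixT -cmatrixM.
exact: tr_orth.
Qed.

Lemma mean_resid_refl_coord B (i : 'I_n) : psd B ->
  mean_resid (l := l) W (cmatrix (refl (delta_mx 0 i)) *m B *m cmatrix (refl (delta_mx 0 i))) =
  mean_resid W B.
Proof.
move=> pB; set e := delta_mx 0 i.
have e1 : rdot e e = 1 :> R.
  rewrite rdot_sum (bigD1 i)//= big1 ?addr0 => [|k ki]; first by rewrite mxE !eqxx mulr1.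
  by rewrite mxE (negbTE ki) mul0r.
rewrite -{2}(refl_tr e) mean_resid_orthE; last by rewrite refl_tr refl_sqr.
rewrite refl_tr.
have m1 : measurable_fun setT ((fun V => Re (\tr (residV B V))) : MT -> R) by exact: measurable_tr_residV.
have m2 V : 0 <= Re (\tr (residV B V)) by exact: tr_residV_ge0.
rewrite /mean_resid.
pose F V : R := Re (\tr (residV B V)).
have h := @Ex_flip_entries i (enum 'I_l) F (enum_uniq 'I_l) m1 m2.
apply: (etrans _ h).
apply: (congr1 (Ex W)); apply/funext => V; apply: (congr1 F).
by apply/matrixP => a b; rewrite refl_deltaE mxE mem_enum andbT.
Qed.

Lemma mean_resid_refl_le B (e : 'rV[R]_n) : psd B -> rdot e e = 1 ->
  mean_resid (l := l) W (cmatrix (refl e) *m B *m cmatrix (refl e)) <= mean_resid W B.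
Proof.
move=> pB e1.
have [i _] : exists i : 'I_n, True.
  case: n e e1 => [e|m e _]; last by exists ord0.
  by rewrite rdot_sum big_ord0 => /eqP; rewrite eq_sym oner_eq0.
rewrite -(mean_resid_refl_coord i pB).
set e0 := delta_mx 0 i.
have e01 : rdot e0 e0 = 1 :> R.
  rewrite rdot_sum (bigD1 i)//= big1 ?addr0 => [|k ki]; first by rewrite mxE !eqxx mulr1.
  by rewrite mxE (negbTE ki) mul0r.
pose c := Re (\tr B).
have c0 : 0 <= c by have /Re_le := psd_tr_ge0 pB.
have [K K0 hK] : exists2 K : R, 0 <= K & forall f g, rdot f f = 1 -> rdot g g = 1 ->
    mean_resid (l := l) W (cmatrix (refl g) *m B *m cmatrix (refl g)) <=
    mean_resid W (cmatrix (refl f) *m B *m cmatrix (refl f)) + K * rdot (g - f) (g - f).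
  (* This is [mean_resid_rotation_step] for the product of two reflections, with [xi] equal to 12 n
     times the distance of the two unit vectors; [xi] enters squared, which is the quadratic
     increment that the bisection on the sphere asks for. *)
  exists (2 * n%:R ^+ 2 * c * (12 * n%:R) ^+ 2 * (step_const n l c * Ex W (@wt R n l))).
    apply: mulr_ge0; last by rewrite mulr_ge0 ?step_const_ge0 ?Ex_wt_ge0.
    by rewrite !mulr_ge0 ?exprn_ge0.
  move=> f g f1 g1.
  have pf : psd (cmatrix (refl f) *m B *m cmatrix (refl f)).
    by rewrite -{2}(refl_tr f); exact: psd_orth.
  have trf : Re (\tr (cmatrix (refl f) *m B *m cmatrix (refl f))) <= c.
    by rewrite -{2}(refl_tr f) tr_orth// refl_tr refl_sqr.
  have OO : (refl g *m refl f) *m (refl g *m refl f)^T = 1%:M.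
    by rewrite trmx_mul !refl_tr -mulmxA (mulmxA (refl f)) refl_sqr// mul1mx refl_sqr.
  have := mean_resid_rotation_step hW pf trf OO (fun a b => refl_mul_sub_le a b f1 g1).
  have -> : cmatrix (refl g *m refl f) *m (cmatrix (refl f) *m B *m cmatrix (refl f)) *m
      cmatrix (refl g *m refl f)^T = cmatrix (refl g) *m B *m cmatrix (refl g).
    rewrite trmx_mul !refl_tr !cmatrixM.
    have ff : cmatrix (refl f) *m cmatrix (refl f) = 1%:M by rewrite -cmatrixM refl_sqr// cmatrix1.
    move: (cmatrix (refl f)) (cmatrix (refl g)) ff => F G ff.
    rewrite -!mulmxA (mulmxA F F) ff mul1mx.
    by rewrite (mulmxA F F) ff mul1mx !mulmxA.
  move/le_trans; apply; rewrite lerD2l exprMn sqr_sqrtr ?rdot_ge0//.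
  rewrite le_eqVlt; apply/orP; left; apply/eqP.
  move: (rdot _ _) (step_const _ _ _) (Ex _ _) => x y z; ring.
have hN f : mean_resid (l := l) W (cmatrix (refl (- f)) *m B *m cmatrix (refl (- f))) =
    mean_resid W (cmatrix (refl f) *m B *m cmatrix (refl f)) by rewrite reflN.
exact: (@sphere_bisection R n
  (fun e => mean_resid (l := l) W (cmatrix (refl e) *m B *m cmatrix (refl e)))
  K K0 hK hN e0 e e01 e1).
Qed.

Lemma mean_resid_refl B (e : 'rV[R]_n) : psd B -> rdot e e = 1 ->
  mean_resid (l := l) W (cmatrix (refl e) *m B *m cmatrix (refl e)) = mean_resid W B.
Proof.
move=> pB e1.
have pe : psd (cmatrix (refl e) *m B *m cmatrix (refl e)).
  by rewrite -{2}(refl_tr e); exact: psd_orth.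
have h := mean_resid_refl_le pe e1.
have ee : cmatrix (refl e) *m cmatrix (refl e) = 1%:M by rewrite -cmatrixM refl_sqr// cmatrix1.
have E : cmatrix (refl e) *m (cmatrix (refl e) *m B *m cmatrix (refl e)) *m cmatrix (refl e) = B.
  by move: (cmatrix (refl e)) ee => F ee; rewrite !mulmxA ee mul1mx -mulmxA ee mulmx1.
rewrite E in h; apply: le_anti; apply/andP; split; [exact: mean_resid_refl_le|exact: h].
Qed.

(** Apply the supergradient inequality at the midpoint towards both ends; the two linear terms
    cancel. *)
Lemma mean_resid_midpoint B B' : psd B -> psd B' ->
  (mean_resid (l := l) W B + mean_resid W B') / 2 <= mean_resid W (2^-1 *: (B + B')).
Proof.
move=> pB pB'.
have arith (x y z u v : R) : x <= z + u -> y <= z + v -> u + v = 0 -> (x + y) / 2 <= z.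
  by clear => *; lra.
have [M ME] : exists M, M = 2^-1 *: (B + B') by exists (2^-1 *: (B + B')).
have pM : psd M by rewrite ME; apply: psdZ; [rewrite invr_ge0|exact: psdD].
rewrite -ME.
have h1 := mean_resid_le hW pM pB; have h2 := mean_resid_le hW pM pB'.
apply: (arith _ _ _ _ _ h1 h2).
have t1 := tame_tr_defect l (B - M) pM; have t2 := tame_tr_defect l (B' - M) pM.
rewrite -(ExD hW t1 t2) -[RHS](Ex_cst W 0); apply: (congr1 (Ex W)); apply/funext => V /=.
rewrite -ReD -mxtraceD -mulmxDl.
have -> : B - M + (B' - M) = 0 by rewrite ME; apply/matrixP => i j; rewrite !mxE; field.
by rewrite mul0mx mxtrace0.
Qed.

(* 1 - 2 Pi is orthogonal, and averaging B with its conjugate by it keeps the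
   diagonal blocks of B relative to Pi. *)
Lemma mean_resid_pinch B (e f : 'rV[R]_n) (Pi : 'M[C]_n) : psd B ->
  rdot e e = 1 -> rdot e f = 0 -> rdot f f = 1 \/ f = 0 ->
  Pi = cmatrix (e^T *m e + f^T *m f) ->
  mean_resid (l := l) W B <=
  mean_resid W (Pi *m B *m Pi + (1%:M - Pi) *m B *m (1%:M - Pi)).
Proof.
move=> pB e1 ef f1 PiE.
pose S := refl e *m refl f.
have eE : e *m e^T = 1%:M by apply/matrixP => i j; rewrite !ord1 [RHS]mxE -e1.
have efE : e *m f^T = 0 by apply/matrixP => i j; rewrite !ord1 [RHS]mxE -ef.
(* By orthogonality of e and f the product of the two reflections is 1 - 2 Pi; for f = 0 the second
   reflection is the identity. *)
have feE : f *m e^T = 0 by apply: trmx_inj; rewrite trmx_mul trmxK efE trmx0.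
have SE : S = 1%:M - 2 *: (e^T *m e + f^T *m f).
  rewrite /S /refl mulmxBl mul1mx mulmxBr mulmx1 -scalemxAl -scalemxAr.
  rewrite -mulmxA (mulmxA e) efE mul0mx mulmx0 !scaler0 subr0.
  by rewrite scalerDr opprD addrA addrAC.
have Sc : cmatrix S = 1%:M - 2 *: Pi.
  rewrite SE /cmatrix map_mxB map_mx1 map_mxZ -/(cmatrix _) -PiE.
  by rewrite (rmorph_nat (real_complex R)).
have fr B' : psd B' -> mean_resid (l := l) W (cmatrix (refl f) *m B' *m cmatrix (refl f)) =
    mean_resid W B' /\ psd (cmatrix (refl f) *m B' *m cmatrix (refl f)).
  move=> pB'; split; last by rewrite -{2}(refl_tr f); exact: psd_orth.
  case: f1 => [f1|->]; first exact: mean_resid_refl.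
  by rewrite /refl trmx0 mul0mx scaler0 subr0 cmatrix1 mul1mx mulmx1.
have [fe pf] := fr B pB.
have Sinv : mean_resid (l := l) W (cmatrix S *m B *m cmatrix S) = mean_resid W B.
  have ST : S = refl f *m refl e.
    have : S^T = S by rewrite SE linearB /= linearZ linearD /= trmx1 !trmx_mul !trmxK.
    by rewrite /S trmx_mul !refl_tr.
  rewrite -fe -(mean_resid_refl pf e1); apply: (congr1 (fun X => mean_resid W X)).
  by rewrite {2}ST /S !cmatrixM !mulmxA.
have pS : psd (cmatrix S *m B *m cmatrix S).
  have : S^T = S by rewrite SE linearB /= linearZ linearD /= trmx1 !trmx_mul !trmxK.
  by move=> {2}<-; exact: psd_orth.
have := mean_resid_midpoint pB pS; rewrite Sinv.
have -> (x : R) : (x + x) / 2 = x by field.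
move/le_trans; apply; rewrite le_eqVlt; apply/orP; left; apply/eqP.
apply: (congr1 (fun X => mean_resid W X)).
by rewrite Sc; exact: pinch_midpoint.
Qed.

End HouseholderInvariance.

(** * Real blocks of a projector and pinching *)

Section RealBlocks.
Context {C : numClosedFieldType} {n : nat}.
Implicit Types (x z : 'rV[C]_n) (M P E Pi X : 'M[C]_n).

Lemma mxrealD m p (A B : 'M[C]_(m, p)) : mxreal A -> mxreal B -> mxreal (A + B).
Proof. by move=> rA rB; rewrite /mxreal map_mxD rA rB. Qed.

Lemma mxrealZ m p (a : C) (A : 'M[C]_(m, p)) : a^* = a -> mxreal A -> mxreal (a *: A).
Proof. by move=> ra rA; rewrite /mxreal map_mxZ rA /= ra. Qed.

Lemma mxrealM m p q (A : 'M[C]_(m, p)) (B : 'M[C]_(p, q)) :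
  mxreal A -> mxreal B -> mxreal (A *m B).
Proof. by move=> rA rB; rewrite /mxreal map_mxM rA rB. Qed.

Lemma mxrealT m p (A : 'M[C]_(m, p)) : mxreal A -> mxreal A^T.
Proof. by move=> rA; rewrite /mxreal -map_trmx rA. Qed.

Lemma mxreal1 p : mxreal (1%:M : 'M[C]_p).
Proof. exact: map_mx1. Qed.

Lemma mxtrace_row x : \tr (x ^t* *m x) = (x *m x ^t*) 0 0.
Proof. by rewrite mxtrace_mulC /mxtrace big_ord1. Qed.

Lemma row_mul_adj_ge0 x : 0 <= (x *m x ^t*) 0 0.
Proof. by have := mxtrace_mul_adj_ge0 x; rewrite /mxtrace big_ord1. Qed.

Lemma row_mul_adj_eq0 x : (x *m x ^t*) 0 0 = 0 -> x = 0.
Proof. by move=> h; apply: mxtrace_mul_adj_eq0; rewrite /mxtrace big_ord1. Qed.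

Lemma normalize_row x : x != 0 -> exists2 a : C, 0 < a &
  (a *: x) *m (a *: x) ^t* = 1%:M.
Proof.
move=> x0; set s := (x *m x ^t*) 0 0.
have s0 : 0 < s.
  by rewrite lt_def row_mul_adj_ge0 andbT; apply: contra x0 => /eqP/row_mul_adj_eq0->.
have r0 : 0 < sqrtC s by rewrite sqrtC_gt0.
exists (sqrtC s)^-1; first by rewrite invr_gt0.
rewrite adjZ (conj_Creal (ger0_real _)) ?invr_ge0 ?ltW//.
rewrite -scalemxAl -scalemxAr scalerA; apply/matrixP => i j; rewrite !ord1 mxE -/s.
rewrite -[X in _ * X](sqrtCK s) expr2 mxE /=.
by field; rewrite gt_eqF.
Qed.

(** A complex eigenvector u comes from the Hermitian spectral theorem. As M and the eigenvalue are
    real, conj u is an eigenvector too, so u + conj u serves, or i u when that sum vanishes. *)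
Lemma realsym_eigenvector M : mxreal M -> M^T = M -> M != 0 ->
  exists x mu, [/\ mxreal x, x *m x ^t* = 1%:M, mu != 0, mu^* = mu & x *m M = mu *: x].
Proof.
move=> rM sM M0.
have hM : M \is hermsymmx.
  by apply/is_hermitianmxP; rewrite expr0 scale1r; apply/esym; rewrite mxreal_adj.
have /orthomx_spectralP ME := hermitian_normalmx hM.
have /mxOverP dreal := hermitian_spectral_diag_real hM.
set U := spectralmx M in ME; set d := spectral_diag M in ME dreal.
have Uu : U \in unitmx by exact: spectral_unit.
have [i di] : exists i, d 0 i != 0.
  apply/existsP; apply: contraNT M0 => /existsPn h.
  rewrite ME (_ : d = 0) ?raddf0 ?mulmx0 ?mul0mx//.
    by apply/matrixP => a b; rewrite ord1 mxE; apply/eqP; have := h b; rewrite negbK.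
have uM : row i U *m M = d 0 i *: row i U.
  rewrite -row_mul ME !mulmxA mulmxV// mul1mx; apply/matrixP => a b; rewrite !mxE.
  rewrite (bigD1 i)//= big1 ?addr0 => [|k ki]; first by rewrite mxE eqxx mulr1n.
  by rewrite mxE eq_sym (negbTE ki) mulr0n mul0r.
have u0 : row i U != 0.
  apply: contraTneq Uu => u0; rewrite unitmxE unitfE negbK; apply/eqP.
  rewrite (expand_det_row _ i) big1// => j _.
  by have /rowP/(_ j) := u0; rewrite !mxE => ->; rewrite mul0r.
have muC : (d 0 i)^* = d 0 i by apply/CrealP; exact: dreal.
set u := row i U in uM u0; set mu := d 0 i in di uM muC.
have cuM : mxconj u *m M = mu *: mxconj u by rewrite -{1}rM -map_mxM uM map_mxZ /= muC.
have [x [rx x0 xM]] : exists x, [/\ mxreal x, x != 0 & x *m M = mu *: x].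
  have cc : mxconj (mxconj u) = u by apply/matrixP => a b; rewrite !mxE conjCK.
  have [e|ne] := eqVneq (u + mxconj u) 0.
    exists ('i *: u); split.
    - rewrite /mxreal map_mxZ /= conjCi.
      have -> : mxconj u = - u by apply/eqP; rewrite -addr_eq0 addrC e.
      by rewrite scalerN scaleNr opprK.
    - by rewrite scaler_eq0 negb_or neq0Ci.
    - by rewrite -scalemxAl uM !scalerA mulrC.
  exists (u + mxconj u); split => //; first by rewrite /mxreal map_mxD cc addrC.
  by rewrite mulmxDl uM cuM scalerDr.
have [a a0 ax] := normalize_row x0.
exists (a *: x), mu; split => //.
  by apply: mxrealZ => //; rewrite conj_Creal// ger0_real// ltW.
by rewrite -scalemxAl xM !scalerA mulrC.
Qed.

(* Real projectors of rank at most 2 that commute with P and on whose range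
   1 - P has rank at most 1. *)
Definition real_block P Pi := exists e f : 'rV[C]_n,
  [/\ mxreal e /\ mxreal f, e *m e ^t* = 1%:M, e *m f ^t* = 0,
      f *m f ^t* = 1%:M \/ f = 0 & Pi = e ^t* *m e + f ^t* *m f] /\
  Pi *m P = P *m Pi /\
  exists2 c : C, c^* = c & exists u : 'rV[C]_n, Pi *m (1%:M - P) = c *: (u ^t* *m u).

Definition realproj E := [/\ mxreal E, E^T = E & E *m E = E].

Lemma real_block_proj P Pi : real_block P Pi -> realproj Pi.
Proof.
move=> [e [f [[[re rf] ee ef ff ->] _]]].
have fe : f *m e ^t* = 0.
  by rewrite -[e]trmxCK -[f]trmxCK -adjM trmxCK ef trmx0 map_mx0.
have fff : f ^t* *m f *m (f ^t* *m f) = f ^t* *m f.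
  case: ff => [ff|->]; last by rewrite !mulmx0.
  by rewrite -mulmxA (mulmxA f) ff mul1mx.
split.
- by rewrite !mxreal_adj//; do !(apply: mxrealD || apply: mxrealM || apply: mxrealT).
- by rewrite !mxreal_adj// linearD /= !trmx_mul !trmxK.
- rewrite mulmxDl !mulmxDr fff.
  rewrite -(mulmxA _ e (e ^t* *m e)) (mulmxA e) ee mul1mx.
  rewrite -(mulmxA _ e (f ^t* *m f)) (mulmxA e) ef mul0mx mulmx0 addr0.
  by rewrite -(mulmxA _ f (e ^t* *m e)) (mulmxA f) fe mul0mx mulmx0 add0r.
Qed.

(** Makes the decomposition below terminate: each extracted block lowers the trace by at least 1. *)
Lemma real_block_tr P Pi : real_block P Pi -> 1 <= \tr Pi.
Proof.
move=> [e [f [[_ ee _ _ ->] _]]].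
by rewrite mxtraceD !mxtrace_row ee mxE eqxx lerDl row_mul_adj_ge0.
Qed.

(** Let x be a real unit eigenvector of the real part of P inside the range of E. Then x P = rho x +
    z with z purely imaginary and orthogonal to x, and P^2 = P makes the span of x and z invariant.
    The block is the projector onto this span, spanned by the real vectors x and i z; when z = 0 it
    is just the line of x. *)
Lemma exists_real_block P E : P ^t* = P -> P *m P = P -> realproj E -> E *m P = P *m E ->
  E != 0 -> exists Pi, [/\ real_block P Pi, Pi *m E = Pi & E *m Pi = Pi].
Proof.
move=> aP PP [rE sE EE] EP E0.
have aE : E ^t* = E by rewrite mxreal_adj.
have PT : P^T = mxconj P by rewrite -{2}aP; apply/matrixP => i j; rewrite !mxE conjCK.
have EPc : E *m mxconj P = mxconj P *m E by rewrite -rE -!map_mxM EP.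
have pP : psd P by rewrite -PP -{2}aP; exact: psd_mul_adj.
have pE : psd E by rewrite -EE -{2}aE; exact: psd_mul_adj.
(* Adding E keeps the trace of M positive, so M is nonzero, and an eigenvector with nonzero
   eigenvalue lies in the range of E. *)
pose M := E *m (P + mxconj P) *m E + E.
have ccP : mxconj (mxconj P) = P by apply/matrixP => a b; rewrite !mxE conjCK.
have [x [mu [rx xx mu0 muC xM]]] : exists x mu,
    [/\ mxreal x, x *m x ^t* = 1%:M, mu != 0, mu^* = mu & x *m M = mu *: x].
  apply: realsym_eigenvector.
  - apply: mxrealD => //; apply: mxrealM => //; apply: mxrealM => //.
    by rewrite /mxreal map_mxD ccP addrC.
  - by rewrite /M linearD /= !trmx_mul sE linearD /= map_trmx aP PT mulmxA [mxconj P + _]addrC.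
  apply: contraNneq E0 => M0.
  have trM : 0 <= \tr (E *m (P + mxconj P) *m E).
    by apply: psd_tr_ge0; rewrite -{2}aE; apply: psd_congr; apply: psdD => //; exact: psd_conj.
  have : \tr M = 0 by rewrite M0 mxtrace0.
  rewrite /M mxtraceD => /eqP; rewrite paddr_eq0 //; last exact: psd_tr_ge0.
  move=> /andP[_ /eqP trE].
  by apply/eqP/mxtrace_mul_adj_eq0; rewrite aE EE.
have ME : M *m E = M by rewrite /M mulmxDl -mulmxA EE.
have xE : x *m E = x.
  by apply: (scalerI mu0); rewrite scalemxAl -xM -mulmxA ME.
pose rho := (mu - 1) / 2.
have rhoC : rho^* = rho by rewrite /rho fmorph_div rmorphB rmorph1 /= muC conjC_nat.
have xPP : x *m mxconj P = 2 * rho *: x - x *m P.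
  have : x *m (E *m (P + mxconj P) *m E) = (mu - 1) *: x.
    move: xM; rewrite /M mulmxDr xE => /eqP; rewrite -subr_eq0 => /eqP h.
    by rewrite scalerBl scale1r -[mu *: x]addr0 -h; mxabel.
  have -> : E *m (P + mxconj P) *m E = E *m (P + mxconj P).
    by rewrite mulmxDr mulmxDl EP EPc -!mulmxA EE.
  rewrite mulmxA xE mulmxDr => h.
  have -> : 2 * rho = mu - 1 by rewrite /rho; field.
  by rewrite -h addrAC subrr add0r.
clearbody rho => {mu mu0 muC xM M ME}.
(* By [xPP] the real part of x P is rho x, so [z] is i times its imaginary part. *)
have [z zE] : exists z, z = x *m P - rho *: x by exists (x *m P - rho *: x).
have xP : x *m P = rho *: x + z by rewrite zE addrC subrK.
have zP : z *m P = (1 - rho) *: z + (rho - rho ^+ 2) *: x.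
  by rewrite {1}zE mulmxBl -mulmxA PP -scalemxAl xP; apply/matrixP => i j; rewrite !mxE; ring.
have cz : mxconj z = - z.
  by rewrite zE map_mxB map_mxM map_mxZ /= rx rhoC xPP; apply/matrixP => i j; rewrite !mxE; ring.
have zEE : z *m E = z by rewrite zE mulmxBl -mulmxA -EP mulmxA -scalemxAl xE.
have aPx : P *m x ^t* = rho *: x ^t* + z ^t* by rewrite -{1}aP -adjM xP adjD adjZ rhoC.
have zx : z *m x ^t* = 0.
  have h1 : (x *m P *m x ^t*)^T = x *m mxconj P *m x ^t*.
    by rewrite !trmx_mul PT mxreal_adj// trmxK mulmxA.
  have h2 : x *m P *m x ^t* = x *m mxconj P *m x ^t*.
    by rewrite -h1; move: (x *m P *m _) => s; apply/matrixP => i j; rewrite !ord1 [RHS]mxE.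
  move: h2; rewrite xPP xP mulmxBl mulmxDl -scalemxAl.
  have -> : (2 * rho *: x) *m x ^t* = rho *: (x *m x ^t*) + rho *: (x *m x ^t*).
    by rewrite -scalemxAl -scalerDl; congr (_ *: _); ring.
  move: (x *m x ^t*) (z *m x ^t*) => s q /matrixP h; apply/matrixP => i j.
  have := h i j; rewrite !mxE => hij.
  have : 2 * q i j = 0 by rewrite -[RHS](subrr (rho * s i j + q i j)) {2}hij; ring.
  by move/eqP; rewrite mulf_eq0 pnatr_eq0 /= => /eqP.
have xz : x *m z ^t* = 0 by rewrite -[x]trmxCK -adjM zx trmx0 map_mx0.
have zz : z *m z ^t* = (rho - rho ^+ 2)%:M.
  have h : x *m P *m (P *m x ^t*) = x *m P *m x ^t* by rewrite mulmxA -(mulmxA x) PP.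
  move: h; rewrite aPx xP !mulmxDl !mulmxDr -!scalemxAl -!scalemxAr zx xz xx.
  rewrite !scaler0 !addr0 add0r scalerA => h.
  rewrite -[LHS](addrK (rho * rho *: 1%:M)) [X in X - _]addrC h.
  by apply/matrixP => i j; rewrite !ord1 !mxE eqxx; ring.
have tau0 : 0 <= rho - rho ^+ 2.
  by have := row_mul_adj_ge0 z; rewrite zz mxE eqxx mulr1n.
have Epi Pi : realproj Pi -> Pi *m E = Pi -> E *m Pi = Pi.
  by move=> [_ sPi _] h; rewrite -{2}sPi -[in RHS]h trmx_mul sE sPi.
have r1C : (1 - rho)^* = 1 - rho by rewrite rmorphB rmorph1 /= rhoC.
have [t0|t0] := eqVneq (rho - rho ^+ 2) 0.
  have z0 : z = 0 by apply: row_mul_adj_eq0; rewrite zz t0 mxE mul0rn.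
  have bPi : real_block P (x ^t* *m x).
    exists x, 0; split; first split => //.
    + by split => //; exact: map_mx0.
    + by rewrite trmx0 map_mx0 mulmx0.
    + by right.
    + by rewrite mulmx0 addr0.
    split.
      by rewrite -mulmxA xP mulmxA aPx z0 trmx0 map_mx0 !addr0 -scalemxAl -scalemxAr.
    exists (1 - rho) => //.
    exists x; rewrite mulmxBr mulmx1 -mulmxA xP z0 addr0 -scalemxAr scalerBl scale1r.
    by [].
  exists (x ^t* *m x); split => //; first by rewrite -mulmxA xE.
  by apply: Epi; [exact: real_block_proj bPi|rewrite -mulmxA xE].
pose t := rho - rho ^+ 2; have tpos : 0 < t by rewrite lt_def t0.
have tC : t^* = t by rewrite /t rmorphB rmorphXn /= rhoC.
have r1 : 1 - rho != 0.
  apply: contraNneq t0 => h; have -> : rho - rho ^+ 2 = rho * (1 - rho) by ring.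
  by rewrite h mulr0.
have s0 : 0 < sqrtC t by rewrite sqrtC_gt0.
have sC : (sqrtC t)^* = sqrtC t by rewrite conj_Creal// ger0_real// ltW.
(* A real unit vector, since z is purely imaginary with squared norm t = rho - rho^2. *)
pose f := ('i / sqrtC t) *: z.
have fC : ('i / sqrtC t)^* = - ('i / sqrtC t) by rewrite fmorph_div /= conjCi sC mulNr.
have ff : ('i / sqrtC t) * ('i / sqrtC t)^* = t^-1.
  rewrite fC mulrN mulf_div -!expr2 sqrCi sqrtCK mulNr opprK div1r//.
have ffE : f ^t* *m f = t^-1 *: (z ^t* *m z).
  by rewrite /f adjZ -scalemxAl -scalemxAr scalerA mulrC ff.
have bPi : real_block P (x ^t* *m x + t^-1 *: (z ^t* *m z)).
  exists x, f; split; first split => //.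
  + split => //; rewrite /f /mxreal map_mxZ /= cz fC scalerN scaleNr opprK//.
  + by rewrite /f adjZ -scalemxAr xz scaler0.
  + left; rewrite /f adjZ -scalemxAl -scalemxAr scalerA ff zz scale_scalar_mx.
    by rewrite mulVf// gt_eqF.
  + by rewrite ffE.
  have PiP : (x ^t* *m x + t^-1 *: (z ^t* *m z)) *m P =
      rho *: (x ^t* *m x) + x ^t* *m z + z ^t* *m x + (t^-1 * (1 - rho)) *: (z ^t* *m z).
    rewrite mulmxDl -scalemxAl -!mulmxA xP zP !mulmxDr -!scalemxAr scalerDr !scalerA.
    have -> : t^-1 * (rho - rho ^+ 2) = 1 by rewrite mulVf// gt_eqF.
    by rewrite scale1r [X in _ + X]addrC addrA.
  have vC : (t^-1 * (1 - rho))^* = t^-1 * (1 - rho).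
    by rewrite rmorphM fmorphV /= r1C tC.
  split.
    have {1}<- : ((x ^t* *m x + t^-1 *: (z ^t* *m z)) *m P) ^t* =
      (x ^t* *m x + t^-1 *: (z ^t* *m z)) *m P.
      rewrite PiP !(adjD, adjZ, adjM, trmxCK) rhoC vC.
      by congr (_ + _); rewrite addrAC.
    by rewrite adjM aP adjD adjZ !adjM !trmxCK fmorphV /= tC.
  (* On the block, 1 - P is the projector onto the line of x (1 - P) = (1 - rho) x - z, whose
     squared norm is (1 - rho)^2 + rho (1 - rho) = 1 - rho. *)
  exists (1 - rho)^-1; first by rewrite fmorphV /= r1C.
  exists ((1 - rho) *: x - z).
  rewrite mulmxBr mulmx1 PiP adjB adjZ r1C.
  rewrite !(mulmxBl, mulmxBr) -!scalemxAl -!scalemxAr.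
  move: (x ^t* *m x) (x ^t* *m z) (z ^t* *m x) (z ^t* *m z) => F1 F2 F3 F4.
  have rho0 : rho != 0 by apply: contraNneq t0 => ->; rewrite expr0n /= subr0.
  apply/matrixP => i j; rewrite !mxE /t.
  have -> : rho - rho ^+ 2 = rho * (1 - rho) by ring.
  by field; rewrite r1 rho0.
exists (x ^t* *m x + t^-1 *: (z ^t* *m z)).
have h : (x ^t* *m x + t^-1 *: (z ^t* *m z)) *m E = x ^t* *m x + t^-1 *: (z ^t* *m z).
  by rewrite mulmxDl -scalemxAl -!mulmxA xE zEE.
by split => //; apply: Epi => //; exact: real_block_proj bPi.
Qed.

Lemma real_block_decomposition P E r : P ^t* = P -> P *m P = P -> realproj E ->
  E *m P = P *m E -> \tr E <= r%:R ->
  exists s : seq 'M[C]_n, [/\ (forall Pi, Pi \in s -> real_block P Pi /\ Pi *m E = Pi),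
    pairwise (fun A B => A *m B == 0) s & \sum_(Pi <- s) Pi = E].
Proof.
move=> aP PP; elim: r E => [|r IH] E rpE EP trE.
  have [rE sE EE] := rpE.
  have aE : E ^t* = E by rewrite mxreal_adj.
  exists [::]; split => //; rewrite big_nil; apply/esym/mxtrace_mul_adj_eq0.
  by rewrite aE EE; apply/le_anti; rewrite trE /= psd_tr_ge0// -EE -{2}aE; exact: psd_mul_adj.
have [->|E0] := eqVneq E 0; first by exists [::]; split => //; rewrite big_nil.
have [Pi [bPi PiE EPi]] := exists_real_block aP PP rpE EP E0.
have [rE sE EE] := rpE; have [rPi sPi PiPi] := real_block_proj bPi.
have PiP : Pi *m P = P *m Pi by case: bPi => [? [? [_ []]]].
have [] := IH (E - Pi).
- split; first by rewrite -scaleN1r; apply: mxrealD => //; apply: mxrealZ => //; rewrite rmorphN1.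
  + by rewrite linearB /= sE sPi.
  + by rewrite mulmxBl !mulmxBr EE PiPi PiE EPi subrr subr0.
- by rewrite mulmxBl mulmxBr EP PiP.
- rewrite linearB /= lerBlDr (le_trans trE)// -natr1 lerD2l; exact: real_block_tr bPi.
move=> s [sb ps ss]; exists (Pi :: s); split.
- move=> Q; rewrite inE => /orP[/eqP->//|/sb[bQ QE]]; split => //.
  by rewrite -QE -mulmxA mulmxBl EE PiE.
- rewrite pairwise_cons; apply/andP; split=> //; apply/allP => Q /sb[bQ QE].
  have [rQ sQ QQ] := real_block_proj bQ.
  have : Q *m Pi = 0 by rewrite -QE -mulmxA mulmxBl EPi PiPi subrr mulmx0.
  by move/(congr1 trmx); rewrite trmx_mul sPi sQ trmx0 => ->; exact: eqxx.
- by rewrite big_cons ss addrC subrK.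
Qed.

End RealBlocks.

(** * Pinching by a family of real blocks *)

Section Pinching.
Context {C : numClosedFieldType} {n : nat}.
Implicit Types (B P E Pi X : 'M[C]_n) (s : seq 'M[C]_n).

Definition pinch s B := \sum_(Pi <- s) Pi *m B *m Pi.

Lemma real_block_adj P Pi : real_block P Pi -> Pi ^t* = Pi.
Proof. by move=> /real_block_proj[rPi sPi _]; rewrite mxreal_adj. Qed.

Lemma real_block_idem P Pi : real_block P Pi -> Pi *m Pi = Pi.
Proof. by move=> /real_block_proj[]. Qed.

Lemma real_block_comm P Pi : real_block P Pi -> Pi *m P = P *m Pi.
Proof. by case=> e [f [_ []]]. Qed.

Lemma real_block_psd P Pi : real_block P Pi -> psd Pi.
Proof.
move=> bPi; rewrite -(real_block_idem bPi) -{2}(real_block_adj bPi); exact: psd_mul_adj.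
Qed.

(** X lives on the range of 1 - P, and Pi (1 - P) is a multiple of some u^H u, so the compression
    only sees the scalar u X u^H; the trace identifies the factor. *)
Lemma pinch_rank1 P X Pi : P *m P = P -> real_block P Pi ->
  (1%:M - P) *m X *m (1%:M - P) = X ->
  Pi *m X *m Pi = \tr (Pi *m X) *: (Pi *m (1%:M - P)).
Proof.
move=> PP bPi XE; have PiP := real_block_comm bPi.
have [e [f [_ [_ [c cC [u uE]]]]]] := bPi.
have uE' : (1%:M - P) *m Pi = c *: (u ^t* *m u).
  by rewrite -uE mulmxBl mulmxBr mul1mx mulmx1 PiP.
have uXu : u *m X *m u ^t* = ((u *m X *m u ^t*) 0 0)%:M.
  by apply/matrixP => i j; rewrite !ord1 [RHS]mxE eqxx mulr1n.
have PXP : Pi *m X *m Pi = (Pi *m (1%:M - P)) *m X *m ((1%:M - P) *m Pi).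
  by rewrite -{1}XE !mulmxA.
have QX : X = (1%:M - P) *m X.
  rewrite -{2}XE !mulmxA.
  have -> : (1%:M - P) *m (1%:M - P) = 1%:M - P.
    by rewrite mulmxBl mul1mx mulmxBr mulmx1 PP subrr subr0.
  by rewrite XE.
have trE : \tr (Pi *m X) = c * (u *m X *m u ^t*) 0 0.
  rewrite {1}QX mulmxA uE -scalemxAl linearZ /=; congr (_ * _).
  by rewrite -mulmxA mxtrace_mulC /mxtrace big_ord1.
rewrite PXP trE uE uE' scalerA -!scalemxAl -scalemxAr scalerA.
have -> : u ^t* *m u *m X *m (u ^t* *m u) = (u *m X *m u ^t*) 0 0 *: (u ^t* *m u).
  rewrite -!mulmxA (mulmxA u X) (mulmxA (u *m X)) uXu mul_scalar_mx -scalemxAr.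
  by rewrite mulmxA.
by rewrite scalerA; congr (_ *: _); ring.
Qed.

Lemma pinch_comm s A : \sum_(Pi <- s) Pi = 1%:M ->
  (forall Pi, Pi \in s -> Pi *m Pi = Pi /\ Pi *m A = A *m Pi) -> pinch s A = A.
Proof.
move=> s1 h; rewrite -[RHS]mulmx1 -s1 mulmx_sumr; apply: eq_big_seq => Pi /h[PiPi PiA].
by rewrite PiA -mulmxA PiPi.
Qed.

Lemma pinchD s A B : pinch s (A + B) = pinch s A + pinch s B.
Proof. by rewrite -big_split; apply: eq_bigr => Pi _; rewrite mulmxDr mulmxDl. Qed.

Lemma pinchZ s c A : pinch s (c *: A) = c *: pinch s A.
Proof. by rewrite scaler_sumr; apply: eq_bigr => Pi _; rewrite -scalemxAr -scalemxAl. Qed.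

Lemma tr_pinch s A : \sum_(Pi <- s) Pi = 1%:M ->
  (forall Pi, Pi \in s -> Pi *m Pi = Pi) -> \tr (pinch s A) = \tr A.
Proof.
move=> s1 h; rewrite -[in RHS](mul1mx A) -s1 mulmx_suml !linear_sum /=.
by apply: eq_big_seq => Pi /h PiPi; rewrite mxtrace_mulC mulmxA PiPi.
Qed.

(* On a block, 1 - P has rank at most one, so pinching X there leaves a multiple
   of 1 - P; block_weight collects these multiples. *)
Definition block_weight s X (eta : C) : 'M[C]_n :=
  eta%:M + \sum_(Pi <- s) \tr (Pi *m X) *: Pi.

Section BlockWeight.
Variables (P X : 'M[C]_n) (s : seq 'M[C]_n) (eta : C).
Hypotheses (PP : P *m P = P) (pX : psd X) (XE : (1%:M - P) *m X *m (1%:M - P) = X).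
Hypotheses (eta0 : 0 < eta) (sP : forall Pi, Pi \in s -> real_block P Pi).
Hypotheses (ps : pairwise (fun A B => A *m B == 0) s) (s1 : \sum_(Pi <- s) Pi = 1%:M).
Let b := block_weight s X eta.

Lemma block_weight_sum_psd : psd (\sum_(Pi <- s) \tr (Pi *m X) *: Pi).
Proof.
rewrite big_seq; elim/big_ind: _ => [|A B|Pi /sP bPi]; [exact: psd0|exact: psdD|].
by apply: psdZ; [apply: psd_trM_ge0 => //|]; exact: real_block_psd bPi.
Qed.

Lemma block_weight_psd : psd b.
Proof.
apply: psdD; last exact: block_weight_sum_psd.
by rewrite -scalemx1; apply: psdZ; [exact: ltW|exact: psd1].
Qed.

Lemma block_weight_unit : b \in unitmx.
Proof.
have -> : b = eta *: (1%:M + eta^-1 *: \sum_(Pi <- s) \tr (Pi *m X) *: Pi).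
  by rewrite scalerDr scalerA mulfV ?gt_eqF// scale1r scalemx1.
rewrite unitmxZ ?unitfE ?gt_eqF//; apply: psd_unit.
by apply: psdZ; [rewrite invr_ge0 ltW|exact: block_weight_sum_psd].
Qed.

Lemma block_weight_real : mxreal b.
Proof.
apply: mxrealD.
  rewrite -scalemx1; apply: mxrealZ; last exact: mxreal1.
  by apply: conj_Creal; exact: gtr0_real.
rewrite big_seq; elim/big_ind: _ => [|A B|Pi /sP bPi].
- by rewrite /mxreal map_mx0.
- exact: mxrealD.
- apply: mxrealZ; last by case/real_block_proj: bPi.
  apply: conj_Creal; apply: ger0_real; apply: psd_trM_ge0 => //.
  exact: real_block_psd bPi.
Qed.

Lemma block_weight_comm : P *m b = b *m P.
Proof.
rewrite /b /block_weight mulmxDr mulmxDl mul_mx_scalar mul_scalar_mx; congr (_ + _).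
rewrite mulmx_sumr mulmx_suml; apply: eq_big_seq => Pi /sP/real_block_comm h.
by rewrite -scalemxAr -scalemxAl h.
Qed.

Lemma pinch_mul_compl : pinch s X + eta *: (1%:M - P) = b *m (1%:M - P).
Proof.
rewrite /b /block_weight mulmxDl mul_scalar_mx addrC; congr (_ + _).
rewrite mulmx_suml; apply: eq_big_seq => Pi /sP bPi.
by rewrite (pinch_rank1 PP bPi XE) -scalemxAl.
Qed.

(** The pairwise condition gives products in list order only; transposing gives the others, as
    blocks are symmetric. *)
Lemma real_blocks_orth : {in s &, forall A B, A != B -> A *m B = 0}.
Proof.
move=> A B As Bs AB; have /(pairwiseP 0) h := ps.
have sT (Q : 'M[C]_n) : Q \in s -> Q^T = Q by move/sP/real_block_proj => [].
have [ij|ij|ij] := ltngtP (index A s) (index B s).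
- by have := h _ _ _ _ ij; rewrite !nth_index// !inE !index_mem => /(_ As Bs)/eqP.
- have := h _ _ _ _ ij; rewrite !nth_index// !inE !index_mem => /(_ Bs As)/eqP.
  by move/(congr1 trmx); rewrite trmx_mul (sT _ As) (sT _ Bs) trmx0.
- by case/eqP: AB; rewrite -[LHS](nth_index 0 As) ij nth_index.
Qed.

Lemma block_weight_block Pi : Pi \in s -> Pi *m b = b *m Pi.
Proof.
move=> Pis; rewrite /b /block_weight mulmxDr mulmxDl mul_mx_scalar mul_scalar_mx.
congr (_ + _); rewrite mulmx_sumr mulmx_suml; apply: eq_big_seq => Q Qs.
rewrite -scalemxAr -scalemxAl; congr (_ *: _).
have [->//|QPi] := eqVneq Q Pi.
by rewrite !real_blocks_orth// eq_sym.
Qed.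

(** Blocks commute with P and b, so pinching fixes b P and 1 - P and acts only on X. The result has
    the form required by [mean_resid_boost_le], with a real b. *)
Lemma pinch_boost (t Lam : C) :
  pinch s (t^-1 *: (Lam *: (b *m P) + X + eta *: (1%:M - P))) =
  boost (t^-1 *: b) P Lam.
Proof.
rewrite pinchZ -addrA !pinchD !pinchZ.
have -> : pinch s (b *m P) = b *m P.
  apply: pinch_comm => // Pi Pis; have bPi := sP Pis.
  split; first exact: real_block_idem bPi.
  by rewrite mulmxA block_weight_block// -!mulmxA (real_block_comm bPi).
have -> : pinch s (1%:M - P) = 1%:M - P.
  apply: pinch_comm => // Pi Pis; have bPi := sP Pis.
  split; first exact: real_block_idem bPi.
  by rewrite mulmxBr mulmxBl mulmx1 mul1mx (real_block_comm bPi).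
rewrite pinch_mul_compl /boost mulmxBr mulmx1 -scalemxAl [X in _ = _ + X]scalerA mulrC.
rewrite -scalerA -scalerDr; congr (_ *: _); rewrite scalerBl scale1r.
by rewrite addrCA.
Qed.

(** Pinching preserves the trace, so passing from X to b (1 - P) costs nothing beyond the eta term;
    the final constant depends on this. *)
Lemma tr_compl_block_weight : \tr ((1%:M - P) *m b) = \tr X + eta * \tr (1%:M - P).
Proof.
have -> : (1%:M - P) *m b = b *m (1%:M - P).
  by rewrite mulmxBl mulmxBr mul1mx mulmx1 block_weight_comm.
have {1}-> : \tr X = \tr (pinch s X) by rewrite tr_pinch// => Pi /sP/real_block_idem.
by rewrite -pinch_mul_compl [LHS]mxtraceD mxtraceZ.
Qed.

End BlockWeight.

End Pinching.

Lemma pinch_step (C : numClosedFieldType) n (Pi E B S : 'M[C]_n) :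
  Pi *m E = 0 -> E *m Pi = 0 -> Pi *m S = 0 -> S *m Pi = 0 ->
  let B' := S + (1%:M - E) *m B *m (1%:M - E) in
  Pi *m B' *m Pi + (1%:M - Pi) *m B' *m (1%:M - Pi) =
  Pi *m B *m Pi + S + (1%:M - (Pi + E)) *m B *m (1%:M - (Pi + E)).
Proof.
move=> PE EP PS SP /=.
have c1 : Pi *m (1%:M - E) = Pi by rewrite mulmxBr mulmx1 PE subr0.
have c2 : (1%:M - E) *m Pi = Pi by rewrite mulmxBl mul1mx EP subr0.
have c3 : (1%:M - Pi) *m (1%:M - E) = 1%:M - (Pi + E).
  by rewrite mulmxBl mul1mx c1 opprD addrA addrAC.
have c4 : (1%:M - E) *m (1%:M - Pi) = 1%:M - (Pi + E).
  by rewrite mulmxBr mulmx1 c2 opprD addrA addrAC.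
have s1 : (1%:M - Pi) *m S *m (1%:M - Pi) = S.
  by rewrite mulmxBl mul1mx PS subr0 mulmxBr mulmx1 SP subr0.
move: (1%:M - E) (1%:M - Pi) (1%:M - (Pi + E)) c1 c2 c3 c4 s1 => G F K c1 c2 c3 c4 s1.
rewrite !mulmxDr !mulmxDl s1 PS mul0mx add0r.
by rewrite !mulmxA c1 c3 -!mulmxA c2 c4 !mulmxA addrA.
Qed.

Section CoreBound.
Context {d : measure_display} {T : measurableType d} {R : realType}.
Variables (P : probability T R) (n l : nat) (W : 'I_n -> 'I_l -> {RV P >-> R}).
Hypothesis hW : gaussian_matrix W.
Local Notation C := R[i].
Local Notation Re := (@complex.Re R).
Implicit Types (B Pr Pi X H : 'M[C]_n).

Lemma mxreal_cmatrixE m k (A : 'M[C]_(m, k)) : mxreal A -> exists A0 : 'M[R]_(m, k), A = cmatrix A0.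
Proof.
move=> rA; exists (map_mx Re A); apply/matrixP => i j.
have /matrixP/(_ i j) := rA; rewrite !mxE; case: (A i j) => a b /= [hb].
suff -> : b = 0 by [].
by apply/eqP; rewrite -eqNr hb.
Qed.

Lemma mean_resid_real_block B Pr Pi : psd B -> real_block Pr Pi ->
  mean_resid (l := l) W B <= mean_resid W (Pi *m B *m Pi + (1%:M - Pi) *m B *m (1%:M - Pi)).
Proof.
move=> pB [e [f [[[re rf] ee ef ff ->] _]]].
have [e0 eE] := mxreal_cmatrixE re; have [f0 fE] := mxreal_cmatrixE rf.
have inj (x : R) : x%:C%C = 1 -> x = 1 by case.
have inj0 (x : R) : x%:C%C = 0 -> x = 0 by case.
have dotE (x y : 'rV[R]_n) : (cmatrix x *m (cmatrix y) ^t*) 0 0 = (rdot x y)%:C%C.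
  by rewrite cmatrix_adj -cmatrixM mxE.
apply: (mean_resid_pinch hW (e := e0) (f := f0)) => //.
- by apply: inj; rewrite -dotE -eE ee mxE eqxx.
- by apply: inj0; rewrite -dotE -eE -fE ef mxE.
- case: ff => [ff|f00]; [left|right].
    by apply: inj; rewrite -dotE -fE ff mxE eqxx.
  apply/matrixP => i j; have /matrixP/(_ i j) := fE; rewrite f00 !mxE => h.
  exact: (inj0 _ (esym h)).
- by rewrite eE fE !cmatrix_adj -!cmatrixM /cmatrix map_mxD.
Qed.

(** Blocks are split off one at a time by [mean_resid_real_block]. The part not yet split is the
    compression to 1 - E, which disappears once the blocks sum to 1. *)
Lemma mean_resid_pinch_seq Pr B (s : seq 'M[C]_n) : psd B ->
  (forall Pi, Pi \in s -> real_block Pr Pi) -> pairwise (fun A B => A *m B == 0) s ->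
  let E := \sum_(Pi <- s) Pi in
  mean_resid (l := l) W B <= mean_resid W (pinch s B + (1%:M - E) *m B *m (1%:M - E)) /\
  psd (pinch s B + (1%:M - E) *m B *m (1%:M - E)).
Proof.
move=> pB; elim: s => [_ _ E|Pi s IH sP ps E].
  by rewrite /pinch /E !big_nil subr0 mul1mx mulmx1 add0r.
move: ps; rewrite pairwise_cons => /andP[/allP hPi ps].
have sP' Q : Q \in s -> real_block Pr Q by move=> Qs; apply: sP; rewrite inE Qs orbT.
have bPi : real_block Pr Pi by apply: sP; rewrite inE eqxx.
have [] := IH sP' ps; set E' := \sum_(Q <- s) Q; set B' := pinch s B + _ => le1 pB'.
have PiE' : Pi *m E' = 0.
  by rewrite /E' mulmx_sumr big_seq big1// => Q /hPi/eqP.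
have aPi : Pi ^t* = Pi := real_block_adj bPi.
have aE' : E' ^t* = E'.
  have : psd E'.
    rewrite /E' big_seq.
    by elim/big_ind: _ => [|A D|Q /sP'/real_block_psd//]; [exact: psd0|exact: psdD].
  exact: psd_adj.
have E'Pi : E' *m Pi = 0 by rewrite -aPi -aE' -adjM PiE' trmx0 map_mx0.
have EE : E = Pi + E' by rewrite /E big_cons.
have zl : Pi *m pinch s B = 0.
  rewrite /pinch mulmx_sumr big_seq big1// => Q /hPi/eqP h.
  by rewrite !mulmxA h !mul0mx.
have zr : pinch s B *m Pi = 0.
  rewrite /pinch mulmx_suml big_seq big1// => Q Qs.
  have : Q *m Pi = 0 by rewrite -aPi -(real_block_adj (sP' _ Qs)) -adjM (eqP (hPi _ Qs)) trmx0 map_mx0.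
  by rewrite -mulmxA => ->; rewrite mulmx0.
have step : Pi *m B' *m Pi + (1%:M - Pi) *m B' *m (1%:M - Pi) =
    pinch (Pi :: s) B + (1%:M - E) *m B *m (1%:M - E).
  by rewrite [pinch (Pi :: s) B]big_cons EE; exact: pinch_step.
rewrite -step; split.
  by apply: (le_trans le1); exact: mean_resid_real_block bPi.
apply: psdD; first by rewrite -{2}aPi; exact: psd_congr.
have {2}-> : 1%:M - Pi = (1%:M - Pi) ^t* by rewrite adjB adj1 aPi.
exact: psd_congr.
Qed.

Lemma tr_defect_le_resid B V : psd B ->
  \tr (B *m (defectV (l := l) B V *m (defectV B V) ^t*)) <= \tr (residV B V).
Proof.
move=> pB; have := residE pB (mxreal_cmatrix V); rewrite /defectV /residV.
move: (resid _ _) (defect _ _) (coef _ _) => F D Z ->.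
rewrite mxtraceD mulmxA [\tr (B *m D *m _)]mxtrace_mulC -mulmxA lerDl.
by rewrite mxtrace_mulC; exact: mxtrace_mul_adj_ge0.
Qed.

Lemma Re_realM (r : R) (z : C) : Re (r%:C%C * z) = r * Re z.
Proof. by case: z => a b /=; rewrite mul0r subr0. Qed.

Lemma psd_mul_proj A Pr : psd A -> Pr ^t* = Pr -> Pr *m Pr = Pr -> Pr *m A = A *m Pr ->
  psd (A *m Pr).
Proof.
by move=> pA aPr PrPr PrA; rewrite -PrPr mulmxA -PrA -{2}aPr; exact: psd_congr.
Qed.

Lemma psd_proj Pr : Pr ^t* = Pr -> Pr *m Pr = Pr -> psd Pr.
Proof. by move=> aPr PrPr; rewrite -PrPr -{2}aPr; exact: psd_mul_adj. Qed.

(** The constant [lam] is absent from the bound: H sits on the range of the projector, where the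
    boost can be arbitrarily large. The witness is the dominating matrix divided by eta, so that the
    additive k of [mean_resid_boost_le] is multiplied by eta. *)
Lemma mean_defect_bound Pr H X k p (lam : C) (eps : R) : l = (k + p)%N -> (2 <= p)%N ->
  Pr ^t* = Pr -> Pr *m Pr = Pr -> \tr Pr = k%:R ->
  0 <= lam -> psd (lam *: Pr - H) ->
  psd X -> (1%:M - Pr) *m X *m (1%:M - Pr) = X -> 0 < eps ->
  exists2 B, psd B &
    Ex W (fun V => Re (\tr ((H + X) *m (defectV (l := l) B V *m (defectV B V) ^t*))))
    <= (1 + k%:R / (p%:R - 1)) * Re (\tr X) + eps.
Proof.
move=> lkp p2 aPr PrPr trPr lam0 pH pX XE eps0.
have p1 : 0 < p%:R - 1 :> R by rewrite subr_gt0 ltr1n.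
(* Collects the errors per unit of [delta]: k from the additive term, (k + p - 1) n from eta (1 -
   Pr), whose trace is at most n, and a spare 1 that keeps [N] positive. [delta] is then fixed so
   that the total is eps (p - 1). *)
pose N : R := k%:R + (k%:R + p%:R - 1) * n%:R + 1.
have N0 : 0 < N.
  by rewrite /N ltr_wpDl// addr_ge0// mulr_ge0// -addrA addr_ge0// ltW.
have [delta [delta0 deltaN]] : exists delta : R, 0 < delta /\ delta * N = eps * (p%:R - 1).
  exists (eps * (p%:R - 1) / N); split; first by rewrite divr_gt0// mulr_gt0.
  by rewrite divfK// gt_eqF.
have [eta etaE] : exists eta : C, eta = delta%:C%C by eexists.
have eta0 : 0 < eta by rewrite etaE ltcR.
have rp1 : realproj (1%:M : 'M[C]_n) by split; rewrite ?mulmx1 ?trmx1//; exact: mxreal1.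
have [s [sP' ps s1]] : exists s : seq 'M[C]_n,
    [/\ (forall Pi, Pi \in s -> real_block Pr Pi /\ Pi *m 1%:M = Pi),
    pairwise (fun A B => A *m B == 0) s & \sum_(Pi <- s) Pi = 1%:M].
  by apply: (real_block_decomposition (r := n)) => //; rewrite ?mulmx1 ?mul1mx// mxtrace1.
have sP Pi : Pi \in s -> real_block Pr Pi by move/sP' => [].
(* Since b is at least eta, Lam b Pr is at least (lam + 2 eta) Pr, which dominates H. The 2 keeps
   Lam > 1 even for lam = 0. *)
pose Lam := (lam + 2 * eta) / eta.
have Lam1 : 1 < Lam.
  by rewrite /Lam ltr_pdivlMr// mul1r ltr_wpDl// ltr_pMl// ltr1n.
have LamE : Lam * eta = lam + 2 * eta by rewrite /Lam divfK// gt_eqF.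
have pb := block_weight_psd pX eta0 sP.
have rb := block_weight_real pX eta0 sP.
have ub := block_weight_unit pX eta0 sP.
have Pb := block_weight_comm X eta sP.
have trb := tr_compl_block_weight eta PrPr XE sP s1.
have pE := pinch_boost eta PrPr XE sP ps s1 eta Lam.
have sumb : block_weight s X eta = eta%:M + \sum_(Pi <- s) \tr (Pi *m X) *: Pi by [].
have psum := block_weight_sum_psd pX sP.
move: (block_weight s X eta) pb rb ub Pb trb pE sumb => b pb rb ub Pb trb pE sumb.
pose Q := 1%:M - Pr.
have aQ : Q ^t* = Q by rewrite /Q adjB adj1 aPr.
have QQ : Q *m Q = Q by rewrite /Q mulmxBl mul1mx mulmxBr mulmx1 PrPr subrr subr0.
have pQ := psd_proj aQ QQ.
have iv0 : 0 <= eta^-1 by rewrite invr_ge0 ltW.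
pose Bh := eta^-1 *: (Lam *: (b *m Pr) + X + eta *: Q).
have pB : psd Bh.
  apply: psdZ => //; apply: psdD; last by apply: psdZ => //; exact: ltW.
  apply: psdD => //; apply: psdZ; first by rewrite ltW// (lt_trans ltr01).
  exact: psd_mul_proj.
exists Bh => //.
have pdom : psd (eta *: Bh - (H + X)).
  have -> : eta *: Bh - (H + X) =
      Lam *: ((\sum_(Pi <- s) \tr (Pi *m X) *: Pi) *m Pr) + (lam *: Pr - H) + (2 * eta) *: Pr +
      eta *: Q.
    rewrite /Bh scalerA mulfV ?gt_eqF// scale1r sumb mulmxDl mul_scalar_mx scalerDr scalerA LamE.
    by rewrite scalerDl; move: (Lam *: _) => Z; apply/matrixP => i j; rewrite !mxE; ring.
  apply: psdD; last by apply: psdZ => //; exact: ltW.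
  apply: psdD; last by apply: psdZ; [rewrite mulr_ge0// ltW|exact: psd_proj].
  apply: psdD => //; apply: psdZ; first by rewrite ltW// (lt_trans ltr01).
  apply: psd_mul_proj => //; rewrite mulmx_sumr mulmx_suml.
  by apply: eq_big_seq => Pi /sP/real_block_comm h; rewrite -scalemxAr -scalemxAl h.
have le1 : Ex W (fun V => Re (\tr ((H + X) *m (defectV (l := l) Bh V *m (defectV Bh V) ^t*))))
    <= delta * mean_resid (l := l) W Bh.
  rewrite /mean_resid -(ExZ hW); last exact: tame_tr_resid.
  apply: (le_Ex hW); first exact: tame_tr_defect.
    by apply: tameZ; exact: tame_tr_resid.
  move=> V; rewrite -Re_realM -etaE; apply: Re_le.
  have pD := psd_mul_adj (defectV (l := l) Bh V).
  have h1 := psd_trM_ge0 pdom pD.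
  have h2 := tr_defect_le_resid V pB.
  move: (defectV Bh V *m _) pD h1 h2 => DD pD h1 h2.
  apply: (@le_trans _ _ (eta * \tr (Bh *m DD))); last by rewrite ler_wpM2l// ltW.
  by rewrite -subr_ge0 -mxtraceZ scalemxAl -linearB -mulmxBl.
have [le2 _] := mean_resid_pinch_seq pB sP ps.
move: le2; rewrite s1 subrr mulmx0 addr0 pE => le2.
have uib : eta^-1 *: b \in unitmx by rewrite unitmxZ// unitfE invr_eq0 gt_eqF.
have le3 : (l%:R - 1 - k%:R) * mean_resid (l := l) W (boost (eta^-1 *: b) Pr Lam) <=
    k%:R + (l%:R - 1) * Re (\tr (Q *m (eta^-1 *: b))).
  apply: (mean_resid_boost_le hW) => //.
  - by rewrite lkp addn_gt0 (leq_trans _ p2) ?orbT.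
  - exact: psdZ.
  - by apply: mxrealZ => //; apply: conj_Creal; exact: ger0_real.
  - by rewrite -scalemxAr Pb -scalemxAl.
have trQ : delta * Re (\tr (Q *m (eta^-1 *: b))) <= Re (\tr X) + delta * n%:R.
  rewrite -Re_realM -etaE -mxtraceZ -scalemxAr scalerA mulfV ?gt_eqF// scale1r trb ReD lerD2l.
  rewrite etaE Re_realM ler_wpM2l ?(ltW delta0)//.
  rewrite linearB /= mxtrace1 trPr ReD ReN.
  by rewrite -!(rmorph_nat (real_complex R)) /= gerBl.
have lR : l%:R = k%:R + p%:R :> R by rewrite lkp natrD.
move: le1 le2 le3 trQ; rewrite lR.
move: (Ex _ _) (mean_resid W Bh) (mean_resid W (boost _ _ _)) (Re (\tr (Q *m _))) (Re (\tr X)).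
move=> f m1 m2 y x le1 le2 le3 trQ.
apply: (le_trans le1); apply: (le_trans (ler_wpM2l (ltW delta0) le2)).
(* Multiplying by p - 1 = l - 1 - k produces the left side of [le3]. *)
rewrite -(ler_pM2l p1).
have -> : (p%:R - 1) * (delta * m2) = delta * ((k%:R + p%:R - 1 - k%:R) * m2) by ring.
apply: (le_trans (ler_wpM2l (ltW delta0) le3)).
have kp1 : 0 <= k%:R + p%:R - 1 :> R by rewrite -addrA addr_ge0// ltW.
have -> : delta * (k%:R + (k%:R + p%:R - 1) * y) =
  delta * k%:R + (k%:R + p%:R - 1) * (delta * y) by ring.
apply: (le_trans (lerD (lexx _) (ler_wpM2l kp1 trQ))).
have -> : (p%:R - 1) * ((1 + k%:R / (p%:R - 1)) * x + eps) =
    (k%:R + p%:R - 1) * x + delta * N.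
  by rewrite deltaN; field; rewrite gt_eqF.
rewrite -subr_ge0 /N.
have -> : (k%:R + p%:R - 1) * x + delta * (k%:R + (k%:R + p%:R - 1) * n%:R + 1) -
  (delta * k%:R + (k%:R + p%:R - 1) * (x + delta * n%:R)) = delta by ring.
exact: ltW.
Qed.

End CoreBound.

(** * Singular values and subspace iteration *)

Section SpectralCalculus.
Context {C : numClosedFieldType} {n : nat}.
Variable U : 'M[C]_n.
Hypothesis UU : U *m U ^t* = 1%:M.
Implicit Types phi psi : 'I_n -> C.

(** Functions of the index rather than of the eigenvalue: a set of indices then defines a projector
    even when it separates equal eigenvalues. *)
Definition spec phi : 'M[C]_n := U ^t* *m diag_mx (\row_j phi j) *m U.

Lemma eq_spec phi psi : phi =1 psi -> spec phi = spec psi.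
Proof. by move=> h; rewrite /spec; congr (_ *m diag_mx _ *m _); apply/rowP => j; rewrite !mxE. Qed.

Lemma spec_mul phi psi : spec phi *m spec psi = spec (fun j => phi j * psi j).
Proof.
rewrite /spec -!mulmxA (mulmxA U) UU mul1mx !mulmxA; congr (_ *m _).
rewrite -mulmxA mulmx_diag; congr (_ *m diag_mx _).
by apply/rowP => j; rewrite !mxE.
Qed.

Lemma specD phi psi : spec phi + spec psi = spec (fun j => phi j + psi j).
Proof.
rewrite /spec -mulmxDl -mulmxDr -linearD; congr (_ *m diag_mx _ *m _).
by apply/rowP => j; rewrite !mxE.
Qed.

Lemma specZ c phi : c *: spec phi = spec (fun j => c * phi j).
Proof.
rewrite /spec scalemxAl scalemxAr -linearZ; congr (_ *m diag_mx _ *m _).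
by apply/rowP => j; rewrite !mxE.
Qed.

Lemma specB phi psi : spec phi - spec psi = spec (fun j => phi j - psi j).
Proof. by rewrite -scaleN1r specZ specD; apply: eq_spec => j; rewrite mulN1r. Qed.

Lemma spec1 : spec (fun _ => 1) = 1%:M.
Proof.
rewrite /spec (_ : \row_j 1 = const_mx 1); last by apply/rowP => j; rewrite !mxE.
by rewrite diag_const_mx mulmx1 (mulmx1C UU).
Qed.

Lemma spec_adj phi : (forall j, phi j \is Num.real) -> (spec phi) ^t* = spec phi.
Proof.
move=> h; rewrite /spec !adjM trmxCK mulmxA; congr (_ *m _ *m _).
rewrite tr_diag_mx map_diag_mx; congr diag_mx; apply/rowP => j; rewrite !mxE.
exact: conj_Creal.
Qed.

Lemma tr_spec_mul phi (N : 'M[C]_n) :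
  \tr (spec phi *m N) = \sum_j phi j * (U *m N *m U ^t*) j j.
Proof.
rewrite /spec -!mulmxA mxtrace_mulC -!mulmxA; apply: eq_bigr => j _.
rewrite mxE (bigD1 j)//= big1 ?addr0 => [|k kj]; last first.
  by rewrite !mxE eq_sym (negbTE kj) mulr0n mul0r.
by rewrite !mxE eqxx mulr1n.
Qed.

Lemma tr_spec phi : \tr (spec phi) = \sum_j phi j.
Proof.
rewrite -[spec phi]mulmx1 tr_spec_mul; apply: eq_bigr => j _.
by rewrite mulmx1 UU mxE eqxx mulr1.
Qed.

Lemma psd_spec phi : (forall j, 0 <= phi j) -> psd (spec phi).
Proof.
move=> h; pose r j := sqrtC (phi j).
have rr j : 0 <= r j by rewrite sqrtC_ge0.
have -> : spec phi = spec r *m spec r.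
  by rewrite spec_mul; apply: eq_spec => j; rewrite -expr2 sqrtCK.
rewrite -{2}(spec_adj (fun j => ger0_real (rr j))); exact: psd_mul_adj.
Qed.

Lemma conj_spec_entry phi j : (U *m spec phi *m U ^t*) j j = phi j.
Proof.
rewrite /spec !mulmxA UU mul1mx -mulmxA UU mulmx1 !mxE eqxx mulr1n.
by [].
Qed.

End SpectralCalculus.

(** * Singular values as sorted roots of Gram eigenvalues *)

Section SingularValues.
Context {R : realType} {m n : nat}.
Variable A : 'M[R[i]]_(m, n).
Local Notation C := R[i].
Local Notation Re := (@complex.Re R).

Let M := A ^t* *m A.
Let U := spectralmx M.
Definition gram_eig (j : 'I_n) : R := Re (spectral_diag (A ^t* *m A) 0 j).
Definition spec_gram := @spec _ _ (spectralmx (A ^t* *m A)).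

Lemma spectral_unitaryE : U *m U ^t* = 1%:M.
Proof. by apply/unitarymxP; exact: spectral_unitarymx. Qed.

Let Mspec : M = U ^t* *m diag_mx (spectral_diag M) *m U.
Proof.
have hM : M \is hermsymmx.
  apply/is_hermitianmxP; rewrite expr0 scale1r; apply/esym.
  by rewrite /M adjM trmxCK.
have /orthomx_spectralP {1}-> := hermitian_normalmx hM.
by rewrite invmx_unitary// spectral_unitarymx.
Qed.

Let diagE j : spectral_diag M 0 j = ((U *m A ^t*) *m (U *m A ^t*) ^t*) j j.
Proof.
have -> : (U *m A ^t*) *m (U *m A ^t*) ^t* = U *m M *m U ^t*.
  by rewrite adjM trmxCK /M !mulmxA.
rewrite {2}Mspec !mulmxA spectral_unitaryE mul1mx -mulmxA spectral_unitaryE mulmx1.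
by rewrite mxE eqxx mulr1n.
Qed.

Let diag_ge0 j : 0 <= spectral_diag M 0 j.
Proof.
by rewrite diagE mxE sumr_ge0// => k _; rewrite adjE mul_conjC_ge0.
Qed.

Lemma gram_eig_ge0 j : 0 <= gram_eig j.
Proof. by have := diag_ge0 j; rewrite lecE => /andP[]. Qed.

Lemma spectral_diagE j : spectral_diag M 0 j = (gram_eig j)%:C%C.
Proof.
rewrite /gram_eig; have := diag_ge0 j; rewrite /M; case: (spectral_diag _ _ _) => a b.
by rewrite lecE /= => /andP[/eqP->].
Qed.

Lemma gram_spec : A ^t* *m A = spec_gram (fun j => (gram_eig j)%:C%C).
Proof.
rewrite -/M {1}Mspec /spec_gram /spec; congr (_ *m diag_mx _ *m _).
by apply/rowP => j; rewrite mxE spectral_diagE.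
Qed.

Let sv j := Num.sqrt (gram_eig j).
(** Indices are sorted along with the values, so that the k largest values, ties included,
    correspond to k distinct indices. *)
Let t := sort (relpre sv >=%R) (enum 'I_n).
Let srt := sort >=%R [seq sv j | j <- enum 'I_n].

Let srtE : srt = map sv t. Proof. by rewrite /srt sort_map. Qed.

Let t_perm : perm_eq t (enum 'I_n).
Proof. by rewrite /t perm_sort. Qed.

Let t_uniq : uniq t. Proof. by rewrite (perm_uniq t_perm) enum_uniq. Qed.
Let t_size : size t = n. Proof. by rewrite (perm_size t_perm) size_enum_ord. Qed.
Let mem_t j : j \in t. Proof. by rewrite (perm_mem t_perm) mem_enum. Qed.
Let srt_size : size srt = n. Proof. by rewrite srtE size_map. Qed.

Let srt_ge0 i : 0 <= nth 0 srt i.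
Proof.
have [h|h] := ltnP i (size srt); last by rewrite nth_default.
have : nth 0 srt i \in srt by exact: mem_nth.
by rewrite {2}srtE => /mapP[j _ ->]; exact: sqrtr_ge0.
Qed.

Let srt_anti i j : (i <= j)%N -> nth 0 srt j <= nth 0 srt i.
Proof.
move=> ij; have [h|h] := ltnP j (size srt); last by rewrite nth_default.
have s : sorted >=%R srt.
  by apply: sort_sorted => x y; rewrite orbC; exact: le_total.
have tr : transitive (>=%R : rel R) by move=> x y z /= h1 h2; exact: le_trans h2 h1.
apply: (sorted_leq_nth tr _ _ s); rewrite ?inE//; first by move=> x; exact: lexx.
exact: leq_ltn_trans ij h.
Qed.

(* The first i + 1 right singular vectors have orthogonal nonzero images in
   C^m if their singular values are positive. *)
Let srt_pos i : 0 < nth 0 srt i -> (i < m)%N.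
Proof.
move=> h; have isz : (i < size t)%N.
  by rewrite t_size -srt_size ltnNge; apply: contraTN h => hi; rewrite nth_default ?ltxx.
have [j0 _] : exists j : 'I_n, True.
  by have : (0 < n)%N; [rewrite -t_size (leq_ltn_trans _ isz)|case: n => // n' _; exists ord0].
pose f (a : 'I_i.+1) := nth j0 t a.
have fsz (a : 'I_i.+1) : (a < size t)%N by rewrite (leq_trans (ltn_ord a)).
pose B : 'M[C]_(i.+1, m) := rowsub f (U *m A ^t*).
have BB : B *m B ^t* = diag_mx (\row_a (gram_eig (f a))%:C%C).
  have -> : B *m B ^t* = mxsub f f (U *m A ^t* *m (U *m A ^t*) ^t*).
    by apply/matrixP => a b; rewrite !mxE; apply: eq_bigr => c _; rewrite !mxE.
  have -> : (U *m A ^t*) *m (U *m A ^t*) ^t* = diag_mx (spectral_diag M).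
    have -> : (U *m A ^t*) *m (U *m A ^t*) ^t* = U *m M *m U ^t*.
      by rewrite adjM trmxCK /M !mulmxA.
    by rewrite {1}Mspec !mulmxA spectral_unitaryE mul1mx -mulmxA spectral_unitaryE mulmx1.
  apply/matrixP => a b; rewrite !mxE spectral_diagE.
  by rewrite /f nth_uniq.
have BBu : B *m B ^t* \in unitmx.
  rewrite unitmxE unitfE BB det_diag; apply/prodf_neq0 => a _; rewrite mxE.
  have : 0 < sv (f a).
    have -> : sv (f a) = nth 0 srt a by rewrite srtE (nth_map j0).
    by apply: (lt_le_trans h); apply: srt_anti; rewrite -ltnS.
  by rewrite /sv sqrtr_gt0 => p; rewrite gt_eqF// ltcR.
have := mxrankM_maxl B (B ^t*); rewrite mxrank_unit// => /leq_trans; apply.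
exact: rank_leq_col.
Qed.

(** The truncation at [minn m n] drops only zeros: by [srt_pos] a positive value at position i
    forces i < m, and the list has length n. *)
Lemma sigmaE j : sigma A j = nth 0 srt j.-1.
Proof.
rewrite /sigma /singular_values -/srt.
have [h|h] := ltnP j.-1 (minn m n); first by rewrite nth_take.
rewrite nth_default; last by rewrite size_take_min geq_min h.
have [//|h2] := eqVneq (nth 0 srt j.-1) 0.
have p : 0 < nth 0 srt j.-1 by rewrite lt_def h2 srt_ge0.
have := srt_pos p; move: h; rewrite geq_min leqNgt => /orP[/negbTE->//|h _].
by move: p; rewrite nth_default ?ltxx// srt_size.
Qed.

Lemma top_singular_indices k : (1 <= k)%N -> 0 < sigma A k -> exists J : {set 'I_n},
  [/\ #|J| = k, forall j, j \in J -> sigma A k ^+ 2 <= gram_eig j,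
      forall j, j \notin J -> gram_eig j <= sigma A k.+1 ^+ 2,
      0 <= sigma A k.+1 <= sigma A k &
      \sum_(k.+1 <= j < (minn m n).+1) sigma A j ^+ 2 = \sum_(j | j \notin J) gram_eig j].
Proof.
move=> k1; rewrite !sigmaE /= => sk.
have kn : (k <= n)%N.
  rewrite -srt_size -(prednK k1) ltnNge; apply: contraTN sk => h.
  by rewrite nth_default ?ltxx.
have svE j : sv j ^+ 2 = gram_eig j by rewrite sqr_sqrtr// gram_eig_ge0.
exists [set j in take k t]; split.
- rewrite cardsE (card_uniqP _) ?take_uniq// size_takel// t_size//.
- move=> j; rewrite inE => jk; rewrite -svE ler_sqr ?nnegrE ?sqrtr_ge0//.
  have i1 : (index j t < k)%N by rewrite -in_take.
  have -> : sv j = nth 0 srt (index j t) by rewrite srtE (nth_map j) ?nth_index ?index_mem.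
  by apply: srt_anti; rewrite -ltnS prednK.
- move=> j; rewrite inE => jk; rewrite -svE ler_sqr ?nnegrE ?sqrtr_ge0//.
  have i1 : (k <= index j t)%N by rewrite leqNgt; apply: contra jk => h; rewrite in_take.
  have -> : sv j = nth 0 srt (index j t) by rewrite srtE (nth_map j) ?nth_index ?index_mem.
  exact: srt_anti.
- by rewrite srt_ge0 srt_anti// leq_pred.
(* Singular values count from 1 and list positions from 0; positions from [minn m n] on contribute 0
   by [srt_pos]. *)
have -> : \sum_(k.+1 <= j < (minn m n).+1) sigma A j ^+ 2 =
    \sum_(k <= j < n) nth 0 srt j ^+ 2.
  rewrite big_add1 /=; under eq_bigr do rewrite sigmaE /=.
  have [kmn|kmn] := leqP k (minn m n); last first.
    rewrite big_geq ?(ltnW kmn)//; apply/esym; rewrite big_nat big1// => i /andP[ki i_n].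
    have [->|h] := eqVneq (nth 0 srt i) 0; first by rewrite expr0n.
    have := @srt_pos i; rewrite lt_def h srt_ge0 => /(_ isT) im.
    by move: kmn; rewrite ltnNge leq_min (leq_trans ki (ltnW im)) (leq_trans ki (ltnW i_n)).
  rewrite [RHS](big_cat_nat (n := minn m n))//= ?geq_minr//.
  rewrite [X in _ = _ + X]big_nat [X in _ = _ + X]big1 ?addr0// => i /andP[mi i_n].
  have [->|h] := eqVneq (nth 0 srt i) 0; first by rewrite expr0n.
  have := @srt_pos i; rewrite lt_def h srt_ge0 => /(_ isT) im.
  by move: mi; rewrite leqNgt leq_min im i_n.
have -> : \sum_(k <= j < n) nth 0 srt j ^+ 2 = \sum_(x <- drop k srt) x ^+ 2.
  rewrite [RHS](big_nth 0) size_drop srt_size -[k in LHS]add0n big_addn.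
  by apply: eq_bigr => i _; rewrite nth_drop addnC.
rewrite srtE -map_drop big_map; under eq_bigr do rewrite svE.
rewrite [RHS](eq_bigl (fun j => (j \in 'I_n) && (j \notin take k t))); last by move=> j; rewrite inE.
rewrite -big_enum_cond /= -(perm_big _ t_perm) /=.
have -> : \sum_(i <- t | i \notin take k t) gram_eig i =
    \sum_(i <- take k t | i \notin take k t) gram_eig i +
    \sum_(i <- drop k t | i \notin take k t) gram_eig i.
  by rewrite -{1}(cat_take_drop k t) big_cat.
rewrite [X in _ = X + _]big1_seq ?add0r; last by move=> j /andP[/negbTE->].
rewrite big_seq [RHS]big_seq_cond; apply: eq_bigl => j.
case jd: (j \in drop k t) => //=; apply/esym/negP => jt.
have := t_uniq; rewrite -(cat_take_drop k t) cat_uniq => /and3P[_ /hasPn h _].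
by have := h j jd; rewrite /= jt.
Qed.

End SingularValues.

(** * From subspace iteration to the weighted defect *)

Section Reduction.
Context {R : realType} {m n : nat}.
Variable A : 'M[R[i]]_(m, n).
Local Notation C := R[i].
Local Notation Re := (@complex.Re R).
Local Notation lam j := (gram_eig A j)%:C%C.
Local Notation sp := (spec_gram A).
Let UU := spectral_unitaryE A.

Lemma eq_spec_gram phi psi : phi =1 psi -> sp phi = sp psi.
Proof. exact: eq_spec. Qed.

Lemma spec_gram_mul phi psi : sp phi *m sp psi = sp (fun j => phi j * psi j).
Proof. exact: (spec_mul UU). Qed.

Lemma spec_gram1 : sp (fun=> 1) = 1%:M.
Proof. exact: (spec1 UU). Qed.

Lemma subspace_iteration_factor l (V : 'M[C]_(n, l)) q r (Q : 'M[C]_(m, r)) :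
  subspace_iteration A V q Q ->
  Q ^t* *m Q = 1%:M /\ exists S : 'M[C]_(r, l), A *m sp (fun j => lam j ^+ q) *m V = Q *m S.
Proof.
elim: q r Q => [|q IH] r Q /=.
  move=> [S [YE QQ _ _]]; split => //; exists S.
  have -> : sp (fun j => lam j ^+ 0) = 1%:M by rewrite -spec_gram1; exact: eq_spec_gram.
  by rewrite mulmx1 -YE.
move=> [r0 [Q0 [r1 [Q1 [T1 [S [/IH[_ [S0 hS0]] [E1 _ _ _] [E2 QQ _ _]]]]]]]].
(* The QR factors accumulate: A A^H Q0 S0 = A Q1 T1 S0 = Q S T1 S0. *)
split => //; exists (S *m T1 *m S0).
have -> : sp (fun j => lam j ^+ q.+1) = A ^t* *m A *m sp (fun j => lam j ^+ q).
  by rewrite {1}gram_spec spec_gram_mul; apply: eq_spec_gram => j; rewrite exprS.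
by rewrite !mulmxA -E2 -(mulmxA A Q1) -E1 -!mulmxA -hS0 !mulmxA.
Qed.

Lemma frobenius_norm_sqr p k (B : 'M[C]_(p, k)) :
  frobenius_norm B ^+ 2 = Re (\tr (B *m B ^t*)).
Proof.
rewrite sqr_sqrtr; last by rewrite sumr_ge0// => i _; rewrite sumr_ge0// => j _; rewrite exprn_ge0// normc_ge0.
rewrite raddf_sum; apply: eq_bigr => i _; rewrite mxE raddf_sum; apply: eq_bigr => j _.
rewrite adjE; case: (B i j) => a b /=.
by rewrite sqr_sqrtr ?addr_ge0 ?sqr_ge0//; ring.
Qed.

(* Termwise; off J the difference is (s^q - a_j^q) (a_j - delta_j). *)
Lemma weighted_residual_le (I : finType) (J : {set I}) (a delta : I -> R) (s F : R) q :
  0 < s -> (forall j, j \in J -> s <= a j) -> (forall j, j \notin J -> a j <= s) ->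
  (forall j, 0 <= a j) -> (forall j, 0 <= delta j <= a j) ->
  \sum_j a j ^+ q * delta j <= F ->
  \sum_j delta j <= \sum_(j | j \notin J) a j +
    (s ^+ q)^-1 * (F - \sum_(j | j \notin J) a j ^+ q.+1).
Proof.
move=> s0 sJ sJc a0 dj hF; have sq0 : 0 < s ^+ q by rewrite exprn_gt0.
rewrite -(ler_pM2l sq0) mulrDr mulrA mulfV ?gt_eqF// mul1r.
apply: (@le_trans _ _ (\sum_j a j ^+ q * delta j +
    \sum_(j | j \notin J) (s ^+ q * a j - a j ^+ q.+1))); last first.
  by rewrite sumrB mulr_sumr addrCA lerD2l lerD2r.
rewrite mulr_sumr [X in _ <= _ + X]big_mkcond -big_split; apply: ler_sum => j _ /=.
have /andP[d0 da] := dj j; have [jJ|jJ] := boolP (j \in J).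
  by rewrite addr0 ler_wpM2r// lerXn2r ?nnegrE// ?(ltW s0)// sJ.
rewrite -subr_ge0.
have -> : a j ^+ q * delta j + (s ^+ q * a j - a j ^+ q.+1) - s ^+ q * delta j =
  (s ^+ q - a j ^+ q) * (a j - delta j) by rewrite exprS; ring.
by rewrite mulr_ge0// subr_ge0// lerXn2r ?nnegrE// ?(ltW s0)// sJc.
Qed.

Lemma trace_conj_real (N : 'M[C]_n) (phi : 'I_n -> R) : psd N ->
  Re (\tr (sp (fun j => (phi j)%:C%C) *m N)) =
  \sum_j phi j * Re ((spectralmx (A ^t* *m A) *m N *m (spectralmx (A ^t* *m A)) ^t*) j j).
Proof.
move=> pN; rewrite /spec_gram tr_spec_mul raddf_sum; apply: eq_bigr => j _.
exact: Re_realM.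
Qed.

Lemma psd_diag_ge0 p (N : 'M[C]_p) j : psd N -> 0 <= Re (N j j).
Proof.
move=> [k [X ->]]; have : 0 <= (X *m X ^t*) j j.
  by rewrite mxE sumr_ge0// => i _; rewrite adjE mul_conjC_ge0.
by rewrite lecE => /andP[].
Qed.

(** With K = 1 - Q Q^H, the entries [delta] are the diagonal of A^H K A in the eigenbasis; they sum
    to the squared error and lie between 0 and the eigenvalues. Weighted by the powers 2q they sum
    to the squared norm of K A (A^H A)^q, and [weighted_residual_le] removes the weights. *)
Lemma low_rank_error_le q l (V : 'M[C]_(n, l)) r (Q : 'M[C]_(m, r)) (J : {set 'I_n}) (s : R)
    (Z : 'M[C]_(l, n)) (D : 'M[C]_n) :
  subspace_iteration A V q Q -> 0 < s ->
  (forall j, j \in J -> s <= gram_eig A j) -> (forall j, j \notin J -> gram_eig A j <= s) ->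
  D = 1%:M - V *m Z ->
  frobenius_norm (A - Q *m Q ^t* *m A) ^+ 2 <=
  \sum_(j | j \notin J) gram_eig A j + (s ^+ (2 * q))^-1 *
    (Re (\tr (sp (fun j => lam j ^+ (2 * q).+1) *m (D *m D ^t*))) -
     \sum_(j | j \notin J) gram_eig A j ^+ (2 * q).+1).
Proof.
move=> /subspace_iteration_factor[QQ [S hS]] s0 sJ sJc DE.
pose K := 1%:M - Q *m Q ^t*.
have aK : K ^t* = K by rewrite /K adjB adj1 adjM trmxCK.
have KK : K *m K = K.
  by rewrite /K mulmxBl mul1mx mulmxBr mulmx1 mulmxA -(mulmxA Q) QQ mulmx1 subrr subr0.
have KQ : K *m Q = 0 by rewrite /K mulmxBl mul1mx -mulmxA QQ mulmx1 subrr.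
pose N := A ^t* *m K *m A.
have NE : N = (K *m A) ^t* *m (K *m A) by rewrite adjM aK /N !mulmxA -(mulmxA _ K K) KK.
have pN : psd N by rewrite NE -{2}[K *m A]trmxCK; exact: psd_mul_adj.
have -> : A - Q *m Q ^t* *m A = K *m A by rewrite /K mulmxBl mul1mx.
rewrite frobenius_norm_sqr mxtrace_mulC -NE.
set U := spectralmx (A ^t* *m A).
have trU (X : 'M[C]_n) : \tr (U *m X *m U ^t*) = \tr X.
  by rewrite mxtrace_mulC mulmxA (mulmx1C UU) mul1mx.
pose delta j := Re ((U *m N *m U ^t*) j j).
have -> : Re (\tr N) = \sum_j delta j.
  rewrite /delta -raddf_sum /=; congr Re.
  have -> : \sum_i (U *m N *m U ^t*) i i = \tr (U *m N *m U ^t*) by [].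
  by rewrite trU.
apply: weighted_residual_le => //.
- exact: gram_eig_ge0.
- move=> j; rewrite psd_diag_ge0 ?andTb; last exact: psd_congr.
  have pMN : psd (A ^t* *m A - N).
    have -> : A ^t* *m A - N = (A ^t* *m Q) *m (A ^t* *m Q) ^t*.
      rewrite /N /K mulmxBr mulmx1 mulmxBl opprB addrC subrK adjM trmxCK.
      by rewrite !mulmxA.
    exact: psd_mul_adj.
  have := psd_diag_ge0 j (psd_congr U pMN).
  rewrite mulmxBr mulmxBl mxE [X in _ + X]mxE ReD ReN subr_ge0 => /le_trans; apply.
  by rewrite gram_spec (conj_spec_entry UU).
pose f e : 'M[C]_n := sp (fun j => lam j ^+ e).
have fD a b : f a *m f b = f (a + b)%N.
  by rewrite /f spec_gram_mul; apply: eq_spec_gram => j; rewrite exprD.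
have fa a : (f a) ^t* = f a.
  apply: spec_adj => j; apply: rpredX; apply: ger0_real.
  by rewrite lecR gram_eig_ge0.
have -> : \sum_j gram_eig A j ^+ (2 * q) * delta j = Re (\tr (f (2 * q)%N *m N)).
  apply: etrans (esym (trace_conj_real (fun j => gram_eig A j ^+ (2 * q)) pN)) _.
  apply: (congr1 (fun F => Re (\tr (F *m N)))); apply: eq_spec_gram => j.
  exact: rmorphXn.
apply: Re_le; rewrite mul2n -addnn -[sp _]/(f (q + q).+1) -fD.
pose G := A *m f q.
have GG : G ^t* *m G = f (q + q).+1.
  have -> : G ^t* *m G = f q *m (A ^t* *m A) *m f q.
    by rewrite /G adjM fa; move: (f q) => F; rewrite !mulmxA.
  have -> : A ^t* *m A = f 1%N by rewrite gram_spec; apply: eq_spec_gram => j; rewrite expr1.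
  by rewrite fD fD addn1.
have hS' : G *m V = Q *m S by [].
have KfK : \tr (f q *m f q *m N) = \tr ((K *m G) ^t* *m (K *m G)).
  rewrite NE /G (mulmxA K A (f q)) [(K *m A *m f q) ^t*]adjM fa; move: (f q) (K *m A) => F B.
  by rewrite -[in LHS]mulmxA [LHS]mxtrace_mulC !mulmxA.
rewrite KfK -GG; move: (G) hS' => G0 hS' {KfK GG}.
(* K annihilates G0 V = Q S, so G0 V Z can be subtracted for any Z. *)
have -> : K *m G0 = K *m G0 *m D.
  by rewrite DE mulmxBr mulmx1 mulmxA -[K *m G0 *m V]mulmxA hS' mulmxA KQ !mul0mx subr0.
(* Dropping K loses exactly the squared norm of Q^H G0 D. *)
rewrite [in X in _ <= X]mulmxA [X in _ <= X]mxtrace_mulC -subr_ge0.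
have -> : \tr (D ^t* *m (G0 ^t* *m G0 *m D)) - \tr ((K *m G0 *m D) ^t* *m (K *m G0 *m D)) =
    \tr ((Q ^t* *m G0 *m D) ^t* *m (Q ^t* *m G0 *m D)).
  have KaK : (K *m G0 *m D) ^t* *m (K *m G0 *m D) = D ^t* *m G0 ^t* *m K *m G0 *m D.
    by rewrite !adjM aK -[in RHS]KK !mulmxA.
  rewrite -linearB KaK !adjM trmxCK; congr (\tr _).
  by rewrite /K mulmxBr mulmx1 !mulmxBl !mulmxA opprB addrC subrK.
by rewrite mxtrace_mulC; exact: mxtrace_mul_adj_ge0.
Qed.

End Reduction.

Local Open Scope complex_scope.

(** The output [Q w] is any admissible choice for each w, so its error need not be measurable. For
    nonnegative functions the integral is a supremum over simple functions below, which is monotone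
    all the same. *)
Lemma ge0_le_integral_nonmeasurable d (T : measurableType d) (R : realType)
  (mu : {measure set T -> \bar R}) (f g : T -> \bar R) :
  (forall x, (0 <= f x)%E) -> (forall x, (f x <= g x)%E) ->
  (\int[mu]_x f x <= \int[mu]_x g x)%E.
Proof.
move=> f0 fg; have g0 x : (0 <= g x)%E := le_trans (f0 x) (fg x).
rewrite !ge0_integralTE//; apply: le_ereal_sup => _ [h hf <-]; exists h => // x.
exact: le_trans (hf x) (fg x).
Qed.

Section Projectors.
Context {R : realType} {m n : nat}.
Variables (A : 'M[R[i]]_(m, n)) (J : {set 'I_n}).
Local Notation C := R[i].
Local Notation sp := (spec_gram A).
Local Notation lam j := (gram_eig A j)%:C%C.

Definition top_proj : 'M[C]_n := sp (fun j => (j \in J)%:R).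
Definition tail_power e : 'M[C]_n := sp (fun j => (j \notin J)%:R * lam j ^+ e).
Definition head_power e : 'M[C]_n := sp (fun j => (j \in J)%:R * lam j ^+ e).

Let UU := spectral_unitaryE A.
Let lamX_ge0 j e : 0 <= lam j ^+ e. Proof. by rewrite exprn_ge0// lecR gram_eig_ge0. Qed.

Lemma top_proj_adj : top_proj ^t* = top_proj.
Proof. by apply: spec_adj => j; exact: realn. Qed.

Lemma top_proj_idem : top_proj *m top_proj = top_proj.
Proof.
rewrite /top_proj spec_gram_mul; apply: eq_spec_gram => j.
by case: (j \in J); rewrite ?mulr1 ?mulr0.
Qed.

Lemma tr_top_proj : \tr top_proj = #|J|%:R.
Proof.
by rewrite (tr_spec UU) -natr_sum -sum1_card [in RHS]big_mkcond.
Qed.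

Lemma top_projC : 1%:M - top_proj = sp (fun j => (j \notin J)%:R).
Proof.
rewrite -(spec_gram1 A) [LHS](specB (spectralmx (A ^t* *m A))).
by apply: eq_spec_gram => j; case: (j \in J); rewrite ?subrr ?subr0.
Qed.

Lemma tail_powerE e : (1%:M - top_proj) *m tail_power e *m (1%:M - top_proj) = tail_power e.
Proof.
rewrite top_projC /tail_power !spec_gram_mul; apply: eq_spec_gram => j.
by case: (j \in J); rewrite /= ?mul1r ?mul0r ?mulr1.
Qed.

Lemma head_tail_power e : head_power e + tail_power e = sp (fun j => lam j ^+ e).
Proof.
rewrite [LHS](specD (spectralmx (A ^t* *m A))); apply: eq_spec_gram => j.
by rewrite -mulrDl; case: (j \in J); rewrite /= ?addr0 ?add0r mul1r.
Qed.

Lemma tail_power_psd e : psd (tail_power e).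
Proof. by apply: (psd_spec UU) => j; rewrite mulr_ge0. Qed.

(** Any finite multiple of the projector will do, because the multiple does not enter the conclusion
    of [mean_defect_bound]; the sum of all powers is a simple choice. *)
Lemma head_power_le e : psd ((\sum_j lam j ^+ e) *: top_proj - head_power e).
Proof.
rewrite /top_proj [_ *: _](specZ (spectralmx (A ^t* *m A))).
rewrite [_ - _](specB (spectralmx (A ^t* *m A))); apply: (psd_spec UU) => j.
rewrite mulrC -mulrBr mulr_ge0// (bigD1 j)//= addrAC subrr add0r.
by rewrite sumr_ge0.
Qed.

Lemma tr_tail_power e : complex.Re (\tr (tail_power e)) = \sum_(j | j \notin J) gram_eig A j ^+ e.
Proof.
rewrite (tr_spec UU) raddf_sum [RHS]big_mkcond; apply: eq_bigr => j _ /=.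
rewrite -[lam j ^+ e]/((real_complex R _) ^+ e) -rmorphXn /=.
by case: (j \in J); rewrite ?mul0r ?mul1r.
Qed.

End Projectors.

Theorem theorem2 (R : realType) (d : measure_display) (T : measurableType d)
    (P : probability T R) (m n k p q : nat) (A : 'M[R[i]]_(m, n))
    (hk : (1 <= k)%N) (hp : (2 <= p)%N)
    (hsigma : 0 < sigma A k) (hgap : gap A k < 1)
    (W : 'I_n -> 'I_(k + p) -> {RV P >-> R}) (hW : gaussian_matrix W)
    (r : T -> nat) (Q : forall w : T, 'M[R[i]]_(m, r w))
    (hQ : forall w : T, subspace_iteration A (cmatrix (sample W w)) q (Q w)) :
  ('E_P[fun w => (frobenius_norm (A - Q w *m (Q w) ^t* *m A) ^+ 2)%R]
   <= ((1 + k%:R / (p%:R - 1) * gap A k ^+ (4 * q))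
       * \sum_(k.+1 <= j < (minn m n).+1) sigma A j ^+ 2)%R%:E)%E.
Proof.
have [J [cJ sJ sJc /andP[s1_ge0 s1_le] ->]] := top_singular_indices hk hsigma.
pose s := sigma A k ^+ 2; have s0 : 0 < s by rewrite exprn_gt0.
have sq0 : 0 < s ^+ (2 * q) by rewrite exprn_gt0.
apply/lee_addgt0Pr => e e0.
have trJ : \tr (top_proj A J) = k%:R by rewrite tr_top_proj cJ.
have lam0 : 0 <= \sum_j (gram_eig A j)%:C ^+ (2 * q).+1 :> R[i].
  by rewrite sumr_ge0// => j _; rewrite exprn_ge0// lecR gram_eig_ge0.
have hH := head_power_le A J (2 * q).+1; have hX := tail_power_psd A J (2 * q).+1.
have hXE := tail_powerE A J (2 * q).+1.
have := mean_defect_bound hW (erefl (k + p)%N) hp (top_proj_adj A J) (top_proj_idem A J) trJ.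
(* The tolerance is e s^(2q), since the reduction divides by s^(2q) = sigma_k^(4q). *)
move=> /(_ _ _ _ _ lam0 hH hX hXE (mulr_gt0 e0 sq0))[B pB].
rewrite head_tail_power tr_tail_power.
set F := (fun V => _).
have tF : tame F by exact: tame_tr_defect.
set c0 := \sum_(j | j \notin J) gram_eig A j.
set c1 := \sum_(j | j \notin J) gram_eig A j ^+ (2 * q).+1.
move=> EF.
have sJs j : j \notin J -> gram_eig A j <= s.
  by move=> jJ; apply: le_trans (sJc j jJ) _; rewrite lerXn2r ?nnegrE// (le_trans s1_ge0).
pose G V := (c0 - (s ^+ (2 * q))^-1 * c1) + (s ^+ (2 * q))^-1 * F V.
have tcst : tame (fun _ : 'M[R]_(n, k + p) => c0 - (s ^+ (2 * q))^-1 * c1) by exact: tame_cst.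
have tZ : tame (fun V => (s ^+ (2 * q))^-1 * F V) by exact: tameZ.
have tG : tame G by exact: tameD.
have errG w : frobenius_norm (A - Q w *m (Q w) ^t* *m A) ^+ 2 <= G (sample W w).
  have := low_rank_error_le (Z := coef B (cmatrix (sample W w))) (hQ w) s0 sJ sJs (erefl _).
  move/le_trans; apply; rewrite -/c0 -/c1 /G /F le_eqVlt; apply/orP; left; apply/eqP.
  by rewrite mulrBr addrA addrAC.
have EG : Ex W G = (c0 - (s ^+ (2 * q))^-1 * c1) + (s ^+ (2 * q))^-1 * Ex W F.
  by rewrite /G (ExD hW)// (Ex_cst W) (ExZ hW).
apply: (@le_trans _ _ (Ex W G)%:E).
  rewrite /Ex /Rintegral fineK; last exact: integrable_fin_num (tame_integrable hW tG).
  rewrite unlock; apply: ge0_le_integral_nonmeasurable => w /=.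
    by rewrite lee_fin sqr_ge0.
  by rewrite lee_fin.
rewrite EG -EFinD lee_fin.
(* Of the 2q + 1 powers of a tail eigenvalue, 2q are bounded by sigma_(k+1)^2; they become the
   numerator of the gap factor. *)
have c1_le : c1 <= (sigma A k.+1 ^+ 2) ^+ (2 * q) * c0.
  rewrite /c1 /c0 mulr_sumr; apply: ler_sum => j jJ.
  rewrite exprSr ler_wpM2r ?gram_eig_ge0// lerXn2r ?nnegrE ?gram_eig_ge0 ?sqr_ge0//.
  exact: sJc.
have p1 : 0 <= k%:R / (p%:R - 1) :> R by rewrite divr_ge0// subr_ge0 ler1n ltnW.
have gapE : gap A k ^+ (4 * q) = (s ^+ (2 * q))^-1 * (sigma A k.+1 ^+ 2) ^+ (2 * q).
  by rewrite /gap /s -!exprM mulnA expr_div_n mulrC.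
have iv0 : 0 <= (s ^+ (2 * q))^-1 by rewrite invr_ge0 ltW.
have h1 := ler_wpM2l iv0 EF; have h2 := ler_wpM2l (mulr_ge0 p1 iv0) c1_le.
rewrite gapE; move: (Ex W F) h1 h2 => f h1 h2.
(* The term c1 / s^(2q) is subtracted once and added 1 + k / (p - 1) times, so only the share k / (p
   - 1) is multiplied by the gap factor, while c0 keeps the factor 1. *)
apply: (le_trans (lerD (lexx _) h1)).
have -> : (s ^+ (2 * q))^-1 * ((1 + k%:R / (p%:R - 1)) * c1 + e * s ^+ (2 * q)) =
   (s ^+ (2 * q))^-1 * c1 + k%:R / (p%:R - 1) * (s ^+ (2 * q))^-1 * c1 + e.
  rewrite mulrDr [e * _]mulrC mulKf ?gt_eqF//; congr (_ + _); ring.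
move: (s ^+ (2 * q))^-1 (k%:R / (p%:R - 1)) ((sigma A k.+1 ^+ 2) ^+ (2 * q)) h2 => u v w h2.
rewrite addrA addrA subrK lerD2r mulrDl mul1r lerD2l.
by rewrite !mulrA in h2 *.
Qed.
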